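(* Let $\ell>0$, let $\mathcal{V}=\mathbb{R}$ or $\mathcal{V}=(-1,+1)$, and let $\mu$ be a Borel probability measure on $\mathcal{V}$ with $\int_{\mathcal{V}} v\,d\mu(v)=0$. Let $g\in L^2(-\ell,+\ell)$, let $0<\beta\le 2$, and let $(\sigma^\varepsilon)_{\varepsilon>0}$ be a family of differentiable functions on $(-\ell,+\ell)$ for which there are constants $\mathfrak{a},\mathfrak{b},\mathfrak{c}>0$ independent of $\varepsilon$ with $$0<\mathfrak{a}\le\sigma^\varepsilon(x)\le\mathfrak{b}<+\infty\ \ \forall x\in(-\ell,+\ell),\qquad \Big\|\frac{d\sigma^\varepsilon}{dx}\Big\|_{L^\infty(-\ell,+\ell)}\le\mathfrak{c}\,\varepsilon^{-\beta}.$$ Let $\sigma^*$ be the $L^\infty$ weak-$*$ limit of $\sigma^\varepsilon$ as $\varepsilon\to0$. For each $\varepsilon>0$ let $f^\varepsilon(x,v)$ be the solution of $$f^\varepsilon+\frac1\varepsilon v\frac{df^\varepsilon}{dx}+\frac{\sigma^\varepsilon(x)}{\varepsilon^2}\big(f^\varepsilon-\langle f^\varepsilon\rangle\big)=g(x)\quad\text{for }(x,v)\in(-\ell,+\ell)\times\mathcal{V},$$ with zero incoming boundary data, i.e. $f^\varepsilon(-\ell,v)=0$ for $v\in\mathcal{V}$ with $v>0$ and $f^\varepsilon(+\ell,v)=0$ for $v\in\mathcal{V}$ with $v<0$. Then, as $\varepsilon\to0$, $$f^\varepsilon(x,v)\rightharpoonup\rho(x)\quad\text{weakly in }L^2\big((-\ell,+\ell)\times\mathcal{V};dx\,d\mu\big),$$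 where $\rho$ is the unique solution of the stationary diffusion equation $$\rho(x)-\frac{d}{dx}\left(\frac{\mathfrak{D}}{\sigma^*}\frac{d\rho}{dx}\right)=g(x)\ \text{ for }x\in(-\ell,+\ell),\qquad \rho(x)=0\ \text{ for }x=\pm\ell,$$ and $\mathfrak{D}$ is the constant $\langle v^2\rangle$.
   Context: Notation: $\langle h\rangle:=\int_{\mathcal{V}}h(v)\,d\mu(v)$ for $h\in L^1(\mathcal{V};d\mu)$; in particular $\langle f^\varepsilon\rangle(x)=\int_{\mathcal{V}}f^\varepsilon(x,v)\,d\mu(v)$ and $\langle v^2\rangle=\int_{\mathcal{V}}v^2\,d\mu(v)$. The diffusion equation with Dirichlet boundary condition is understood in the weak ($H^1_0$) sense.
   Formalization: The second moment of μ is assumed finite, since otherwise 𝔇 is undefined, and existence of ρ is asserted only for 𝔇>0: for μ=δ_0 and g=1 the diffusion problem reads ρ=1 and has no H^1_0 solution; uniqueness and convergence are stated for every solution ρ. *)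

(* Defs.v *)
From HB Require Import structures.
From mathcomp Require Import all_boot all_order all_algebra.
From mathcomp Require Import all_classical all_reals all_analysis.

Set Implicit Arguments.
Unset Strict Implicit.
Unset Printing Implicit Defensive.

Import Order.TTheory GRing.Theory Num.Theory.
Import numFieldNormedType.Exports.

Local Open Scope classical_set_scope.
Local Open Scope ring_scope.

Definition slab (R : realType) (l : R) : set R := [set` `]- l, l[%R].

(* Functions on a measurable subset D of T are represented by functions on T
   whose values off D are irrelevant; Lfun asks for measurability and for a
   finite L^p norm of the extension by 0. *)
Definition Lon d (T : measurableType d) (R : realType)
    (m : {measure set T -> \bar R}) (p : \bar R) (D : set T) (f : T -> R) :=
  f \_ D \in Lfun m p.

Definition norm_on d (T : measurableType d) (R : realType)
    (m : {measure set T -> \bar R}) (p : \bar R) (D : set T) (f : T -> R) :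
    \bar R :=
  ('N[m]_p[EFin \o (f \_ D)])%E.

Section Sobolev.
Variables (R : realType) (l : R).
Local Notation leb := (@lebesgue_measure R).
Implicit Types u du phi : R -> R.

(* C^1 functions with compact support in ]-l, l[ *)
Definition C1c phi :=
  [/\ forall x, derivable phi x 1, continuous (derive1 phi) &
      exists2 r, r < l & forall x, r < `|x| -> phi x = 0].

Definition weak_deriv u du := forall phi, C1c phi ->
  \int[leb]_(x in slab l) (u x * derive1 phi x) =
  - \int[leb]_(x in slab l) (du x * phi x).

(* u is in H^1(]-l, l[), with weak derivative du *)
Definition H1 u du :=
  [/\ Lon leb 2%:E (slab l) u, Lon leb 2%:E (slab l) du & weak_deriv u du].

(* H^1_0 is the closure of C^1_c in H^1. *)
Definition H10 u du := H1 u du /\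
  forall e : R, 0 < e -> exists2 phi, C1c phi &
    (norm_on leb 2%:E (slab l) (u \- phi)%R < e%:E)%E /\
    (norm_on leb 2%:E (slab l) (du \- derive1 phi)%R < e%:E)%E.

(* u is absolutely continuous on [-l, l], with a.e. derivative du *)
Definition primitive u du := Lon leb 1%E (slab l) du /\
  forall x, -l <= x <= l -> u x = u (- l) + \int[leb]_(y in `]- l, x[) du y.

End Sobolev.

Section Problems.
Variables (R : realType) (l : R).
Local Notation leb := (@lebesgue_measure R).

(* A Borel probability measure on V is represented by a probability measure mu
   on R with mu V = 1. *)
Definition vavg (V : set R) (mu : probability (measurableTypeR R) R)
  (h : R -> R) : R := \int[mu]_(v in V) h v.

(* df stands for the x-derivative of f(., v); it is unconstrained for v = 0,
   where the streaming term v * df vanishes. f is an L^2 class: for v != 0 the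
   boundary conditions bear on the absolutely continuous representative u of
   f(., v), which exists because v * df is square integrable. *)
Definition transport_sol (V : set R) (mu : probability (measurableTypeR R) R)
    (eps : R) (sig g : R -> R) (f : R * R -> R) :=
  Lon (leb \x mu)%E 2%:E (slab l `*` V) f /\
  {ae mu, forall v, V v -> exists df : R -> R,
    {ae leb, forall x, slab l x ->
      f (x, v) + eps^-1 * v * df x
        + sig x / eps ^+ 2 * (f (x, v) - vavg V mu (fun w => f (x, w))) = g x} /\
    (v != 0 -> exists u : R -> R,
      [/\ primitive l u df,
          {ae leb, forall x, slab l x -> f (x, v) = u x},
          0 < v -> u (- l) = 0 &
          v < 0 -> u l = 0])}.

(* Variational solution of rho - (D / s * rho')' = g with rho(-l) = rho(l) = 0 *)
Definition diffusion_sol (D : R) (s g rho : R -> R) :=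
  exists drho, H10 l rho drho /\
  forall phi dphi, H10 l phi dphi ->
    \int[leb]_(x in slab l) (rho x * phi x + D / s x * drho x * dphi x) =
    \int[leb]_(x in slab l) (g x * phi x).

(* Convergence to s in the weak-* topology of L^oo, as eps tends to 0 *)
Definition weak_star_lim (sig : R -> R -> R) (s : R -> R) :=
  Lon leb +oo%E (slab l) s /\
  forall phi, Lon leb 1%E (slab l) phi ->
    \int[leb]_(x in slab l) (sig eps x * phi x) @[eps --> 0^'+] -->
    \int[leb]_(x in slab l) (s x * phi x).

End Problems.

Definition weak_L2_lim d (T : measurableType d) (R : realType)
    (m : {measure set T -> \bar R}) (D : set T) (f : R -> T -> R) (h : T -> R) :=
  Lon m 2%:E D h /\
  forall psi, Lon m 2%:E D psi ->
    \int[m]_(z in D) (f eps z * psi z) @[eps --> 0^'+] -->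
    \int[m]_(z in D) (h z * psi z).

(* Main.v *)
Require Import Defs.
From HB Require Import structures.
From mathcomp Require Import all_boot all_order all_algebra.
From mathcomp Require Import all_classical all_reals all_analysis.
From mathcomp Require Import measurable_realfun ess_sup_inf ring lra.
Import Order.TTheory GRing.Theory Num.Theory.
Import numFieldNormedType.Exports.
Local Open Scope classical_set_scope.
Local Open Scope ring_scope.

(* The mean F = <f>, the flux j = <v f> / eps and the pressure P = <v^2 f> are
   compared with rho and its flux J = - (D / sigma* ) rho' by energy estimates.
   The dissipation gives f - F = O(eps) in L^2 and bounds j.  Integrating the
   equation against 1 and v yields j' = g - F and P' = - (eps^2 + sigma) j, while
   P - D F tends to 0 and the end values of P tend to 0, since incoming traces
   vanish and outgoing ones are controlled by the dissipated energy.  Testing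
   the equation for j - J with sigma (j - J) bounds D |F - rho|^2 by small terms
   and the primitive of (sigma - sigma* ) J, which tends to 0 pointwise and
   boundedly: in one dimension only the weak-* limit of sigma is seen.  Hence f
   converges to rho even strongly in L^2.  When D = 0, v vanishes almost surely
   and F = g.  The diffusion problem is solved by Volterra iteration and shooting
   on J(-l). *)

Set Implicit Arguments.
Unset Strict Implicit.
Unset Printing Implicit Defensive.

(** Put e = F - rho, k = j - J and let s be the limit of sigma. Up to small terms the two systems
    subtract to k' = - e and D e' = - sigma k - (sigma - s) J. Multiplying the latter by k and
    integrating by parts gives D |e|^2 and the integral of sigma k^2 with the same sign, and leaves
    the defect (sigma - s) J only as a primitive paired with e. The product sigma j of two weakly
    convergent factors is thus never passed to the limit. As F is only known to be in L^2 and has no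
    trace, the computation runs on P, whose derivative is square integrable, with P - D F as an L^2
    error. Derivatives and traces occur only through primitives: v f is its value at -l plus the
    primitive of v df/dx. Lebesgue measure is replaced by its restriction to the slab, a finite
    atomless measure on the line, so that integrals and almost everywhere statements carry no
    domain. Since only a second moment of v is available, v^2 f is formed as v times v f, where v f
    is in L^2 because it is a primitive in x. *)

Lemma sqr_le_abs (R : realDomainType) (x C : R) : `|x| <= C -> x ^+ 2 <= C ^+ 2.
Proof. by rewrite ler_norml => /andP[? ?]; nra. Qed.

(** * Square integrable functions *)

Section L2.
Context d (T : measurableType d) (R : realType).
Variable m : {measure set T -> \bar R}.
Implicit Types f g h : T -> R.

Definition L1 f := m.-integrable setT (EFin \o f).

Definition L2 f := measurable_fun setT f /\ L1 (f \* f).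

Definition ip f g := \int[m]_x (f \* g) x.

Lemma L1_le f g : measurable_fun setT f -> L1 g ->
  (forall x, `|f x| <= g x) -> L1 f.
Proof.
move=> mf ig fg; apply: (le_integrable measurableT _ _ ig).
  exact/measurable_EFinP.
by move=> x _ /=; rewrite lee_fin (le_trans (fg x)) // ler_norm.
Qed.

Lemma L1_meas f : L1 f -> measurable_fun setT f.
Proof. by case/integrableP => /measurable_EFinP. Qed.

Lemma L1D f g : L1 f -> L1 g -> L1 (f \+ g).
Proof. by move=> f1 g1; have := integrableD measurableT f1 g1. Qed.

Lemma L1B f g : L1 f -> L1 g -> L1 (f \- g).
Proof. by move=> f1 g1; have := integrableB measurableT f1 g1. Qed.

Lemma L1Z k f : L1 f -> L1 (k \*o f).
Proof. by move=> f1; have := integrableZl measurableT k f1. Qed.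

Lemma L2M f g : L2 f -> L2 g -> L1 (f \* g).
Proof.
move=> [mf f2] [mg g2]; apply: (L1_le _ (L1D f2 g2)).
  exact: measurable_funM.
move=> x /=; rewrite ler_norml.
have := sqr_ge0 (f x + g x); have := sqr_ge0 (f x - g x).
have := sqr_ge0 (f x); have := sqr_ge0 (g x).
by move=> *; apply/andP; split; nra.
Qed.

Lemma L2D f g : L2 f -> L2 g -> L2 (f \+ g).
Proof.
move=> f2 g2; have [mf f2'] := f2; have [mg g2'] := g2.
split; first exact: measurable_funD.
have -> : (f \+ g) \* (f \+ g) = (f \* f \+ g \* g) \+ 2 \*o (f \* g).
  by apply/funext => x /=; ring.
by apply: L1D; [exact: L1D|apply: L1Z; exact: L2M].
Qed.

Lemma L2Z k f : L2 f -> L2 (k \*o f).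
Proof.
move=> [mf f2]; split; first exact: measurable_funM.
have -> : (k \*o f) \* (k \*o f) = (k ^+ 2) \*o (f \* f).
  by apply/funext => x /=; ring.
exact: L1Z.
Qed.

Lemma L2B f g : L2 f -> L2 g -> L2 (f \- g).
Proof.
move=> f2 g2; have -> : f \- g = f \+ (-1) \*o g.
  by apply/funext => x /=; ring.
exact/L2D/L2Z.
Qed.

Lemma L2_mull C h f : measurable_fun setT h -> (forall x, `|h x| <= C) ->
  L2 f -> L2 (h \* f).
Proof.
move=> mh hC [mf f2]; split; first exact: measurable_funM.
apply: (L1_le _ (L1Z (C ^+ 2) f2)).
  by apply: measurable_funM; exact: measurable_funM.
move=> x /=; rewrite ger0_norm -!expr2 ?sqr_ge0 // exprMn.
by rewrite ler_wpM2r ?sqr_ge0 // sqr_le_abs.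
Qed.

Lemma ipC f g : ip f g = ip g f.
Proof. by apply: eq_Rintegral => x _ /=; rewrite mulrC. Qed.

Lemma RintD f g : L1 f -> L1 g -> \int[m]_x (f \+ g) x =
  \int[m]_x f x + \int[m]_x g x.
Proof. by move=> f1 g1; rewrite RintegralD. Qed.

Lemma RintB f g : L1 f -> L1 g -> \int[m]_x (f \- g) x =
  \int[m]_x f x - \int[m]_x g x.
Proof. by move=> f1 g1; rewrite RintegralB. Qed.

Lemma RintZ k f : L1 f -> \int[m]_x (k \*o f) x = k * \int[m]_x f x.
Proof. by move=> f1; rewrite RintegralZl. Qed.

Lemma ip0l f : ip (cst 0) f = 0.
Proof.
rewrite /ip (_ : cst 0 \* f = cst 0); first by rewrite Rintegral_cst // mul0r.
by apply/funext => x /=; rewrite mul0r.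
Qed.

Lemma ipDl f g h : L2 f -> L2 g -> L2 h -> ip (f \+ g) h = ip f h + ip g h.
Proof.
move=> f2 g2 h2; rewrite -RintD; try exact: L2M.
by apply: eq_Rintegral => x _ /=; ring.
Qed.

Lemma ipBl f g h : L2 f -> L2 g -> L2 h -> ip (f \- g) h = ip f h - ip g h.
Proof.
move=> f2 g2 h2; rewrite -RintB; try exact: L2M.
by apply: eq_Rintegral => x _ /=; ring.
Qed.

Lemma ipZl k f g : L2 f -> L2 g -> ip (k \*o f) g = k * ip f g.
Proof.
move=> f2 g2; rewrite -RintZ; try exact: L2M.
by apply: eq_Rintegral => x _ /=; ring.
Qed.

Lemma ipDr f g h : L2 f -> L2 g -> L2 h -> ip h (f \+ g) = ip h f + ip h g.
Proof. by move=> *; rewrite !(ipC h) ipDl. Qed.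

Lemma ipBr f g h : L2 f -> L2 g -> L2 h -> ip h (f \- g) = ip h f - ip h g.
Proof. by move=> *; rewrite !(ipC h) ipBl. Qed.

Lemma ipZr k f g : L2 f -> L2 g -> ip f (k \*o g) = k * ip f g.
Proof. by move=> *; rewrite !(ipC f) ipZl. Qed.

Lemma ip_ge0 f : 0 <= ip f f.
Proof. by apply: Rintegral_ge0 => x _ /=; rewrite -expr2 sqr_ge0. Qed.

Lemma ip_cauchy f g : L2 f -> L2 g -> ip f g ^+ 2 <= ip f f * ip g g.
Proof.
move=> f2 g2.
have key t : 0 <= ip f f - 2 * t * ip f g + t ^+ 2 * ip g g.
  have tg := L2Z t g2.
  have := ip_ge0 (f \- t \*o g); rewrite ipBl ?ipBr ?ipZl ?ipZr //; last exact: L2B.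
  by rewrite (ipC g f); lra.
have := ip_ge0 f; have := ip_ge0 g.
rewrite le_eqVlt => /predU1P[g0|gp] fp.
  rewrite -g0 mulr0; have [->|fg0] := eqVneq (ip f g) 0; first by rewrite expr0n.
  (* With [ip g g = 0] the quadratic in t is affine, and this t would give it the value -1. *)
  have := key ((ip f f + 1) / (2 * ip f g)); rewrite -g0 mulr0 addr0.
  have -> : 2 * ((ip f f + 1) / (2 * ip f g)) * ip f g = ip f f + 1 by field.
  by move=> H; exfalso; lra.
(* The minimiser of the quadratic in t. *)
have := key (ip f g / ip g g).
have -> : ip f f - 2 * (ip f g / ip g g) * ip f g + (ip f g / ip g g) ^+ 2 * ip g g
   = (ip f f * ip g g - ip f g ^+ 2) / ip g g.
  by field; rewrite gt_eqF.
by rewrite pmulr_lge0 ?invr_gt0 // subr_ge0.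
Qed.

Lemma ip_cauchy_abs f g : L2 f -> L2 g ->
  `|ip f g| <= Num.sqrt (ip f f) * Num.sqrt (ip g g).
Proof.
move=> f2 g2; rewrite -sqrtrM ?ip_ge0 // -sqrtr_sqr ler_sqrt ?ip_cauchy //.
by rewrite mulr_ge0 // ip_ge0.
Qed.

Lemma ipD_le f g : L2 f -> L2 g ->
  ip (f \+ g) (f \+ g) <= 2 * ip f f + 2 * ip g g.
Proof.
move=> f2 g2; have := ip_ge0 (f \- g).
rewrite ipBl ?ipBr ?ipDl ?ipDr //; try exact: L2B; try exact: L2D.
by rewrite (ipC g f); lra.
Qed.

Lemma ipB_le f g : L2 f -> L2 g ->
  ip (f \- g) (f \- g) <= 2 * ip f f + 2 * ip g g.
Proof.
move=> f2 g2; have := ip_ge0 (f \+ g).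
rewrite ipBl ?ipBr ?ipDl ?ipDr //; try exact: L2B; try exact: L2D.
by rewrite (ipC g f); lra.
Qed.

Lemma ip_mull_le C h f : measurable_fun setT h -> (forall x, `|h x| <= C) ->
  L2 f -> ip (h \* f) (h \* f) <= C ^+ 2 * ip f f.
Proof.
move=> mh hC f2; have hf2 := L2_mull mh hC f2; have [mf f2'] := f2.
rewrite -RintZ //; apply: le_Rintegral => //; [exact: L2M|exact: L1Z|].
move=> x _ /=; rewrite -!expr2 exprMn.
by rewrite ler_wpM2r ?sqr_ge0 // sqr_le_abs.
Qed.

Lemma le_ip f g h k : L2 f -> L2 g -> L2 h -> L2 k ->
  (forall x, f x * g x <= h x * k x) -> ip f g <= ip h k.
Proof.
move=> f2 g2 h2 k2 fg; apply: le_Rintegral => //; [exact: L2M|exact: L2M|by move=> x _; exact: fg].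
Qed.

Lemma Rint_ae f g : measurable_fun setT f -> measurable_fun setT g ->
  {ae m, forall x, f x = g x} -> \int[m]_x f x = \int[m]_x g x.
Proof.
move=> mf mg fg; congr fine; apply: ae_eq_integral => //.
- exact/measurable_EFinP.
- exact/measurable_EFinP.
- by apply: filterS fg => x /= ->.
Qed.

Lemma le_Rint_ae f g : L1 f -> L1 g -> {ae m, forall x, f x <= g x} ->
  \int[m]_x f x <= \int[m]_x g x.
Proof.
move=> f1 g1 fg; rewrite -subr_ge0 -RintB //.
have mgf := L1_meas (L1B g1 f1).
rewrite (@Rint_ae _ (fun x => `|(g \- f) x|)) //.
- exact: Rintegral_ge0.
- exact: measurableT_comp.
- by apply: filterS fg => x fg /=; rewrite ger0_norm // subr_ge0.
Qed.

Lemma ip_ael f f' g : L2 f -> L2 f' -> L2 g -> {ae m, forall x, f x = f' x} ->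
  ip f g = ip f' g.
Proof.
move=> [mf _] [mf' _] [mg _] ff'.
apply: Rint_ae; try exact: measurable_funM.
by apply: filterS ff' => x /= ->.
Qed.

Lemma ip_eq0 f : L2 f -> ip f f = 0 -> {ae m, forall x, f x = 0}.
Proof.
move=> [mf f2] f0.
have : (\int[m]_x `|((f \* f) x)%:E| = 0)%E.
  have -> : (\int[m]_x `|((f \* f) x)%:E| = \int[m]_x ((f \* f) x)%:E)%E.
    by apply: eq_integral => x _ /=; rewrite ger0_norm // -expr2 sqr_ge0.
  rewrite -[LHS]fineK; first by rewrite -/(Rintegral _ _ _) -/(ip f f) f0.
  exact: integrable_fin_num.
move/(ae_eq_integral_abs m measurableT (measurable_int _ f2)).1.
by apply: filterS => x /= /(_ I) [] /eqP; rewrite -expr2 sqrf_eq0 => /eqP.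
Qed.

Lemma L2_ae f g : L2 f -> measurable_fun setT g ->
  {ae m, forall x, f x = g x} -> L2 g.
Proof.
move=> [mf f2] mg fg; split => //.
move/integrableP : f2 => [_ f2]; apply/integrableP; split.
  by apply/measurable_EFinP; exact: measurable_funM.
apply: le_lt_trans f2; rewrite le_eqVlt; apply/orP; left; apply/eqP.
apply: ae_eq_integral => //; last by apply: filterS fg => x /= ->.
- by apply: measurableT_comp => //; apply/measurable_EFinP; exact: measurable_funM.
- by apply: measurableT_comp => //; apply/measurable_EFinP; exact: measurable_funM.
Qed.

Hypothesis mfin : (m setT < +oo)%E.

Lemma L1_cst k : L1 (cst k).
Proof.
apply/integrableP; split; first exact/measurable_EFinP.
rewrite (_ : (fun x => _) = cst (`|k|%:E)) //.
rewrite integral_cst // lte_mul_pinfty //.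
Qed.

Lemma L2_cst k : L2 (cst k).
Proof. by split => //; exact: (L1_cst (k * k)). Qed.

Lemma L2_bounded C f : measurable_fun setT f -> (forall x, `|f x| <= C) -> L2 f.
Proof.
move=> mf fC; have -> : f = f \* cst 1 by apply/funext => x /=; rewrite mulr1.
exact: (L2_mull mf fC (L2_cst 1)).
Qed.

Lemma L2_L1 f : L2 f -> L1 f.
Proof.
move=> f2; have := L2M f2 (L2_cst 1).
by congr L1; apply/funext => x /=; rewrite mulr1.
Qed.

Lemma ip1r f : ip f (cst 1) = \int[m]_x f x.
Proof. by apply: eq_Rintegral => x _ /=; rewrite mulr1. Qed.

Lemma ip11 : ip (cst 1) (cst 1) = fine (m setT).
Proof. by rewrite ip1r Rintegral_cst // mul1r. Qed.

End L2.

(** * Fubini's theorem and velocity moments *)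

Section integrable_fine.
Context d (T : measurableType d) (R : realType).
Variable m : {measure set T -> \bar R}.

(** The inner integrals of Fubini's theorem are extended reals, possibly infinite on a null set.
    There [fine] puts 0, which affects neither integrability nor the integral. *)
Lemma L1_fine (h : T -> \bar R) : m.-integrable setT h -> L1 m (fine \o h).
Proof.
move=> ih; apply: (le_integrable measurableT _ _ ih).
  apply/measurable_EFinP.
  exact: (measurableT_comp (fine_measurable measurableT) (measurable_int _ ih)).
by move=> x _ /=; case: (h x) => [r| |] //=; rewrite normr0 leey.
Qed.

Lemma Rint_fine (h : T -> \bar R) : m.-integrable setT h ->
  \int[m]_x (fine (h x)) = fine (\int[m]_x h x)%E.
Proof.
move=> ih; congr fine; apply: ae_eq_integral => //.
- exact: (measurable_int _ (L1_fine ih)).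
- exact: (measurable_int _ ih).
- have := integrable_ae measurableT ih; apply: filterS => x /= H _.
  by rewrite fineK // H.
Qed.
End integrable_fine.

Section Product.
Context d1 d2 (T1 : measurableType d1) (T2 : measurableType d2) (R : realType).
Variables (m1 : {finite_measure set T1 -> \bar R})
          (m2 : {finite_measure set T2 -> \bar R}).
Local Notation m := (m1 \x m2)%E.
Implicit Types (h : T1 * T2 -> R) (p q : T1 -> R) (w : T2 -> R).

Lemma fin1 : (m1 setT < +oo)%E.
Proof. by rewrite ltey_eq fin_num_measure. Qed.
Lemma fin2 : (m2 setT < +oo)%E.
Proof. by rewrite ltey_eq fin_num_measure. Qed.

Lemma finprod : (m setT < +oo)%E.
Proof.
rewrite -setXTT product_measure1E //.
by rewrite ltey_eq fin_numM // fin_num_measure.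
Qed.

Lemma L1_ae2 h : L1 m h -> {ae m2, forall v, L1 m1 (fun x => h (x, v))}.
Proof. by move=> h1; exact: (ae_integrable2 h1). Qed.

Lemma L1_ae1 h : L1 m h -> {ae m1, forall x, L1 m2 (fun v => h (x, v))}.
Proof. by move=> h1; exact: (ae_integrable1 h1). Qed.

Lemma measurable_absG h : measurable_fun setT h ->
  measurable_fun setT (fun v => \int[m1]_x `|(h (x, v))%:E|)%E.
Proof.
move=> mh; apply: (measurable_fun_fubini_tonelli_G (abse \o (EFin \o h))) => //=.
by apply: measurableT_comp => //; exact/measurable_EFinP.
Qed.

Lemma fubini_G_integrable h : L1 m h ->
  m2.-integrable setT (fun v => \int[m1]_x (h (x, v))%:E)%E.
Proof.
move=> h1; have ih := (integrable21ltyP m1 m2 (measurable_int _ h1)).1 h1.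
apply/integrableP; split; first exact: (measurable_fubini_G h1).
have mh := measurable_int _ h1.
apply: le_lt_trans ih; apply: ge0_le_integral => //.
- by apply: measurableT_comp => //; exact: (measurable_fubini_G h1).
- apply: measurable_absG; exact/measurable_EFinP.
- move=> v _; apply: le_abse_integral => //.
  exact: measurableT_comp mh _.
Qed.

Lemma L1_int1 h : L1 m h -> L1 m2 (fun v => \int[m1]_x h (x, v)).
Proof. by move=> /fubini_G_integrable/L1_fine. Qed.

Lemma Rint_fubini2 h : L1 m h ->
  \int[m]_z h z = \int[m2]_v \int[m1]_x h (x, v).
Proof.
move=> h1; rewrite (Rint_fine (fubini_G_integrable h1)).
by rewrite /Rintegral -(integral21_prod_meas1 h1).
Qed.

Lemma L1_int2 h : L1 m h -> L1 m1 (fun x => \int[m2]_v h (x, v)).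
Proof. by move=> /integrable_fubini_F/L1_fine. Qed.

Lemma Rint_fubini1 h : L1 m h ->
  \int[m]_z h z = \int[m1]_x \int[m2]_v h (x, v).
Proof.
move=> h1; rewrite (Rint_fine (integrable_fubini_F h1)).
by rewrite /Rintegral -(integral12_prod_meas1 h1).
Qed.

(** Tonelli's criterion, with information on the sections only almost everywhere. It serves for
    functions such as v f that are controlled one velocity at a time. *)
Lemma L1_prod h : measurable_fun setT h -> (forall z, 0 <= h z) ->
  {ae m2, forall v, L1 m1 (fun x => h (x, v))} ->
  forall u, L1 m2 u -> {ae m2, forall v, \int[m1]_x h (x, v) <= u v} ->
  L1 m h.
Proof.
move=> mh h0 h1 u u1 hu.
have mh' : measurable_fun setT (EFin \o h) by exact/measurable_EFinP.
apply/(integrable21ltyP m1 m2) => //.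
move/integrableP: (u1) => [mu ulty]; apply: le_lt_trans ulty.
apply: ae_ge0_le_integral => //.
- by move=> v _; apply: integral_ge0.
- exact: measurable_absG.
- exact: measurableT_comp.
- apply: filterS2 h1 hu => v h1 hu _ /=.
  have -> : (\int[m1]_x `|(h (x, v))%:E| = \int[m1]_x (h (x, v))%:E)%E.
    by apply: eq_integral => x _ /=; rewrite ger0_norm.
  rewrite -(fineK (integrable_fin_num measurableT h1)) lee_fin.
  by rewrite (le_trans hu) // ler_norm.
Qed.

Lemma L2_ae2 h : L2 m h -> {ae m2, forall v, L2 m1 (fun x => h (x, v))}.
Proof.
move=> [mh h2]; apply: filterS (L1_ae2 h2) => v hv; split => //.
exact: measurableT_comp mh _.
Qed.

Lemma L2_ae1 h : L2 m h -> {ae m1, forall x, L2 m2 (fun v => h (x, v))}.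
Proof.
move=> [mh h2]; apply: filterS (L1_ae1 h2) => v hv; split => //.
exact: measurableT_comp mh _.
Qed.

Definition lift p : T1 * T2 -> R := fun z => p z.1.
Definition tens w p : T1 * T2 -> R := fun z => w z.2 * p z.1.

Lemma L1_tens w p : L1 m2 w -> L1 m1 p -> L1 m (tens w p).
Proof.
move=> w1 p1; have mw := L1_meas w1; have mp := L1_meas p1.
have mt : measurable_fun setT (tens w p).
  by apply: measurable_funM; exact: measurableT_comp.
have H : L1 m (fun z => `|tens w p z|).
  apply: (@L1_prod _ _ _ _ (fun v => `|w v| * \int[m1]_x `|p x|)).
  - exact: measurableT_comp.
  - by [].
  - apply: aeW => v; have := L1Z `|w v| (integrable_norm p1).
    by congr L1; apply/funext => x /=; rewrite normrM.
  - have := L1Z (\int[m1]_x `|p x|) (integrable_norm w1).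
    by congr L1; apply/funext => x /=; rewrite mulrC.
  - apply: aeW => v; rewrite -RintegralZl //; last exact: (integrable_norm p1).
    by rewrite le_eqVlt; apply/orP; left; apply/eqP/eq_Rintegral => x _; rewrite normrM.
by apply: (L1_le mt H).
Qed.

Lemma L2_tens w p : L2 m2 w -> L2 m1 p -> L2 m (tens w p).
Proof.
move=> [mw w2] [mp p2]; split.
  by apply: measurable_funM; exact: measurableT_comp.
have := L1_tens w2 p2; congr L1.
by apply/funext => z /=; rewrite /tens /=; ring.
Qed.

Lemma L2_lift p : L2 m1 p -> L2 m (lift p).
Proof.
move=> p2; have := L2_tens (L2_cst fin2 1) p2; congr L2.
by apply/funext => z /=; rewrite /tens /= mul1r.
Qed.

Definition mom w h : T1 -> R := fun x => \int[m2]_v (w v * h (x, v)).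

Lemma mom_L1 w h : L2 m2 w -> L2 m h -> L1 m (fun z => w z.2 * h z).
Proof.
move=> w2 h2; have := L2M (L2_tens w2 (L2_cst fin1 1)) h2; congr L1.
by apply/funext => z /=; rewrite /tens /= mulr1.
Qed.

Lemma mom_meas w h : L2 m2 w -> L2 m h -> measurable_fun setT (mom w h).
Proof. by move=> w2 h2; apply: L1_meas (L1_int2 (mom_L1 w2 h2)). Qed.

(** Cauchy-Schwarz in v, valid at those x where the section of [h] is square integrable. It yields
    both the square integrability of moments and [mom_le]. *)
Lemma mom_sq_le w h : L2 m2 w -> L2 m h ->
  {ae m1, forall x, mom w h x * mom w h x <=
     ip m2 w w * \int[m2]_v (h (x, v) * h (x, v))}.
Proof.
move=> w2 h2; apply: filterS (L2_ae1 h2) => x hx.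
by rewrite -expr2; exact: (ip_cauchy w2 hx).
Qed.

Lemma mom_bound_L1 w h : L2 m2 w -> L2 m h ->
  L1 m1 (ip m2 w w \*o (fun x => \int[m2]_v (h (x, v) * h (x, v)))).
Proof. by move=> w2 [_ h2]; apply: L1Z; exact: (L1_int2 h2). Qed.

Lemma mom_L2 w h : L2 m2 w -> L2 m h -> L2 m1 (mom w h).
Proof.
move=> w2 h2; have mm := mom_meas w2 h2; split => //.
apply/integrableP; split.
  by apply/measurable_EFinP; exact: measurable_funM.
move/integrableP : (mom_bound_L1 w2 h2) => [mu ulty].
apply: le_lt_trans ulty; apply: ae_ge0_le_integral => //.
- by apply: measurableT_comp => //; apply/measurable_EFinP; exact: measurable_funM.
- exact: measurableT_comp.
- apply: filterS (mom_sq_le w2 h2) => x H _ /=.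
  rewrite lee_fin (le_trans _ (le_trans H _)) ?ler_norm //.
  by rewrite ger0_norm // -expr2 sqr_ge0.
Qed.

Lemma mom_le w h : L2 m2 w -> L2 m h ->
  ip m1 (mom w h) (mom w h) <= ip m2 w w * ip m h h.
Proof.
move=> w2 h2; have [_ h2'] := h2.
rewrite [X in _ * X](Rint_fubini1 h2') -RintZ; last exact: (L1_int2 h2').
have M2 := mom_L2 w2 h2; have [_ M2'] := M2.
have B := mom_bound_L1 w2 h2.
exact: le_Rint_ae M2' B (mom_sq_le w2 h2).
Qed.

Lemma ip_mom w h p : L2 m2 w -> L2 m h -> L2 m1 p ->
  ip m1 (mom w h) p = ip m h (tens w p).
Proof.
move=> w2 h2 p2; rewrite [RHS]Rint_fubini1; last first.
  by apply: L2M => //; exact: L2_tens.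
have [mm _] := mom_L2 w2 h2; have [mp _] := p2.
apply: Rint_ae.
- exact: measurable_funM.
- by apply: L1_meas; apply: L1_int2; apply: L2M => //; exact: L2_tens.
- apply: filterS (L1_ae1 (mom_L1 w2 h2)) => x H /=.
  rewrite /mom /= -RintegralZr //.
  by apply: eq_Rintegral => v _; rewrite /tens /=; ring.
Qed.

End Product.

(** * Primitives for a finite atomless measure *)

Section Primitive.
Context (R : realType).
Variable nu : {finite_measure set (measurableTypeR R) -> \bar R}.
Implicit Types (p q : measurableTypeR R -> R).

Definition step (x y : R) : R := (y < x)%R%:R.

(** The primitive from the left, written with a kernel over the whole line: its values are inner
    products, so that Cauchy-Schwarz and Fubini apply at once. *)
Definition prim p : measurableTypeR R -> R := fun x => \int[nu]_y (step x y * p y).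

Lemma step_abs x y : `|step x y| <= 1.
Proof. by rewrite /step; case: (y < x); rewrite /= ?normr1 ?normr0. Qed.

Lemma step_meas2 : measurable_fun setT
  (fun z : measurableTypeR R * measurableTypeR R => step z.1 z.2).
Proof.
rewrite /step (_ : (fun z => _) =
  (fun z : measurableTypeR R * measurableTypeR R => if (z.2 < z.1)%R then 1 else 0 : R)); last first.
  by apply/funext => z; case: (_ < _).
apply: measurable_fun_ifT => //.
by apply: measurable_fun_ltr.
Qed.

Lemma step_meas x : measurable_fun setT (step x : measurableTypeR R -> R).
Proof. exact: (measurableT_comp step_meas2 (measurable_fun_pair (measurable_cst x) (@measurable_id _ _ _))). Qed.

Lemma step_measl y : measurable_fun setT ((fun x => step x y) : measurableTypeR R -> R).
Proof. exact: (measurableT_comp step_meas2 (measurable_fun_pair (@measurable_id _ _ _) (measurable_cst y))). Qed.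

Lemma L2_step x : L2 nu (step x).
Proof. exact: (L2_bounded (fin1 nu) (step_meas x) (step_abs x)). Qed.

Lemma L1_step_mul x p : L1 nu p -> L1 nu (step x \* p).
Proof.
move=> p1; have mp := L1_meas p1; apply: (L1_le _ (integrable_norm p1)).
  by apply: measurable_funM => //; exact: step_meas.
by move=> y /=; rewrite normrM ler_piMl // step_abs.
Qed.

Lemma primE p x : prim p x = ip nu (step x) p.
Proof. by []. Qed.

Lemma primD p q x : L1 nu p -> L1 nu q -> prim (p \+ q) x = prim p x + prim q x.
Proof.
move=> p1 q1; rewrite /prim -RintD; try exact: L1_step_mul.
by apply: eq_Rintegral => y _ /=; rewrite mulrDr.
Qed.

Lemma primB p q x : L1 nu p -> L1 nu q -> prim (p \- q) x = prim p x - prim q x.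
Proof.
move=> p1 q1; rewrite /prim -RintB; try exact: L1_step_mul.
by apply: eq_Rintegral => y _ /=; rewrite mulrBr.
Qed.

Lemma primZ k p x : L1 nu p -> prim (k \*o p) x = k * prim p x.
Proof.
move=> p1; rewrite /prim -RintZ; try exact: L1_step_mul.
by apply: eq_Rintegral => y _ /=; ring.
Qed.

Lemma prim_abs_le p x : L1 nu p -> `|prim p x| <= \int[nu]_y `|p y|.
Proof.
move=> p1; apply: le_trans (le_normr_Rintegral measurableT (L1_step_mul x p1)) _.
apply: le_Rintegral => //.
- exact: (integrable_norm (L1_step_mul x p1)).
- exact: (integrable_norm p1).
- by move=> y _ /=; rewrite normrM ler_piMl // step_abs.
Qed.

Lemma prim_le p q x : L1 nu p -> L1 nu q -> (forall y, p y <= q y) ->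
  prim p x <= prim q x.
Proof.
move=> p1 q1 pq; apply: le_Rintegral => //.
- exact: (L1_step_mul x p1).
- exact: (L1_step_mul x q1).
- by move=> y _ /=; rewrite ler_wpM2l // /step ler0n.
Qed.

Lemma eq_prim_ae p q x : measurable_fun setT p -> measurable_fun setT q ->
  {ae nu, forall y, p y = q y} -> prim p x = prim q x.
Proof.
move=> mp mq pq; apply: Rint_ae.
- by apply: measurable_funM => //; exact: step_meas.
- by apply: measurable_funM => //; exact: step_meas.
- by apply: filterS pq => y ->.
Qed.

Definition ker1 p q (z : measurableTypeR R * measurableTypeR R) : R :=
  step z.1 z.2 * (p z.2 * q z.1).

Lemma L1_ker1 p q : L1 nu p -> L1 nu q -> L1 (nu \x nu)%E (ker1 p q).
Proof.
move=> p1 q1; apply: (L1_le _ (integrable_norm (L1_tens p1 q1))).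
  apply: measurable_funM; first exact: step_meas2.
  exact: (L1_meas (L1_tens p1 q1)).
by move=> z; rewrite /ker1 /= normrM ler_piMl // step_abs.
Qed.

(** A partial integral of [ker1] with second factor 1, so that measurability comes from Fubini. *)
Lemma prim_meas p : L1 nu p -> measurable_fun setT (prim p).
Proof.
move=> p1; have := L1_meas (L1_int2 (L1_ker1 p1 (L1_cst (fin1 nu) 1))).
congr measurable_fun; apply/funext => x; apply: eq_Rintegral => y _.
by rewrite /ker1 /= mulr1.
Qed.

Lemma L2_prim1 p : L1 nu p -> L2 nu (prim p).
Proof.
move=> p1; apply: (L2_bounded (fin1 nu) (prim_meas p1)) => x.
exact: prim_abs_le.
Qed.

Lemma L2_prim p : L2 nu p -> L2 nu (prim p).
Proof. by move=> /(L2_L1 (fin1 nu))/L2_prim1. Qed.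

Definition vol : R := fine (nu setT).

Lemma vol_ge0 : 0 <= vol.
Proof. by rewrite /vol fine_ge0. Qed.

Lemma prim_sqr_le p x : L2 nu p -> prim p x ^+ 2 <= vol * ip nu p p.
Proof.
move=> p2; rewrite primE; apply: le_trans (ip_cauchy (L2_step x) p2) _.
rewrite ler_wpM2r ?ip_ge0 // /vol -(ip11 nu); apply: le_ip.
- exact: L2_step.
- exact: L2_step.
- exact: (L2_cst (fin1 nu)).
- exact: (L2_cst (fin1 nu)).
- by move=> y; rewrite /step; case: (y < x); rewrite /= ?mulr1 ?mulr0.
Qed.

Lemma int_sqr_le p : L2 nu p -> (\int[nu]_x p x) ^+ 2 <= vol * ip nu p p.
Proof.
move=> p2; rewrite -(ip1r nu) mulrC /vol -(ip11 nu).
by apply: ip_cauchy => //; exact: (L2_cst (fin1 nu)).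
Qed.

Lemma ip_bound_le p K : L2 nu p -> (forall x, p x ^+ 2 <= K) ->
  ip nu p p <= vol * K.
Proof.
move=> p2 pK; rewrite /vol -(ip11 nu) mulrC.
have C1 := L2_cst (fin1 nu) 1; have C2 := L2_cst (fin1 nu) K.
rewrite -ipZl //; apply: le_ip => //; first exact: L2Z.
by move=> x /=; rewrite !mulr1 -expr2.
Qed.

Lemma ip_prim_le p : L2 nu p -> ip nu (prim p) (prim p) <= vol ^+ 2 * ip nu p p.
Proof.
move=> p2; rewrite expr2 -mulrA; apply: ip_bound_le; first exact: L2_prim.
by move=> x; exact: prim_sqr_le.
Qed.

Hypothesis noatom : forall x, nu [set x] = 0%E.

Lemma ae_neq x : {ae nu, forall y, y != x}.
Proof.
exists [set x]; split; [exact: measurable_set1|exact: noatom|].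
by move=> y /= /negP; rewrite negbK => /eqP.
Qed.

(** The two terms are the integrals of p(y) q(x) over the triangles y < x and x < y. These fill the
    square up to the diagonal, which is null because [nu] has no atoms. *)
Lemma prim_ibp1 p q : L1 nu p -> L1 nu q ->
  \int[nu]_x (prim p x * q x) + \int[nu]_x (p x * prim q x) =
  (\int[nu]_x p x) * (\int[nu]_x q x).
Proof.
move=> p1 q1; pose h2 (z : measurableTypeR R * measurableTypeR R) :=
  step z.2 z.1 * (p z.2 * q z.1).
have H2 : L1 (nu \x nu)%E h2.
  apply: (L1_le _ (integrable_norm (L1_tens p1 q1))).
    apply: measurable_funM; last exact: (L1_meas (L1_tens p1 q1)).
    exact: (measurableT_comp step_meas2 (measurable_fun_pair (@measurable_snd _ _ _ _) (@measurable_fst _ _ _ _))).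
  by move=> z; rewrite /h2 /= normrM ler_piMl // step_abs.
have -> : \int[nu]_x (prim p x * q x) = \int[(nu \x nu)%E]_z ker1 p q z.
  rewrite (Rint_fubini1 (L1_ker1 p1 q1)); apply: eq_Rintegral => x _.
  rewrite /prim -RintegralZr //; last exact: (L1_step_mul x p1).
  by apply: eq_Rintegral => y _; rewrite /ker1 /=; ring.
have -> : \int[nu]_x (p x * prim q x) = \int[(nu \x nu)%E]_z h2 z.
  rewrite (Rint_fubini2 H2); apply: eq_Rintegral => y _.
  rewrite /prim -RintegralZl //; last exact: (L1_step_mul y q1).
  by apply: eq_Rintegral => x _; rewrite /h2 /=; ring.
rewrite -RintD //; last exact: L1_ker1.
rewrite Rint_fubini1; last by apply: L1D => //; exact: L1_ker1.
rewrite -RintegralZl //; apply: eq_Rintegral => x _.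
rewrite -RintegralZr //.
have mpq : measurable_fun setT (fun y => p y * q x).
  by apply: measurable_funM => //; exact: L1_meas p1.
apply: Rint_ae.
- apply: (@measurable_funD _ _ _ _ (fun y => step x y * (p y * q x))
                                   (fun y => step y x * (p y * q x))).
  + by apply: measurable_funM => //; exact: step_meas.
  + by apply: measurable_funM => //; exact: step_measl.
- by [].
- apply: filterS (ae_neq x) => y yx; rewrite /ker1 /h2 /step /=.
  by case: ltgtP yx => // *; rewrite /=; ring.
Qed.

Lemma prim_ibp p q : L2 nu p -> L2 nu q ->
  ip nu (prim p) q = (\int[nu]_x p x) * (\int[nu]_x q x) - ip nu p (prim q).
Proof.
move=> p2 q2; rewrite -prim_ibp1; try exact: (L2_L1 (fin1 nu)).
by rewrite /ip /= addrK.
Qed.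

Lemma ip_prim_self p : L2 nu p -> ip nu (prim p) p = (\int[nu]_x p x) ^+ 2 / 2.
Proof. by move=> p2; have := prim_ibp p2 p2; rewrite (ipC _ p); lra. Qed.

End Primitive.

(** Transfers norm bounds between functions known only through their pairings with L^2 functions,
    without identifying them almost everywhere. *)
Lemma ip_weak_eq d (T : measurableType d) (R : realType)
    (m : {measure set T -> \bar R}) (u u' : T -> R) :
  L2 m u -> L2 m u' -> (forall q, L2 m q -> ip m u q = ip m u' q) ->
  ip m u u = ip m u' u'.
Proof. by move=> u2 u2' H; rewrite H // ipC H. Qed.

Lemma combine_le (R : realDomainType) (x y z t p q r : R) :
  x <= 2 * y + 2 * z -> y <= p -> z <= q -> t <= r ->
  2 * x + 2 * t <= 4 * p + 4 * q + 2 * r.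
Proof. by move=> *; lra. Qed.

Section Sections.
Context (R : realType).
Variables (nu mu : {finite_measure set (measurableTypeR R) -> \bar R}).
Local Notation m := (nu \x mu)%E.
Local Notation RT := (measurableTypeR R).
Implicit Types (h k : RT * RT -> R) (p q : RT -> R) (w : RT -> R).
Hypothesis mu1 : mu setT = 1%E.

Lemma ip_sections h k : L2 m h -> L2 m k ->
  ip m h k = \int[mu]_v ip nu (fun x => h (x, v)) (fun x => k (x, v)).
Proof. by move=> h2 k2; rewrite /ip (Rint_fubini2 (L2M h2 k2)). Qed.

Lemma L1_sections h k : L2 m h -> L2 m k ->
  L1 mu (fun v => ip nu (fun x => h (x, v)) (fun x => k (x, v))).
Proof. by move=> h2 k2; exact: (L1_int1 (L2M h2 k2)). Qed.

Lemma mom_lift w p : L1 mu w -> mom mu w (lift p) = (\int[mu]_v w v) \*o p.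
Proof.
by move=> w1; apply/funext => x; rewrite /mom /lift /= RintegralZr.
Qed.

Lemma ip_lift_tens w p q : L2 mu w -> L2 nu p -> L2 nu q ->
  ip m (lift p) (tens w q) = (\int[mu]_v w v) * ip nu p q.
Proof.
move=> w2 p2 q2; rewrite -ip_mom //; last exact: L2_lift.
by rewrite mom_lift ?ipZl //; exact: (L2_L1 (fin1 mu)).
Qed.

Lemma lift_tens p : lift p = tens (cst 1) p :> (RT * RT -> R).
Proof. by apply/funext => z; rewrite /lift /tens mul1r. Qed.

Lemma int_one : \int[mu]_v cst 1 v = 1 :> R.
Proof.
by transitivity (fine (mu setT)); [rewrite Rintegral_cst // mul1r|rewrite mu1].
Qed.

Lemma ip_lift p q : L2 nu p -> L2 nu q -> ip m (lift p) (lift q) = ip nu p q.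
Proof.
move=> p2 q2; rewrite [lift q]lift_tens ip_lift_tens //.
  by rewrite int_one mul1r.
exact: (L2_cst (fin1 mu)).
Qed.

Lemma ip_mean h q : L2 m h -> L2 nu q ->
  ip m h (lift q) = ip nu (mom mu (cst 1) h) q.
Proof.
by move=> h2 q2; rewrite lift_tens ip_mom //; exact: (L2_cst (fin1 mu)).
Qed.

Lemma mean_le h : L2 m h ->
  ip nu (mom mu (cst 1) h) (mom mu (cst 1) h) <= ip m h h.
Proof.
move=> h2; have c2 := L2_cst (fin1 mu) 1.
have := mom_le c2 h2; have m1 : fine (mu setT) = 1 by rewrite mu1.
by rewrite (ip11 mu) [X in X * _]m1 mul1r.
Qed.

Lemma mean_L2 h : L2 m h -> L2 nu (mom mu (cst 1) h).
Proof. by move=> h2; apply: mom_L2 => //; exact: (L2_cst (fin1 mu)). Qed.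

End Sections.

(** * The transport equation *)

Section Kinetic.
Context (R : realType).
Variables (nu mu : {finite_measure set (measurableTypeR R) -> \bar R}).
Local Notation m := (nu \x mu)%E.
Local Notation RT := (measurableTypeR R).
Implicit Types (h k : RT * RT -> R) (p q : RT -> R) (w : RT -> R).
Hypothesis mu1 : mu setT = 1%E.
Hypothesis noatom : forall x, nu [set x] = 0%E.
Local Notation V := (fun v : RT => v : R).
Hypothesis V2 : L2 mu V.
Hypothesis V0 : \int[mu]_v v = 0.

Variables (a b eps : R) (sig : RT -> R) (g : RT -> R) (f : RT * RT -> R).
Hypotheses (a0 : 0 < a) (eps0 : 0 < eps) (eps1 : eps <= 1).
Hypothesis msig : measurable_fun setT sig.
Hypothesis sigab : forall x, a <= sig x <= b.
Hypothesis g2 : L2 nu g.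
Hypothesis f2 : L2 m f.

Definition rhof : RT -> R := mom mu (cst 1) f.

(* v df/dx, as given by the transport equation *)
Definition coll : RT * RT -> R :=
  eps \*o (lift g \- f) \- eps^-1 \*o (lift sig \* (f \- lift rhof)).

(** By the equation this is v (f(l, v) - f(-l, v)); since incoming traces vanish, it is |v| times
    the outgoing trace. *)
Definition tau (v : RT) : R := \int[nu]_x coll (x, v).

(* v times the trace of f(., v) at the left end point *)
Definition inflow (v : RT) : R := if v < 0 then - tau v else 0.

(** The equation and its boundary conditions in integrated form. For v < 0 the condition at l forces
    the value at -l to be minus the increment [tau], whence the form of [inflow]. At v = 0 there is
    no trace and the equation reduces to [coll = 0]. *)
Hypothesis transport : {ae mu, forall v : RT,
  (v = 0 -> {ae nu, forall x, coll (x, v) = 0}) /\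
  {ae nu, forall x, v * f (x, v) = inflow v + prim nu (fun y => coll (y, v)) x}}.

Let F2 : L2 nu rhof. Proof. exact: mean_L2. Qed.
Let lg2 : L2 m (lift g). Proof. exact: L2_lift. Qed.
Let lF2 : L2 m (lift rhof). Proof. exact: L2_lift. Qed.
Let d2 : L2 m (f \- lift rhof). Proof. exact: L2B. Qed.

Let sig_abs x : `|sig x| <= b.
Proof.
have /andP[h1 h2] := sigab x; rewrite ger0_norm // (le_trans _ h1) // ltW //.
Qed.

Let mlsig : measurable_fun setT (lift sig : RT * RT -> R).
Proof. exact: measurableT_comp. Qed.

Let sd2 : L2 m (lift sig \* (f \- lift rhof)).
Proof. by apply: (@L2_mull _ _ _ _ b) => // z; exact: sig_abs. Qed.

Let sigL2 p : L2 nu p -> L2 nu (sig \* p).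
Proof. by move=> p2; apply: (@L2_mull _ _ _ _ b). Qed.

Lemma coll_L2 : L2 m coll.
Proof. by apply: L2B; apply: L2Z => //; exact: L2B. Qed.
Let T2 := coll_L2.

(* As v df/dx = coll, this is v/2 times the increment of f(., v)^2, that is, the
   outgoing energy: cf. [tau_sqr]. *)
Definition source (v : RT) : R := ip nu (fun x => coll (x, v)) (fun x => f (x, v)).

Let oneL2 : L2 nu (cst 1). Proof. exact: (L2_cst (fin1 nu)). Qed.

Lemma transport_weak : {ae mu, forall v : RT,
  [/\ L2 nu (fun x => coll (x, v)), L2 nu (fun x => f (x, v)) &
   forall q, L2 nu q -> v * ip nu (fun x => f (x, v)) q =
     inflow v * \int[nu]_x q x + ip nu (prim nu (fun y => coll (y, v))) q]}.
Proof.
apply: filterS3 transport (L2_ae2 T2) (L2_ae2 f2) => v [_ tr] c2 fv2; split => // q q2.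
have c1 := L2_prim c2.
rewrite -ipZl // -(ip1r nu) (ipC _ q) -ipZl // -ipDl //; last exact: L2Z.
apply: ip_ael => //; first exact: L2Z.
- by apply: L2D => //; exact: L2Z.
- by apply: filterS tr => x /= ->; rewrite mulr1.
Qed.

(** Pairing v f = inflow + prim coll with [coll] gives v source = inflow tau + tau^2 / 2, where
    inflow is - tau for v < 0 and 0 for v > 0. At v = 0 everything vanishes with [coll]. *)
Lemma tau_sqr : {ae mu, forall v : RT,
  tau v ^+ 2 = 2 * `|v| * source v /\ 0 <= source v}.
Proof.
apply: filterS2 transport_weak transport => v [c2 fv2 tr] [tr0 _].
have := tr _ c2; rewrite -/(tau v) ip_prim_self // -/(tau v) ipC -/(source v) /inflow.
case: (ltgtP v 0) => [v0|v0|v0] H.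
- rewrite ltr0_norm //; have E : tau v ^+ 2 = 2 * - v * source v by lra.
  by split => //; have := sqr_ge0 (tau v); rewrite E pmulr_rge0 // mulr_gt0 ?oppr_gt0.
- rewrite gtr0_norm //; have E : tau v ^+ 2 = 2 * v * source v by lra.
  by split => //; have := sqr_ge0 (tau v); rewrite E pmulr_rge0 // mulr_gt0.
- have S0 : source v = 0.
    rewrite /source (@ip_ael _ _ _ _ _ (cst 0)) //.
    + exact: ip0l.
    + exact: (L2_cst (fin1 nu)).
    + by apply: filterS (tr0 v0) => x /= ->.
  by move: H; rewrite S0 v0 mul0r => ?; split => //; rewrite normr0; lra.
Qed.

(** [sig] and [rhof] depend on x only, and the velocity average of [f \- lift rhof] is 0. *)
Let lsigd : ip m (lift sig \* (f \- lift rhof)) (lift rhof) = 0.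
Proof.
have -> : ip m (lift sig \* (f \- lift rhof)) (lift rhof) =
   ip m (f \- lift rhof) (lift (sig \* rhof)).
  by apply: eq_Rintegral => z _; rewrite /lift /=; ring.
have s2 := sigL2 F2.
rewrite ipBl //; last exact: L2_lift.
by rewrite (ip_mean f2 s2) ip_lift // subrr.
Qed.

Let dd : ip m (lift sig \* (f \- lift rhof)) f >= a * ip m (f \- lift rhof) (f \- lift rhof).
Proof.
have -> : ip m (lift sig \* (f \- lift rhof)) f =
  ip m (lift sig \* (f \- lift rhof)) (f \- lift rhof).
  by rewrite ipBr // lsigd subr0.
rewrite -ipZl //; apply: le_ip => //; first exact: L2Z.
move=> z /=; rewrite -!mulrA -!expr2 ler_wpM2r ?sqr_ge0 //.
by have /andP[] := sigab z.1.
Qed.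

Lemma source_int : ip m coll f = \int[mu]_v source v.
Proof. exact: ip_sections. Qed.

Lemma source_L1 : L1 mu source.
Proof. exact: (L1_sections T2 f2). Qed.

Lemma source_int_ge0 : 0 <= \int[mu]_v source v.
Proof.
have -> : 0 = \int[mu]_v (cst 0) v :> R by rewrite Rintegral_cst // mul0r.
apply: le_Rint_ae; [exact: (L1_cst (fin1 mu))|exact: source_L1|].
by apply: filterS tau_sqr => v [].
Qed.

Let G := ip nu g g.
Let d := ip m (f \- lift rhof) (f \- lift rhof).

(** The equation is paired with f. By [dd] the collision term dissipates at least a / eps times [d],
    and 2 g f <= g^2 + f^2 absorbs the datum. The streaming term is the integral of [source], the
    outgoing energy. *)
Lemma energy : \int[mu]_v source v + eps * ip m f f / 2 + a / eps * d
  <= eps * G / 2.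
Proof.
have gf : L2 m (lift g \- f) by exact: L2B.
have := dd; rewrite -/d => dd'.
have E : \int[mu]_v source v = eps * (ip m (lift g) f - ip m f f)
    - eps^-1 * ip m (lift sig \* (f \- lift rhof)) f.
  rewrite -source_int /coll ipBl ?ipZl ?ipBl //; [exact: L2Z|exact: L2Z].
have cs : 2 * ip m (lift g) f <= G + ip m f f.
  have := ip_ge0 m (lift g \- f); rewrite ipBl ?ipBr // ip_lift // (ipC _ f) -/G.
  by lra.
have h1 : a / eps * d <= eps^-1 * ip m (lift sig \* (f \- lift rhof)) f.
  by rewrite mulrAC mulrC ler_wpM2l // invr_ge0 ltW.
have h2 : eps * (2 * ip m (lift g) f) <= eps * (G + ip m f f).
  by rewrite ler_wpM2l // ltW.
rewrite E; lra.
Qed.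

Let d_ge0 : 0 <= d. Proof. exact: ip_ge0. Qed.
Let ad_ge0 : 0 <= a / eps * d. Proof. by rewrite mulr_ge0 // divr_ge0 // ltW. Qed.

Lemma f_bound : ip m f f <= G.
Proof.
have := energy; have := source_int_ge0; have := ad_ge0 => h1 h2 h3.
have : eps * ip m f f <= eps * G by lra.
by rewrite ler_pM2l.
Qed.

Lemma fluct_bound : d <= eps ^+ 2 * G / (2 * a).
Proof.
have := energy; have := source_int_ge0; have := ip_ge0 m f => h1 h2 h3.
have h4 : a / eps * d <= eps * G / 2.
  have : 0 <= eps * ip m f f by rewrite mulr_ge0 // ltW.
  move: h2 h3; rewrite -/G; move: (eps * ip m f f) (a / eps * d) (eps * G).
  by move: (Rintegral _ _ _) => x y z t; lra.
rewrite ler_pdivlMr ?mulr_gt0 //.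
have -> : d * (2 * a) = 2 * eps * (a / eps * d) by field; rewrite gt_eqF.
have -> : eps ^+ 2 * G = 2 * eps * (eps * G / 2) by field.
by rewrite ler_wpM2l // mulr_ge0 // ltW.
Qed.

Lemma source_bound : \int[mu]_v source v <= eps * G / 2.
Proof.
have := energy; have := ip_ge0 m f => h1 h3.
have : 0 <= eps * ip m f f by rewrite mulr_ge0 // ltW.
have := ad_ge0; move: h3; move: (eps * ip m f f) (a / eps * d) (eps * G).
by move: (Rintegral _ _ _) => x y z t; lra.
Qed.

(** The part eps (g - f) of [coll] gives 2 * 4 G, as eps <= 1. The collision part gives 2 * b^2 G /
    (2 a), where the factor eps^-2 is cancelled by the eps^2 of [fluct_bound]. *)
Definition CT : R := (8 + b ^+ 2 / a) * G.

Lemma coll_bound : ip m coll coll <= CT.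
Proof.
have gf : L2 m (lift g \- f) by exact: L2B.
apply: le_trans (ipB_le _ _) _; [exact: L2Z|exact: L2Z|].
rewrite !ipZl ?ipZr //; try exact: L2Z.
have h1 := ipB_le lg2 f2; rewrite ip_lift // -/G in h1.
have h2 := f_bound.
have h3 := ip_mull_le mlsig (fun z => sig_abs z.1) d2; rewrite -/d in h3.
have h4 := fluct_bound.
have h5 : eps^-1 * (eps^-1 * ip m (lift sig \* (f \- lift rhof)) (lift sig \* (f \- lift rhof)))
   <= b ^+ 2 * G / (2 * a).
  rewrite mulrA -invfM -expr2.
  apply: (@le_trans _ _ ((eps ^+ 2)^-1 * (b ^+ 2 * (eps ^+ 2 * G / (2 * a))))).
    rewrite ler_wpM2l ?invr_ge0 ?sqr_ge0 // (le_trans h3) //.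
    by rewrite ler_wpM2l ?sqr_ge0.
  by rewrite le_eqVlt; apply/orP; left; apply/eqP; field; rewrite !gt_eqF.
have h6 : eps * (eps * ip m (lift g \- f) (lift g \- f)) <= 4 * G.
  have h7 : ip m (lift g \- f) (lift g \- f) <= 4 * G by lra.
  apply: le_trans h7; have := ip_ge0 m (lift g \- f) => h0.
  rewrite mulrA ler_piMl // -expr2 expr_le1 // ltW //.
have -> : CT = 2 * (4 * G) + 2 * (b ^+ 2 * G / (2 * a)).
  by rewrite /CT; field; rewrite gt_eqF.
lra.
Qed.

Lemma tau_sq_le : {ae mu, forall v : RT,
  tau v ^+ 2 <= vol nu * ip nu (fun x => coll (x, v)) (fun x => coll (x, v))}.
Proof. by apply: filterS (L2_ae2 T2) => v c2; exact: int_sqr_le. Qed.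

Let T1 : L1 m coll. Proof. exact: (L2_L1 (finprod nu mu)). Qed.

Lemma tau_meas : measurable_fun setT tau.
Proof. exact: (L1_meas (L1_int1 T1)). Qed.

Let CC1 : L1 mu (fun v => ip nu (fun x => coll (x, v)) (fun x => coll (x, v))).
Proof. exact: L1_sections. Qed.

Lemma L1_le_ae (h k : RT -> R) : measurable_fun setT h -> L1 mu k ->
  (forall x, 0 <= h x) -> (forall x, 0 <= k x) ->
  {ae mu, forall x, h x <= k x} -> L1 mu h.
Proof.
move=> mh /integrableP[mk klty] h0 k0 hk; apply/integrableP; split.
  exact/measurable_EFinP.
apply: le_lt_trans klty; apply: ae_ge0_le_integral => //.
- by apply: measurableT_comp => //; exact/measurable_EFinP.
- exact: measurableT_comp.
- by apply: filterS hk => x hk _ /=; rewrite lee_fin !ger0_norm.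
Qed.

Lemma tau_L2 : L2 mu tau.
Proof.
split; first exact: tau_meas.
apply: (L1_le_ae _ (L1Z (vol nu) CC1)) => [|x|x|].
- by apply: measurable_funM; exact: tau_meas.
- by rewrite /= -expr2 sqr_ge0.
- by rewrite /= mulr_ge0 ?vol_ge0 ?ip_ge0.
- by apply: filterS tau_sq_le => x /=; rewrite -expr2.
Qed.

Lemma tau_bound : ip mu tau tau <= vol nu * CT.
Proof.
apply: le_trans (_ : vol nu * ip m coll coll <= _); last first.
  by rewrite ler_wpM2l ?vol_ge0 ?coll_bound.
rewrite (ip_sections T2 T2) -RintZ //; apply: le_Rint_ae.
- exact: (L2M tau_L2 tau_L2).
- exact: L1Z.
- by apply: filterS tau_sq_le => x /=; rewrite -expr2.
Qed.

Lemma inflow_meas : measurable_fun setT inflow.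
Proof.
apply: measurable_fun_ifT => //.
- by apply: measurable_fun_ltr.
- by apply: measurableT_comp => //; exact: tau_meas.
Qed.

Lemma inflow_abs v : `|inflow v| <= `|tau v|.
Proof. by rewrite /inflow; case: ifP; rewrite ?normrN ?normr0. Qed.

Lemma inflow_L2 : L2 mu inflow.
Proof.
have mi := inflow_meas; split => //.
have [mt t1] := tau_L2; apply: (L1_le _ t1).
  exact: measurable_funM.
move=> v /=; rewrite ger0_norm -!expr2 ?sqr_ge0 //.
by rewrite -[leRHS]real_normK ?num_real // sqr_le_abs // inflow_abs.
Qed.

Definition vf : RT * RT -> R := fun z => z.2 * f z.

Let mvf : measurable_fun setT vf.
Proof. by have [mf _] := f2; apply: measurable_funM. Qed.

(** v f(., v) is a constant plus the primitive of [coll], each of squared norm at most vol^2 times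
    that of [coll], so that no bound on v is involved. The 4 is the sum of the two factors 2 in
    [ipD_le]. *)
Lemma vf_ae : {ae mu, forall v : RT, L2 nu (fun x => vf (x, v)) /\
  ip nu (fun x => vf (x, v)) (fun x => vf (x, v)) <=
    4 * vol nu ^+ 2 * ip nu (fun x => coll (x, v)) (fun x => coll (x, v))}.
Proof.
apply: filterS3 transport tau_sq_le (filterI (L2_ae2 T2) (L2_ae2 f2)).
move=> v [_ tr] ts [c2 fv2].
have V2' : L2 nu (fun x => vf (x, v)) := L2Z v fv2.
split => //; set K := ip nu _ _ in ts *.
have P2 := L2_prim c2.
have B2 := L2_cst (fin1 nu) (inflow v).
have E : {ae nu, forall x, vf (x, v) = (cst (inflow v) \+ prim nu (fun y : RT => coll (y, v))) x}.
  exact: tr.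
have S2 := L2D B2 P2.
rewrite (ip_ael V2' S2 V2' E) ipC (ip_ael V2' S2 S2 E).
apply: le_trans (ipD_le B2 P2) _.
have -> : 4 * vol nu ^+ 2 * K = 2 * (vol nu * (vol nu * K)) + 2 * (vol nu ^+ 2 * K) by ring.
rewrite lerD // ler_wpM2l // ?ip_prim_le //.
apply: (@ip_bound_le _ _ _ (vol nu * K)) => //.
move=> x; rewrite /= /inflow; case: ifP => _; rewrite ?sqrrN // expr0n /=.
by rewrite mulr_ge0 ?vol_ge0 // ip_ge0.
Qed.

Lemma vf_L2 : L2 m vf.
Proof.
split => //; apply: (@L1_prod _ _ _ _ _ _ _ _ _ _ _ _ (L1Z (4 * vol nu ^+ 2) CC1)).
- exact: measurable_funM.
- by move=> z; rewrite /= -expr2 sqr_ge0.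
- by apply: filterS vf_ae => v [[]].
- by apply: filterS vf_ae => v [].
Qed.

Definition CV : R := 4 * vol nu ^+ 2 * CT.

Lemma vf_bound : ip m vf vf <= CV.
Proof.
have W := vf_L2.
apply: le_trans (_ : 4 * vol nu ^+ 2 * ip m coll coll <= _); last first.
  by apply: ler_wpM2l; [exact: mulr_ge0 (sqr_ge0 _)|exact: coll_bound].
rewrite !ip_sections // -RintZ //; apply: le_Rint_ae.
- exact: L1_sections.
- exact: L1Z.
- by apply: filterS vf_ae => x [].
Qed.

Definition flux : RT -> R := eps^-1 \*o mom mu V f.

Lemma flux_L2 : L2 nu flux.
Proof. by apply: L2Z; exact: mom_L2. Qed.
Let j2 := flux_L2.

Let nV : \int[mu]_v V v = 0. Proof. exact: V0. Qed.

Lemma ip_f_V q : L2 nu q -> ip m f (tens V q) = eps * ip nu flux q.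
Proof.
move=> q2; have M2 := mom_L2 V2 f2.
by rewrite -ip_mom // /flux ipZl // mulrA divff ?gt_eqF // mul1r.
Qed.

(** As v has mean 0, f may be replaced by its fluctuation [f \- lift rhof], whose norm is O(eps);
    this compensates the factor 1 / eps in [flux]. *)
Lemma flux_bound : ip nu flux flux <= ip mu V V * (G / (2 * a)).
Proof.
have M2 := mom_L2 V2 f2; have D2 := mom_L2 V2 d2.
have -> : ip nu flux flux = eps^-1 ^+ 2 * ip nu (mom mu V f) (mom mu V f).
  by rewrite /flux ipZl ?ipZr // ?mulrA //; exact: L2Z.
have W q : L2 nu q -> ip nu (mom mu V f) q = ip nu (mom mu V (f \- lift rhof)) q.
  move=> q2; have t2 := L2_tens V2 q2.
  by rewrite (ip_mom V2 f2 q2) (ip_mom V2 d2 q2) (ipBl f2 lF2 t2) ip_lift_tens // nV mul0r subr0.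
rewrite (ip_weak_eq M2 D2 W).
apply: (@le_trans _ _ (eps^-1 ^+ 2 * (ip mu V V * (eps ^+ 2 * G / (2 * a))))).
  rewrite ler_wpM2l ?sqr_ge0 // (le_trans (mom_le V2 d2)) //.
  by rewrite ler_wpM2l ?ip_ge0 ?fluct_bound.
by rewrite le_eqVlt; apply/orP; left; apply/eqP; field; rewrite !gt_eqF.
Qed.

Lemma ip_coll_lift X : L2 nu X -> ip m coll (lift X) = eps * ip nu (g \- rhof) X.
Proof.
move=> X2; have lX2 := L2_lift mu X2; have sX2 := sigL2 X2.
have lsX2 := L2_lift mu sX2.
have gf : L2 m (lift g \- f) by exact: L2B.
rewrite /coll (ipBl (L2Z eps gf) (L2Z eps^-1 sd2)) // !ipZl //.
have -> : ip m (lift sig \* (f \- lift rhof)) (lift X) =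
   ip m (f \- lift rhof) (lift (sig \* X)).
  by apply: eq_Rintegral => z _; rewrite /lift /=; ring.
rewrite (ipBl f2) // (ip_mean f2 sX2) ip_lift // subrr mulr0 subr0.
by rewrite ipBl // ip_lift // (ip_mean f2 X2) ipBl.
Qed.

(** The weak form of j' = g - F. A mean free [psi] removes the inflow; integration by parts,
    velocity by velocity, then pairs [coll] with the primitive of [psi], and in this pairing the
    collision term averages out ([ip_coll_lift]). *)
Lemma flux_eq psi : L2 nu psi -> \int[nu]_x psi x = 0 ->
  ip nu flux psi = - ip nu (g \- rhof) (prim nu psi).
Proof.
move=> psi2 psi0; have P2 := L2_prim psi2; have lP2 := L2_lift mu P2.
apply: (@mulfI _ eps); first by rewrite gt_eqF.
rewrite -ip_f_V // mulrN -ip_coll_lift // (ip_sections f2 (L2_tens V2 psi2)).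
rewrite (ip_sections T2 lP2).
rewrite -[RHS]mulN1r -RintZ; last exact: L1_sections.
apply: Rint_ae.
- exact: (L1_meas (L1_sections f2 (L2_tens V2 psi2))).
- exact: (L1_meas (L1Z (-1) (L1_sections T2 lP2))).
- apply: filterS transport_weak => v [c2 fv2 /(_ _ psi2) H] /=.
  have -> : (fun x => tens V psi (x, v)) = v \*o psi by [].
  rewrite ipZr // H psi0 mulr0 add0r prim_ibp // psi0 mulr0 sub0r mulN1r.
  by [].
Qed.

Let kk : RT -> R := - (1) \*o ((eps ^+ 2) \*o flux \+ sig \* flux).
Let kk2 : L2 nu kk.
Proof. by apply: L2Z; apply: L2D; [exact: L2Z|exact: sigL2]. Qed.

(** Against v X(x) the terms in g and F vanish, since v has mean 0, and f contributes eps times the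
    flux. *)
Let ip_coll_tens X : L2 nu X -> ip m coll (tens V X) = ip nu kk X.
Proof.
move=> X2; have tX2 := L2_tens V2 X2; have sX2 := sigL2 X2.
have tsX2 := L2_tens V2 sX2.
have gf : L2 m (lift g \- f) by exact: L2B.
rewrite /coll (ipBl (L2Z eps gf) (L2Z eps^-1 sd2)) // (ipZl eps gf tX2) (ipZl eps^-1 sd2 tX2).
have -> : ip m (lift sig \* (f \- lift rhof)) (tens V X) =
   ip m (f \- lift rhof) (tens V (sig \* X)).
  by apply: eq_Rintegral => z _; rewrite /lift /tens /=; ring.
rewrite (ipBl f2) // (ip_f_V sX2) ip_lift_tens // nV mul0r subr0.
rewrite ipBl // ip_lift_tens // nV mul0r sub0r ip_f_V //.
have e1 : L2 nu ((eps ^+ 2) \*o flux) by exact: L2Z.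
have e2 := sigL2 j2.
rewrite /kk (ipZl (-1) (L2D e1 e2) X2) (ipDl e1 e2 X2) (ipZl _ j2 X2).
rewrite mulrA mulVf ?gt_eqF // mul1r.
have -> : ip nu (sig \* flux) X = ip nu flux (sig \* X).
  by apply: eq_Rintegral => z _ /=; ring.
by rewrite expr2; ring.
Qed.

Definition P0 : R := \int[mu]_v (v * inflow v).

(* <v^2 f>: its derivative is kk = <v coll>, by the transport equation *)
Definition pressure : RT -> R := cst P0 \+ prim nu kk.

Lemma pressure_L2 : L2 nu pressure.
Proof. by apply: L2D; [exact: (L2_cst (fin1 nu))|exact: L2_prim]. Qed.

(** Identifies [pressure] with <v^2 f> by pairing v f with v q. Both are square integrable as soon
    as v is, whereas v^2 need not be. *)
Lemma pressure_weak q : L2 nu q -> ip m vf (tens V q) = ip nu pressure q.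
Proof.
move=> q2; have P2 := L2_prim q2; have tq2 := L2_tens V2 q2.
have tP2 := L2_tens V2 P2; have c2 := L2_cst (fin1 nu) 1.
have tc2 := L2_tens V2 c2; have W := vf_L2.
have i1 : L1 mu (V \* inflow) := L2M V2 inflow_L2.
rewrite (ip_sections W tq2) /pressure.
rewrite (ipDl (L2_cst (fin1 nu) P0) (L2_prim kk2) q2) (prim_ibp noatom kk2 q2) -(ip_coll_tens P2) -(ip1r nu kk) -(ip_coll_tens c2).
rewrite (_ : ip nu (cst P0) q = P0 * \int[nu]_x q x); last first.
  by rewrite /ip -RintZ //; exact: (L2_L1 (fin1 nu)).
rewrite (ip_sections T2 tc2) (ip_sections T2 tP2).
set Q := \int[nu]_x q x.
have l1 := L1_sections T2 tc2; have l2 := L1_sections T2 tP2.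
rewrite addrA -mulrDl /P0 -(RintD i1 l1) -RintegralZr //; last exact: L1D.
rewrite -RintB //; last first.
  by have := L1Z Q (L1D i1 l1); congr L1; apply/funext => v /=; rewrite mulrC.
apply: Rint_ae.
- exact: (L1_meas (L1_sections W tq2)).
- apply: L1_meas; apply: (L1B _ l2).
  by have := L1Z Q (L1D i1 l1); congr L1; apply/funext => v /=; rewrite mulrC.
- apply: filterS transport_weak => v [cv2 fv2 /(_ _ q2) H] /=.
  have -> : (fun x => tens V q (x, v)) = v \*o q by [].
  have -> : (fun x => tens V (prim nu q) (x, v)) = v \*o prim nu q by [].
  have -> : (fun x => tens V (cst 1) (x, v)) = v \*o cst 1 by [].
  have -> : (fun x => vf (x, v)) = v \*o (fun x => f (x, v)) by [].
  have p2 := L2_prim q2.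
  rewrite (ipZr v (L2Z v fv2) q2) (ipZl v fv2 q2) (ipZr v cv2 c2) (ipZr v cv2 p2).
  by rewrite H (prim_ibp noatom cv2 q2) (ip1r nu) -/Q; ring.
Qed.

Section Truncation.
Variable M : R.
Hypothesis M0 : 0 < M.

(* <|v|^3> may be infinite: velocities are cut off at M, and the remaining
   second moment [tail] tends to 0 as M tends to infinity. *)
Let below (v : RT) : R := if `|v| <= M then 1 else 0.
Let c : RT -> R := below \* V.
Let u : RT -> R := V \- c.
Let w : RT -> R := V \* c.

Let mbelow : measurable_fun setT below.
Proof. by apply: measurable_fun_ifT => //; apply: measurable_fun_ler. Qed.

Let below_abs v : `|below v| <= 1.
Proof. by rewrite /below; case: ifP; rewrite ?normr1 ?normr0. Qed.

Let c2 : L2 mu c. Proof. exact: (L2_mull mbelow below_abs V2). Qed.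
Let u2 : L2 mu u. Proof. exact: L2B. Qed.

Let w_abs v : `|w v| <= M ^+ 2.
Proof.
rewrite /w /c /below /=; case: ifP => [vM|_]; last by rewrite mul0r mulr0 normr0 sqr_ge0.
by rewrite mul1r -expr2 ger0_norm ?sqr_ge0 // sqr_le_abs.
Qed.

Let w2 : L2 mu w.
Proof.
have [mc _] := c2; apply: (L2_bounded (fin1 mu) _ w_abs).
exact: measurable_funM.
Qed.

Definition tail : R := ip mu u u.

Let wD : \int[mu]_v w v = ip mu V V - tail.
Proof.
rewrite /tail /ip -RintB; [|exact: L2M|exact: L2M].
apply: eq_Rintegral => v _; rewrite /w /u /c /= /below.
by case: ifP => _; ring.
Qed.

Let ww : ip mu w w <= M ^+ 4.
Proof.
have m1 : vol mu = 1 by rewrite /vol; rewrite mu1.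
rewrite -[leRHS]mul1r -m1; apply: ip_bound_le => // v.
by rewrite (_ : 4 = 2 * 2)%N // exprM sqr_le_abs.
Qed.

(** Splits v^2 f into w f and u v f, where w is v^2 cut off at M. As w has integral D - tail, P - D
    F = <w (f - F)> + <u v f> - tail F. The first term is small by [fluct_bound] and |w| <= M^2; the
    other two carry the tail. *)
Lemma pressure_close :
  ip nu (pressure \- ip mu V V \*o rhof) (pressure \- ip mu V V \*o rhof) <=
  4 * (M ^+ 4 * (eps ^+ 2 * G / (2 * a))) + 4 * (tail * CV) + 2 * (tail ^+ 2 * G).
Proof.
have W := vf_L2; have PL := pressure_L2; have DF := L2Z (ip mu V V) F2.
have m1 := mom_L2 w2 d2; have m2 := mom_L2 u2 W.
have tF := L2Z tail F2; have m12 := L2D m1 m2.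
pose A := (mom mu w (f \- lift rhof) \+ mom mu u vf) \- tail \*o rhof.
have A2 : L2 nu A by exact: L2B.
have E q : L2 nu q -> ip nu (pressure \- ip mu V V \*o rhof) q = ip nu A q.
  move=> q2; have tw := L2_tens w2 q2; have tu := L2_tens u2 q2.
  have tc := L2_tens c2 q2.
  rewrite (ipBl PL DF q2) (ipZl _ F2 q2) -(pressure_weak q2).
  rewrite (ipBl m12 tF q2) (ipDl m1 m2 q2) (ipZl _ F2 q2).
  rewrite (ip_mom w2 d2 q2) (ip_mom u2 W q2) (ipBl f2 lF2 tw) ip_lift_tens // wD.
  have -> : tens V q = tens c q \+ tens u q :> (RT * RT -> R).
    by apply/funext => z; rewrite /tens /u /=; ring.
  rewrite (ipDr tc tu W).
  have -> : ip m vf (tens c q) = ip m f (tens w q).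
    by apply: eq_Rintegral => z _; rewrite /vf /tens /w /=; ring.
  by ring.
rewrite (ip_weak_eq (L2B PL DF) A2 E).
apply: le_trans (ipB_le m12 tF) _.
have h1 := ipD_le m1 m2.
have h2 : ip nu (mom mu w (f \- lift rhof)) (mom mu w (f \- lift rhof)) <=
   M ^+ 4 * (eps ^+ 2 * G / (2 * a)).
  apply: le_trans (mom_le w2 d2) _; apply: ler_pM => //; try exact: ip_ge0.
  exact: fluct_bound.
have h3 : ip nu (mom mu u vf) (mom mu u vf) <= tail * CV.
  apply: le_trans (mom_le u2 W) _; rewrite ler_wpM2l ?ip_ge0 //.
  exact: vf_bound.
have h4 : ip nu (tail \*o rhof) (tail \*o rhof) <= tail ^+ 2 * G.
  rewrite (ipZl _ F2 tF) (ipZr _ F2 F2) mulrA -expr2 ler_wpM2l ?sqr_ge0 //.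
  apply: le_trans f_bound; exact: (mean_le mu1 f2).
exact: combine_le h1 h2 h3 h4.
Qed.

(** For |v| <= M, [tau_sqr] gives s^2 <= tau^2 <= 2 M source, and the integral of [source] is
    O(eps). For larger |v| only [tau_bound] is available, multiplied by the tail. *)
Lemma moment_bound (s : RT -> R) : measurable_fun setT s ->
  (forall v, `|s v| <= `|tau v|) ->
  (\int[mu]_v (v * s v)) ^+ 2 <=
  2 * (ip mu V V * (M * (eps * G))) + 2 * (tail * (vol nu * CT)).
Proof.
move=> ms st; have t2 := tau_L2; have [mt tt1] := t2.
have ss v : s v ^+ 2 <= tau v ^+ 2.
  by rewrite -[leRHS]real_normK ?num_real // sqr_le_abs.
have s2 : L2 mu s.
  split => //; apply: (L1_le _ tt1); first exact: measurable_funM.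
  by move=> v /=; rewrite ger0_norm -!expr2 ?sqr_ge0.
have bs2 := L2_mull mbelow below_abs s2.
have -> : \int[mu]_v (v * s v) = ip mu V (below \* s) + ip mu u s.
  rewrite /ip -RintD; [|exact: L2M|exact: L2M].
  by apply: eq_Rintegral => v _; rewrite /u /c /=; ring.
have sqD (x y : R) : (x + y) ^+ 2 <= 2 * x ^+ 2 + 2 * y ^+ 2.
  by have := sqr_ge0 (x - y); lra.
apply: le_trans (sqD _ _) _; rewrite lerD // ler_wpM2l //.
  apply: le_trans (ip_cauchy V2 bs2) _; rewrite ler_wpM2l ?ip_ge0 //.
  apply: (@le_trans _ _ (2 * M * \int[mu]_v source v)).
    rewrite -RintZ; last exact: source_L1.
    apply: le_Rint_ae; [exact: L2M|by apply: L1Z; exact: source_L1|].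
    apply: filterS tau_sqr => v [tE S0] /=.
    rewrite /below; case: ifP => [vM|_]; last first.
      by rewrite !mul0r mulr_ge0 // mulr_ge0 // ltW.
    rewrite !mul1r -expr2 (le_trans (ss v)) // tE ler_wpM2r //.
    by rewrite ler_wpM2l.
  apply: (@le_trans _ _ (2 * M * (eps * G / 2))).
    by rewrite ler_wpM2l ?source_bound // mulr_ge0 // ltW.
  by rewrite le_eqVlt; apply/orP; left; apply/eqP; field.
apply: le_trans (ip_cauchy u2 s2) _; rewrite ler_wpM2l ?ip_ge0 //.
apply: le_trans tau_bound; apply: le_ip => // v.
Qed.

Definition Cend : R := 2 * (ip mu V V * (M * (eps * G))) + 2 * (tail * (vol nu * CT)).

Lemma P0_bound : P0 ^+ 2 <= Cend.
Proof. exact: (moment_bound inflow_meas inflow_abs). Qed.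

(** The value of P at l is the first moment of inflow + tau, that is, of v times the trace of f at
    l. This is 0 for v < 0 and [tau] otherwise, so [moment_bound] applies again. *)
Lemma P1_bound : (P0 + \int[nu]_x kk x) ^+ 2 <= Cend.
Proof.
have i1 : L1 mu (V \* inflow) := L2M V2 inflow_L2.
have i2 : L1 mu (V \* tau) := L2M V2 tau_L2.
have tc2 := L2_tens V2 oneL2.
have -> : \int[nu]_x kk x = \int[mu]_v (V \* tau) v.
  rewrite -(ip1r nu kk) -(ip_coll_tens oneL2) (ip_sections T2 tc2).
  apply: Rint_ae.
  - exact: (L1_meas (L1_sections T2 tc2)).
  - exact: (L1_meas i2).
  - apply: filterS (L2_ae2 T2) => v cv2.
    have -> : (fun x => tens V (cst 1) (x, v)) = v \*o cst 1 by [].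
    by rewrite (ipZr v cv2 oneL2) (ip1r nu).
rewrite /P0 -(RintD i1 i2).
have -> : \int[mu]_v (V \* inflow \+ V \* tau) v = \int[mu]_v (v * (inflow v + tau v)).
  by apply: eq_Rintegral => v _ /=; ring.
apply: (moment_bound (s := inflow \+ tau)).
  by apply: measurable_funD; [exact: inflow_meas|exact: tau_meas].
move=> v /=; rewrite /inflow; case: ifP => _; last by rewrite add0r.
by rewrite addrC subrr normr0.
Qed.

End Truncation.

End Kinetic.

Lemma sqr_sum4_le (R : realDomainType) (x y z t : R) :
  (x - y + z + t) ^+ 2 <= 4 * (x ^+ 2 + y ^+ 2 + z ^+ 2 + t ^+ 2).
Proof.
have := sqr_ge0 (x + y); have := sqr_ge0 (x - z); have := sqr_ge0 (x - t).
have := sqr_ge0 (y + z); have := sqr_ge0 (y + t); have := sqr_ge0 (z - t).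
by move=> *; nra.
Qed.

(** Each of the two error pairings may use up a quarter of D E, and half of it remains. *)
Lemma young_absorb (R : realFieldType) (D E x y z X Y : R) : 0 < D ->
  D * E <= x + y + z -> x <= D / 4 * E + X / D -> y <= D / 4 * E + Y / D ->
  D / 2 * E <= (X + Y) / D + z.
Proof. by move=> D0 h1 h2 h3; rewrite mulrDl; lra. Qed.

(** * Comparison with the diffusion limit *)

Section Stability.
Context (R : realType).
Variable nu : {finite_measure set (measurableTypeR R) -> \bar R}.
Local Notation RT := (measurableTypeR R).
Hypothesis noatom : forall x, nu [set x] = 0%E.
Hypothesis vol0 : 0 < vol nu.
Variables (D a b eta : R) (sig s g F j rho J : RT -> R) (p0 : R).
Hypotheses (D0 : 0 < D) (a0 : 0 < a).
Hypotheses (msig : measurable_fun setT sig) (ms : measurable_fun setT s).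
Hypothesis sigab : forall x, a <= sig x <= b.
Hypothesis sab : forall x, a <= s x <= b.
Hypotheses (g2 : L2 nu g) (F2 : L2 nu F) (j2 : L2 nu j) (rho2 : L2 nu rho)
  (J2 : L2 nu J).
Hypothesis jE : forall psi, L2 nu psi -> \int[nu]_x psi x = 0 ->
  ip nu j psi = - ip nu (g \- F) (prim nu psi).
Hypothesis JE : forall psi, L2 nu psi -> \int[nu]_x psi x = 0 ->
  ip nu J psi = - ip nu (g \- rho) (prim nu psi).
Hypothesis rhoE : forall x, D * rho x = - prim nu (s \* J) x.
Hypothesis rho_end : \int[nu]_x (s \* J) x = 0.

(* In the application eta = eps^2, F = <f>, j is the flux of f and P its
   pressure; s, rho and J are the limits of sig, F and j. *)
Let kk : RT -> R := -1 \*o (eta \*o j \+ sig \* j).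
Let P : RT -> R := cst p0 \+ prim nu kk.
Let defect : RT -> R := (sig \- s) \* J.

Let bounded_abs (h : RT -> R) : (forall x, a <= h x <= b) -> forall x, `|h x| <= b.
Proof.
move=> hab x; have /andP[h1 h2] := hab x.
by rewrite ger0_norm // (le_trans _ h1) // ltW.
Qed.

Let sigL2 p : L2 nu p -> L2 nu (sig \* p).
Proof. exact: (L2_mull msig (bounded_abs sigab)). Qed.
Let sL2 p : L2 nu p -> L2 nu (s \* p).
Proof. exact: (L2_mull ms (bounded_abs sab)). Qed.

Let e : RT -> R := F \- rho.
Let k : RT -> R := j \- J.
Let e2 : L2 nu e. Proof. exact: L2B. Qed.
Let k2 : L2 nu k. Proof. exact: L2B. Qed.
Let sk2 := sigL2 k2.
Let sj2 := sigL2 j2.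
Let sJ2 := sL2 J2.
Let c1 : L2 nu (cst 1). Proof. exact: (L2_cst (fin1 nu)). Qed.
Let cp : L2 nu (cst p0). Proof. exact: (L2_cst (fin1 nu)). Qed.

Lemma defect_L2 : L2 nu defect.
Proof.
have := L2B (sigL2 J2) sJ2; congr L2.
by apply/funext => x; rewrite /defect /=; ring.
Qed.
Let df2 := defect_L2.

Let toL1 p : L2 nu p -> L1 nu p. Proof. exact: (L2_L1 (fin1 nu)). Qed.

Let ej2 : L2 nu (eta \*o j). Proof. exact: L2Z. Qed.
Let kk2 : L2 nu kk. Proof. by apply: L2Z; apply: L2D. Qed.
Let P2 : L2 nu P. Proof. by apply: L2D => //; exact: L2_prim. Qed.

(** The splitting sig j = sig (j - J) + (sig - s) J + s J. The last term is - D rho', and [sig]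
    meets [s] only in the middle one. *)
Let kkE : kk = -1 \*o (((eta \*o j \+ sig \* k) \+ defect) \+ s \* J).
Proof. by apply/funext => x; rewrite /kk /defect /k /=; ring. Qed.

Let primkk x : prim nu kk x =
  - (eta * prim nu j x) - prim nu (sig \* k) x - prim nu defect x + D * rho x.
Proof.
have l1 := toL1 ej2; have l2 := toL1 sk2; have l3 := toL1 df2.
have l4 := toL1 sJ2; have l5 := L1D l1 l2; have l6 := L1D l5 l3.
rewrite kkE (primZ _ _ (L1D l6 l4)) (primD _ l6 l4) (primD _ l5 l3) (primD _ l1 l2).
by rewrite (primZ _ _ (toL1 j2)) rhoE; ring.
Qed.

Let intkk : \int[nu]_x kk x = - (eta * \int[nu]_x j x) - \int[nu]_x (sig \* k) x
  - \int[nu]_x defect x.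
Proof.
have l1 := toL1 ej2; have l2 := toL1 sk2; have l3 := toL1 df2.
have l4 := toL1 sJ2; have l5 := L1D l1 l2; have l6 := L1D l5 l3.
rewrite kkE (RintZ _ (L1D l6 l4)) (RintD l6 l4) (RintD l5 l3) (RintD l1 l2).
by rewrite (RintZ _ (toL1 j2)) rho_end; ring.
Qed.

(** The part of the error in D e that is small in L^2: pressure gap, eta term and primitive of the
    defect. The other part, [Lf] below, comes from the end values of P and from the mean of sig
    k. *)
Let om : RT -> R := ((D \*o F \- P) \- eta \*o prim nu j) \- prim nu defect.
Let DFP2 : L2 nu (D \*o F \- P). Proof. by apply: L2B => //; exact: L2Z. Qed.
Let epj2 : L2 nu (eta \*o prim nu j). Proof. by apply: L2Z; exact: L2_prim. Qed.
Let om2 : L2 nu om.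
Proof. by apply: L2B; [exact: L2B|exact: L2_prim]. Qed.

Let mb : R := - \int[nu]_x (sig \* k) x / vol nu.
(* Testing with sig (j - J), made mean free, gives D |F - rho|^2 up to small
   terms; only J, which does not depend on eps, meets the weak-* convergence. *)
Let psi : RT -> R := -1 \*o (sig \* k) \- mb \*o cst 1.
Let skm2 : L2 nu (-1 \*o (sig \* k)). Proof. exact: L2Z. Qed.
Let mc2 : L2 nu (mb \*o cst 1). Proof. exact: L2Z. Qed.
Let psi2 : L2 nu psi. Proof. exact: L2B. Qed.

Let psi0 : \int[nu]_x psi x = 0.
Proof.
rewrite /psi (RintB (toL1 skm2) (toL1 mc2)) (RintZ _ (toL1 sk2)) (RintZ _ (toL1 c1)).
have -> : \int[nu]_x cst 1 x = vol nu by rewrite -(ip1r nu) (ip11 nu).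
by rewrite /mb; field; rewrite gt_eqF.
Qed.

Let Lf : RT -> R := cst p0 \+ mb \*o prim nu (cst 1).
Let pc2 : L2 nu (prim nu (cst 1)). Proof. exact: L2_prim. Qed.
Let mpc2 : L2 nu (mb \*o prim nu (cst 1)). Proof. exact: L2Z. Qed.
Let Lf2 : L2 nu Lf. Proof. exact: L2D. Qed.
Let De2 : L2 nu (D \*o e). Proof. exact: L2Z. Qed.

Let prim_psi : prim nu psi = (D \*o e \- om) \- Lf.
Proof.
apply/funext => x; rewrite /psi (primB _ (toL1 skm2) (toL1 mc2)).
rewrite (primZ _ _ (toL1 sk2)) (primZ _ _ (toL1 c1)).
by rewrite /Lf /om /P /e /= primkk; ring.
Qed.

(** [ip nu k psi] is computed twice: from the form of [psi], and, on subtracting [jE] and [JE], as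
    the pairing of e with the primitive of [psi], which is D e up to [om] and [Lf]. *)
Let balance : D * ip nu e e = ip nu e om + ip nu e Lf
   + (- mb * ip nu k (cst 1) - ip nu k (sig \* k)).
Proof.
have pp2 := L2_prim psi2.
have : ip nu k psi = ip nu e (prim nu psi).
  rewrite (ipBl j2 J2 psi2) (jE psi2 psi0) (JE psi2 psi0).
  rewrite (ipBl g2 F2 pp2) (ipBl g2 rho2 pp2) (ipBl F2 rho2 pp2); ring.
rewrite prim_psi (ipBr (L2B De2 om2) Lf2 e2) (ipBr De2 om2 e2) (ipZr _ e2 e2).
rewrite (ipBr skm2 mc2 k2) (ipZr _ k2 sk2) (ipZr _ k2 c1).
by move: (ip nu _ _) (ip nu _ _) (ip nu _ _) => x y z; move: (ip nu _ _) (ip nu _ _) => t u; lra.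
Qed.

Let young (h : RT -> R) : L2 nu h ->
  ip nu e h <= D / 4 * ip nu e e + ip nu h h / D.
Proof.
move=> h2; have := ip_ge0 nu ((D / 2) \*o e \- h).
have De : L2 nu ((D / 2) \*o e) by exact: L2Z.
rewrite (ipBl De h2 (L2B De h2)) (ipBr De h2 De) (ipBr De h2 h2).
rewrite (ipZl _ e2 De) (ipZl _ e2 h2) (ipZr _ e2 e2) (ipC _ h) (ipZl _ e2 h2).
move: (ip nu e e) (ip nu e h) (ip nu h h) => x y z H.
have : 0 <= (D / 2 * (D / 2 * x) - D / 2 * y - (D / 2 * y - z)) / D.
  by rewrite divr_ge0 // ltW.
have -> : (D / 2 * (D / 2 * x) - D / 2 * y - (D / 2 * y - z)) / D =
  D / 4 * x - y + z / D by field; rewrite gt_eqF.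
by lra.
Qed.

Let sk_ge0 : 0 <= ip nu k (sig \* k).
Proof.
apply: Rintegral_ge0 => x _ /=; rewrite mulrCA mulr_ge0 ?sqr_ge0 //.
  by have /andP[h _] := sigab x; rewrite (le_trans _ h) // ltW.
Qed.

Let om_le : ip nu om om <= 4 * ip nu (P \- D \*o F) (P \- D \*o F)
  + 4 * (eta ^+ 2 * (vol nu ^+ 2 * ip nu j j)) + 2 * ip nu (prim nu defect) (prim nu defect).
Proof.
have h1 := ipB_le (L2B DFP2 epj2) (L2_prim df2).
have h2 := ipB_le DFP2 epj2.
have h3 : ip nu (eta \*o prim nu j) (eta \*o prim nu j) <= eta ^+ 2 * (vol nu ^+ 2 * ip nu j j).
  have pj2 := L2_prim j2.
  rewrite (ipZl _ pj2 epj2) (ipZr _ pj2 pj2) mulrA -expr2.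
  by rewrite ler_wpM2l ?sqr_ge0 // ip_prim_le.
have h4 : ip nu (D \*o F \- P) (D \*o F \- P) = ip nu (P \- D \*o F) (P \- D \*o F).
  by apply: eq_Rintegral => x _ /=; ring.
rewrite h4 in h2; move: h1 h2 h3.
move: (ip nu om om) (ip nu (P \- _) _) (ip nu (prim nu defect) _) (eta ^+ 2 * _).
move: (ip nu (eta \*o _) _) (ip nu _ _) => x y z t u v; lra.
Qed.

Let Y : R := 4 * ((p0 + \int[nu]_x kk x) ^+ 2 + p0 ^+ 2
  + eta ^+ 2 * (vol nu * ip nu j j) + (\int[nu]_x defect x) ^+ 2).

(** The integral of sig k is read off the increment of P over the slab, hence off its end values. D
    rho does not enter, as it vanishes at both ends ([rho_end]). *)
Let mb_le : (mb * vol nu) ^+ 2 <= Y.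
Proof.
have -> : mb * vol nu = (p0 + \int[nu]_x kk x) - p0 + eta * \int[nu]_x j x
  + \int[nu]_x defect x.
  rewrite intkk /mb; field; by rewrite gt_eqF.
apply: le_trans (sqr_sum4_le _ _ _ _) _; rewrite ler_wpM2l // lerD2r lerD2l.
by rewrite exprMn ler_wpM2l ?sqr_ge0 // int_sqr_le.
Qed.

Let Lf_le : ip nu Lf Lf <= 2 * (vol nu * p0 ^+ 2) + 2 * (vol nu * Y).
Proof.
apply: le_trans (ipD_le cp mpc2) _; rewrite lerD // ler_wpM2l //.
  by apply: ip_bound_le => // x.
rewrite (ipZl _ pc2 mpc2) (ipZr _ pc2 pc2) mulrA -expr2.
have h := ip_prim_le c1.
apply: (@le_trans _ _ (mb ^+ 2 * (vol nu ^+ 2 * vol nu))).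
  rewrite ler_wpM2l ?sqr_ge0 // (le_trans h) // (ip11 nu) //.
by rewrite mulrA -exprMn mulrC ler_wpM2l // ltW.
Qed.

Lemma stability : D / 2 * ip nu e e <=
  ((4 * ip nu (P \- D \*o F) (P \- D \*o F)
  + 4 * (eta ^+ 2 * (vol nu ^+ 2 * ip nu j j)) + 2 * ip nu (prim nu defect) (prim nu defect))
  + (2 * (vol nu * p0 ^+ 2) + 2 * (vol nu * Y))) / D
  + Num.sqrt Y / vol nu * Num.sqrt (vol nu * ip nu k k).
Proof.
apply: (young_absorb D0 (x := ip nu e om) (y := ip nu e Lf)).
- rewrite balance lerD2l (le_trans (_ : _ <= - mb * ip nu k (cst 1))) ?gerBl //.
  apply: le_trans (ler_norm _) _; rewrite normrM normrN.
  apply: ler_pM => //.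
    rewrite ler_pdivlMr // -(ger0_norm (ltW vol0)) -normrM -sqrtr_sqr ler_sqrt //.
    by rewrite (le_trans _ mb_le) // sqr_ge0.
  rewrite -sqrtr_sqr ler_sqrt ?mulr_ge0 ?vol_ge0 ?ip_ge0 //.
  by rewrite (ip1r nu) int_sqr_le.
- apply: le_trans (young om2) _.
  by rewrite lerD2l ler_pM2r ?invr_gt0 // om_le.
- apply: le_trans (young Lf2) _.
  by rewrite lerD2l ler_pM2r ?invr_gt0 // Lf_le.
Qed.

End Stability.

(** * Passage to the limit in eps *)

Section DCT.
Context d (T : measurableType d) (R : realType).
Variable m : {measure set T -> \bar R}.

Lemma Rint_dct (h_ : nat -> T -> R) (h k : T -> R) :
  (forall n, measurable_fun setT (h_ n)) -> measurable_fun setT h -> L1 m k ->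
  (forall x, h_ n x @[n --> \oo] --> h x) -> (forall n x, `|h_ n x| <= k x) ->
  \int[m]_x h_ n x @[n --> \oo] --> \int[m]_x h x.
Proof.
move=> mh_ mh k1 hh hk.
have [||||ih _ H] := @dominated_convergence _ _ _ m setT measurableT
  (fun n x => (h_ n x)%:E) (fun x => (h x)%:E) (fun x => (k x)%:E) _ _ _ k1 _.
- by move=> n; exact/measurable_EFinP.
- exact/measurable_EFinP.
- by apply: aeW => x _; apply: cvg_EFin; [near=> n|exact: hh].
- by apply: aeW => x n _; rewrite /= lee_fin.
apply: fine_cvg; rewrite fineK; last exact: (integrable_fin_num measurableT ih).
exact: H.
Unshelve. all: by end_near. Qed.
End DCT.

Section Small.
Context (R : realType).
Implicit Types h k : R -> R.

(** Only an upper bound is asked: the quantities concerned are nonnegative. *)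
Definition small h := forall delta : R, 0 < delta ->
  \forall eps \near 0^'+, h eps <= delta.

Lemma near0 (r : R) : 0 < r -> \forall eps \near (0 : R)^'+, 0 < eps <= r.
Proof.
move=> r0; near=> eps; apply/andP; split => //.
by near: eps; exact: nbhs_right_le.
Unshelve. all: by end_near. Qed.

Lemma small_le h k : (forall eps, 0 < eps <= 1 -> h eps <= k eps) ->
  small k -> small h.
Proof.
move=> hk k0 d d0; apply: filterS2 (near0 ltr01) (k0 d d0) => eps e1.
exact/le_trans/hk.
Qed.

Lemma smallD h k : small h -> small k -> small (fun eps => h eps + k eps).
Proof.
move=> h0 k0 d d0; have d2 : 0 < d / 2 by rewrite divr_gt0.
by apply: filterS2 (h0 _ d2) (k0 _ d2) => eps; lra.
Qed.

Lemma smallZ c h : 0 <= c -> small h -> small (fun eps => c * h eps).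
Proof.
(* Dividing by [c + 1] also covers c = 0. *)
move=> c0 h0 d d0; have d2 : 0 < d / (c + 1) by rewrite divr_gt0 // ltr_wpDl.
apply: filterS (h0 _ d2) => eps H.
apply: (@le_trans _ _ (c * (d / (c + 1)))); first by rewrite ler_wpM2l.
rewrite mulrA ler_pdivrMr; last by rewrite ltr_wpDl.
by nra.
Qed.

Lemma small_sqrt h : small h -> small (fun eps => Num.sqrt (h eps)).
Proof.
move=> h0 d d0; have d2 : 0 < d ^+ 2 by rewrite exprn_gt0.
apply: filterS (h0 _ d2) => eps H.
by rewrite -(ger0_norm (ltW d0)) -sqrtr_sqr ler_wsqrtr.
Qed.

Lemma small_id : small id.
Proof. by move=> d d0; apply: filterS (near0 d0) => eps /andP[]. Qed.

Lemma small_cvg h : h eps @[eps --> 0^'+] --> (0 : R) -> small h.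
Proof. by move=> h0 d d0; near=> eps; near: eps; exact: (cvgr_le _ h0). 
Unshelve. all: by end_near. Qed.

(** M is fixed first, to make [B M] small for every eps; only then is eps sent to 0 in
    [A M * eps]. *)
Lemma small_two_scale h (A B : R -> R) :
  (forall M, 0 < M -> 0 <= A M) ->
  (forall M eps, 0 < M -> 0 < eps <= 1 -> h eps <= A M * eps + B M) ->
  (forall delta, 0 < delta -> exists2 M, 0 < M & B M <= delta) -> small h.
Proof.
move=> A0 hAB Bd d d0; have d2 : 0 < d / 2 by rewrite divr_gt0.
have [M M0 BM] := Bd _ d2.
apply: filterS2 (near0 ltr01) (smallZ (A0 _ M0) small_id d2) => eps e1 H.
by apply: le_trans (hAB _ _ M0 e1) _; rewrite /= in H; lra.
Qed.

End Small.

Section Tail.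
Context (R : realType).
Variable mu : {finite_measure set (measurableTypeR R) -> \bar R}.
Local Notation V := (fun v : measurableTypeR R => v : R).
Hypothesis V2 : L2 mu V.

Lemma tail_ge0 M : 0 <= tail mu M.
Proof. exact: ip_ge0. Qed.

(** Dominated convergence: the integrand is at most v^2 and vanishes as soon as n + 1 >= |v|. *)
Lemma tail_cvg : tail mu n.+1%:R @[n --> \oo] --> 0.
Proof.
have -> : (0 : R) = \int[mu]_v (cst 0) v by rewrite Rintegral_cst // mul0r.
have [_ V1] := V2.
apply: (@Rint_dct _ _ _ mu _ _ (V \* V)) => //.
- move=> n; apply: measurable_funM; apply: measurable_funB => //;
  by apply: measurable_funM => //; apply: measurable_fun_ifT => //; apply: measurable_fun_ler.
- move=> v; apply: cvg_near_cst; near=> n => /=.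
  rewrite ifT ?mul1r ?subrr ?mul0r //.
  have : `|v| <= n%:R by near: n; exact: nbhs_infty_ger.
  by move=> /le_trans; apply; rewrite ler_nat.
- move=> n v /=; case: ifP => _; rewrite ?mul1r ?mul0r ?subrr ?subr0 ?mul0r ?normr0.
    by rewrite -expr2 sqr_ge0.
  by rewrite ger0_norm // -expr2 sqr_ge0.
Unshelve. all: by end_near. Qed.

Lemma tail_small delta : 0 < delta -> exists2 M, 0 < M & tail mu M <= delta.
Proof.
move=> d0; have : \forall n \near \oo, tail mu n.+1%:R <= delta.
  exact: (cvgr_le _ tail_cvg).
by move=> [N _ /(_ N (leqnn N)) H]; exists N.+1%:R.
Qed.

End Tail.

Lemma sqr_le_self (R : realDomainType) (t : R) : 0 <= t -> t <= 1 -> t ^+ 2 <= t.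
Proof. by move=> t0 t1; nra. Qed.

Lemma le_scale_eps (R : realDomainType) (eps K : R) :
  0 < eps <= 1 -> 0 <= K -> eps ^+ 2 * K <= K * eps.
Proof.
move=> /andP[e0 e1] K0; rewrite expr2 -mulrA mulrCA mulrC (mulrC K).
by rewrite ler_piMr // mulr_ge0 // ltW.
Qed.

Section Limit.
Context (R : realType).
Variables (nu mu : {finite_measure set (measurableTypeR R) -> \bar R}).
Local Notation m := (nu \x mu)%E.
Local Notation RT := (measurableTypeR R).
Hypothesis mu1 : mu setT = 1%E.
Hypothesis noatom : forall x, nu [set x] = 0%E.
Hypothesis vol0 : 0 < vol nu.
Local Notation V := (fun v : RT => v : R).
Hypothesis V2 : L2 mu V.
Hypothesis V0 : \int[mu]_v v = 0.
Local Notation D := (ip mu V V).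
Hypothesis D0 : 0 < D.
Variables (a b : R) (sig : R -> RT -> R) (s g : RT -> R) (f : R -> RT * RT -> R).
Variables (rho J : RT -> R).
Hypothesis a0 : 0 < a.
Hypothesis msig : forall eps, 0 < eps -> measurable_fun setT (sig eps).
Hypothesis sigab : forall eps, 0 < eps -> forall x, a <= sig eps x <= b.
Hypothesis ms : measurable_fun setT s.
Hypothesis sab : forall x, a <= s x <= b.
Hypothesis g2 : L2 nu g.
Hypothesis f2 : forall eps, 0 < eps -> L2 m (f eps).
Hypothesis transport : forall eps, 0 < eps -> {ae mu, forall v : RT,
  (v = 0 -> {ae nu, forall x, coll mu eps (sig eps) g (f eps) (x, v) = 0}) /\
  {ae nu, forall x, v * f eps (x, v) = inflow nu mu eps (sig eps) g (f eps) v
    + prim nu (fun y => coll mu eps (sig eps) g (f eps) (y, v)) x}}.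
Hypothesis weak_star : forall phi, L1 nu phi ->
  \int[nu]_x (sig eps x * phi x) @[eps --> 0^'+] --> \int[nu]_x (s x * phi x).
Hypotheses (rho2 : L2 nu rho) (J2 : L2 nu J).
Hypothesis JE : forall psi, L2 nu psi -> \int[nu]_x psi x = 0 ->
  ip nu J psi = - ip nu (g \- rho) (prim nu psi).
Hypothesis rhoE : forall x, D * rho x = - prim nu (s \* J) x.
Hypothesis rho_end : \int[nu]_x (s \* J) x = 0.

Let G := ip nu g g.
Let G0 : 0 <= G. Proof. exact: ip_ge0. Qed.
Let Kj := D * (G / (2 * a)).
Let Kj0 : 0 <= Kj.
Proof. by rewrite mulr_ge0 ?ip_ge0 // divr_ge0 // mulr_ge0 // ltW. Qed.
Let KT := CT nu a b g.
Let KV := CV nu a b g.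
Let KT0 : 0 <= KT.
Proof. by rewrite mulr_ge0 // addr_ge0 // divr_ge0 ?sqr_ge0 // ltW. Qed.
Let KV0 : 0 <= KV.
Proof. by rewrite mulr_ge0 ?KT0 // mulr_ge0 // sqr_ge0. Qed.

Let j eps := flux mu eps (f eps).
Let F eps := rhof mu (f eps).
Let p0 eps := P0 nu mu eps (sig eps) g (f eps).
Let kk eps : RT -> R := -1 \*o (eps ^+ 2 \*o j eps \+ sig eps \* j eps).
Let P eps : RT -> R := cst (p0 eps) \+ prim nu (kk eps).
Let defect eps : RT -> R := (sig eps \- s) \* J.

Let F2 eps : 0 < eps -> L2 nu (F eps).
Proof. by move=> e0; apply: mean_L2; exact: f2. Qed.

Let j2 eps : 0 < eps -> L2 nu (j eps).
Proof. by move=> e0; apply: flux_L2 => //; exact: f2. Qed.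

Let j_le eps : 0 < eps <= 1 -> ip nu (j eps) (j eps) <= Kj.
Proof.
move=> /andP[e0 e1].
exact: (flux_bound mu1 noatom V2 V0 a0 e0 (msig e0) (sigab e0) g2 (f2 e0) (transport e0)).
Qed.

Let fluct eps := ip m (f eps \- lift (F eps)) (f eps \- lift (F eps)).

Let fluct_le eps : 0 < eps <= 1 -> fluct eps <= (G / (2 * a)) * eps.
Proof.
move=> he; have /andP[e0 e1] := he.
apply: le_trans (fluct_bound mu1 noatom a0 e0 (msig e0) (sigab e0) g2 (f2 e0) (transport e0)) _.
rewrite -mulrA; apply: le_scale_eps => //.
by rewrite divr_ge0 // mulr_ge0 // ltW.
Qed.

Let fluct_small : small fluct.
Proof.
apply: (small_le fluct_le); apply: smallZ; last exact: small_id.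
by rewrite divr_ge0 // mulr_ge0 // ltW.
Qed.

(** The extra bound by 1 lets [gap_small] replace the squared tail by the tail. *)
Let tail_scaled (c : R) : 0 <= c -> forall delta, 0 < delta ->
  exists2 M, 0 < M & tail mu M <= 1 /\ c * tail mu M <= delta.
Proof.
move=> c0 delta d0; have c1 : 0 < c + 1 by rewrite ltr_wpDl.
pose t := Num.min 1 (delta / (c + 1)).
have t0 : 0 < t by rewrite lt_min ltr01 divr_gt0.
have [M M0 H] := tail_small V2 t0; exists M => //; split.
  by rewrite (le_trans H) // ge_min lexx.
have H2 : tail mu M <= delta / (c + 1) by rewrite (le_trans H) // ge_min lexx orbT.
apply: (@le_trans _ _ ((c + 1) * tail mu M)).
  by rewrite ler_wpM2r ?tail_ge0 // lerDl.
by rewrite mulrC -ler_pdivlMr.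
Qed.

Let end_small h : (forall M eps, 0 < M -> 0 < eps <= 1 ->
  h eps <= Cend nu mu a b eps g M) -> small h.
Proof.
move=> hC; apply: (@small_two_scale _ _ (fun M => 2 * (D * (M * G)))
  (fun M => 2 * (tail mu M * (vol nu * KT)))).
- by move=> M M0; rewrite !mulr_ge0 ?ip_ge0 // ltW.
- move=> M eps M0 he; apply: le_trans (hC M eps M0 he) _.
  by rewrite /Cend lerD2r -/G -/KT le_eqVlt; apply/orP; left; apply/eqP; ring.
- move=> delta d0.
  have c0 : 0 <= 2 * (vol nu * KT) by apply: mulr_ge0 => //; apply: mulr_ge0 => //; exact: ltW.
  have [M M0 [_ H]] := tail_scaled c0 d0; exists M => //.
  by apply: le_trans H; rewrite le_eqVlt; apply/orP; left; apply/eqP; ring.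
Qed.

Let p0_small : small (fun eps => p0 eps ^+ 2).
Proof.
apply: end_small => M eps M0 /andP[e0 e1].
exact: (P0_bound mu1 noatom V2 a0 e0 e1 (msig e0) (sigab e0) g2 (f2 e0) (transport e0) M0).
Qed.

Let p1_small : small (fun eps => (p0 eps + \int[nu]_x kk eps x) ^+ 2).
Proof.
apply: end_small => M eps M0 /andP[e0 e1].
exact: (P1_bound mu1 noatom V2 V0 a0 e0 e1 (msig e0) (sigab e0) g2 (f2 e0) (transport e0) M0).
Qed.

Let gap eps := ip nu (P eps \- D \*o F eps) (P eps \- D \*o F eps).

Let gap_small : small gap.
Proof.
have K0 : 0 <= G / (2 * a) by rewrite divr_ge0 // mulr_ge0 // ltW.
apply: (@small_two_scale _ _ (fun M => 4 * (M ^+ 4 * (G / (2 * a))))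
  (fun M => 4 * (tail mu M * KV) + 2 * (tail mu M ^+ 2 * G))).
- by move=> M M0 /=; apply: mulr_ge0 => //; apply: mulr_ge0 => //; apply: exprn_ge0; exact: ltW.
- move=> M eps M0 he; have /andP[e0 e1] := he.
  apply: le_trans (pressure_close mu1 noatom V2 V0 a0 e0 e1 (msig e0) (sigab e0)
    g2 (f2 e0) (transport e0) M) _.
  have es : eps ^+ 2 * G / (2 * a) <= G / (2 * a) * eps.
    by rewrite -mulrA; exact: le_scale_eps.
  rewrite -addrA lerD2r.
  apply: (@le_trans _ _ (4 * (M ^+ 4 * (G / (2 * a) * eps)))).
    by apply: ler_wpM2l => //; apply: ler_wpM2l => //; apply: exprn_ge0; exact: ltW.
  by rewrite le_eqVlt; apply/orP; left; apply/eqP; rewrite !mulrA.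
- move=> delta d0.
  have c0 : 0 <= 4 * KV + 2 * G by rewrite addr_ge0 // mulr_ge0.
  have [M M0 [t1 H]] := tail_scaled c0 d0; exists M => //.
  apply: le_trans H; rewrite [leRHS]mulrDl lerD //.
    by rewrite le_eqVlt; apply/orP; left; apply/eqP; ring.
  rewrite -[leRHS]mulrA ler_wpM2l // [leRHS]mulrC ler_wpM2r //.
  by rewrite sqr_le_self ?tail_ge0.
Qed.

Let abs_b (h : RT -> R) : (forall x, a <= h x <= b) -> forall x, `|h x| <= b.
Proof.
move=> hab x; have /andP[h1 h2] := hab x.
by rewrite ger0_norm // (le_trans _ h1) // ltW.
Qed.

Let J1 : L1 nu J. Proof. exact: (L2_L1 (fin1 nu)). Qed.

Let sphi_L1 (h phi : RT -> R) : measurable_fun setT h ->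
  (forall x, a <= h x <= b) -> L1 nu phi -> L1 nu (h \* phi).
Proof.
move=> mh hab p1; apply: (L1_le _ (L1Z b (integrable_norm p1))).
  by apply: measurable_funM => //; exact: L1_meas p1.
by move=> x /=; rewrite normrM ler_wpM2r // abs_b.
Qed.

Let defect_L1 eps : 0 < eps -> L1 nu (defect eps).
Proof.
move=> e0; have := L1B (sphi_L1 (msig e0) (sigab e0) J1) (sphi_L1 ms sab J1).
by congr L1; apply/funext => x; rewrite /defect /=; ring.
Qed.

Let weak_star0 phi : L1 nu phi ->
  \int[nu]_x ((sig eps \- s) \* phi) x @[eps --> 0^'+] --> (0 : R).
Proof.
move=> p1; have H := weak_star p1.
have : \int[nu]_x (sig eps x * phi x) - \int[nu]_x (s x * phi x) @[eps --> 0^'+] --> (0 : R).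
  by rewrite -[X in _ --> X](subrr (\int[nu]_x (s x * phi x))); apply: cvgB => //; exact: cvg_cst.
apply: cvg_trans; apply: near_eq_cvg; apply: filterS (near0 ltr01) => eps /andP[e0 _].
rewrite -(RintB (sphi_L1 (msig e0) (sigab e0) p1) (sphi_L1 ms sab p1)).
by apply: eq_Rintegral => x _ /=; ring.
Qed.

Let defect_end_small : small (fun eps => (\int[nu]_x defect eps x) ^+ 2).
Proof.
apply: small_cvg; have := weak_star0 J1 => H.
by rewrite -[X in _ --> X](mulr0 (0 : R)); under eq_fun do rewrite expr2; exact: cvgM.
Qed.

(** For fixed x the test function is J cut off at x: here weak convergence of sigma becomes
    pointwise convergence of a primitive. *)
Let defect_prim_cvg x : prim nu (defect eps) x @[eps --> 0^'+] --> (0 : R).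
Proof.
have := weak_star0 (L1_step_mul x J1).
apply: cvg_trans; apply: near_eq_cvg; apply: filterS (near0 ltr01) => eps _.
by apply: eq_Rintegral => y _; rewrite /defect /=; ring.
Qed.

Let defect_abs eps x : 0 < eps -> `|prim nu (defect eps) x| <= (2 * b) * \int[nu]_y `|J y|.
Proof.
move=> e0; apply: le_trans (prim_abs_le x (defect_L1 e0)) _.
rewrite -RintZ; last exact: (integrable_norm J1).
apply: le_Rintegral => //.
- exact: (integrable_norm (defect_L1 e0)).
- exact: (L1Z _ (integrable_norm J1)).
- move=> y _; rewrite /defect /= normrM ler_wpM2r //.
  apply: le_trans (ler_normB _ _) _.
  by have := abs_b (sigab e0) y; have := abs_b sab y; lra.
Qed.

Let defect_small : small (fun eps => ip nu (prim nu (defect eps)) (prim nu (defect eps))).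
Proof.
(* Dominated convergence is about sequences, so eps runs along an arbitrary positive sequence
   tending to 0. *)
apply: small_cvg; apply/cvg_at_rightP => u [u0 ucv].
pose C := 2 * b * \int[nu]_y `|J y|.
have mp n : measurable_fun setT (prim nu (defect (u n))).
  by apply: prim_meas; exact: defect_L1.
have -> : (0 : R) = \int[nu]_v (cst 0) v by rewrite Rintegral_cst // mul0r.
apply: (@Rint_dct _ _ _ nu _ _ (cst (C ^+ 2))) => //.
- by move=> n; exact: measurable_funM.
- exact: (L1_cst (fin1 nu)).
- move=> x; rewrite -[X in _ --> X](mulr0 (0 : R)).
  have := defect_prim_cvg x; move/cvg_at_rightP => /(_ u (conj u0 ucv)) H.
  exact: cvgM.
- move=> n x /=; rewrite ger0_norm -expr2 ?sqr_ge0 // sqr_le_abs //.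
  exact: defect_abs.
Qed.

Let flux_small : small (fun eps => (eps ^+ 2) ^+ 2 * Kj).
Proof.
apply: (@small_le _ _ (fun eps => Kj * eps)); last exact (smallZ Kj0 (@small_id R)).
move=> eps he; rewrite mulrC ler_wpM2l //; have /andP[e0 e1] := he.
apply: le_trans (sqr_le_self _ _) _; rewrite ?sqr_ge0 ?expr_le1 ?(ltW e0) //.
by rewrite sqr_le_self // ltW.
Qed.

Let e2 eps := ip nu (F eps \- rho) (F eps \- rho).

Let Y eps := 4 * (((p0 eps + \int[nu]_x kk eps x) ^+ 2 + p0 eps ^+ 2
  + vol nu * ((eps ^+ 2) ^+ 2 * Kj)) + (\int[nu]_x defect eps x) ^+ 2).

Let Y_small : small Y.
Proof.
apply: smallZ => //; apply: smallD => //; apply: smallD; first exact: smallD.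
by apply: smallZ => //; exact: ltW.
Qed.

Let Kk := 2 * Kj + 2 * ip nu J J.

(** The right side of [stability] with the squared norms of j and j - J replaced by their bounds
    [Kj] and [Kk], arranged as nonnegative constants times small quantities. *)
Let limit_bound eps := (D / 2)^-1 * (D^-1 * (((4 * gap eps
  + (4 * vol nu ^+ 2) * ((eps ^+ 2) ^+ 2 * Kj)) + 2 * ip nu (prim nu (defect eps)) (prim nu (defect eps)))
  + ((2 * vol nu) * p0 eps ^+ 2 + (2 * vol nu) * Y eps))
  + ((vol nu)^-1 * Num.sqrt (vol nu * Kk)) * Num.sqrt (Y eps)).

Let limit_bound_small : small limit_bound.
Proof.
have v0 := ltW vol0.
apply: smallZ; first by rewrite invr_ge0 divr_ge0 // ltW.
apply: smallD; last first.
  by apply: smallZ; [rewrite mulr_ge0 ?invr_ge0 // sqrtr_ge0|exact: small_sqrt].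
apply: smallZ; first by rewrite invr_ge0 ltW.
apply: smallD.
  apply: smallD; last exact: smallZ.
  apply: smallD; first exact: smallZ.
  by apply: smallZ => //; rewrite mulr_ge0 ?sqr_ge0.
by apply: smallD; apply: smallZ => //; rewrite mulr_ge0.
Qed.

Let e2_le eps : 0 < eps <= 1 -> e2 eps <= limit_bound eps.
Proof.
move=> he; have /andP[e0 e1] := he; have v0 := ltW vol0.
have D20 : 0 < D / 2 by rewrite divr_gt0.
rewrite /limit_bound ler_pdivlMl //.
have flE psi : L2 nu psi -> \int[nu]_x psi x = 0 ->
   ip nu (j eps) psi = - ip nu (g \- F eps) (prim nu psi).
  exact: (flux_eq mu1 noatom V2 a0 e0 (msig e0) (sigab e0) g2 (f2 e0) (transport e0)).
have := stability vol0 (eps ^+ 2) (p0 eps) D0 a0 (msig e0) ms (sigab e0) sab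
  g2 (F2 e0) (j2 e0) rho2 J2 flE JE rhoE rho_end.
move=> /le_trans; apply.
have jl := j_le he.
have evj : (eps ^+ 2) ^+ 2 * (vol nu * ip nu (j eps) (j eps)) <= vol nu * ((eps ^+ 2) ^+ 2 * Kj).
  by rewrite mulrCA ler_wpM2l // ler_wpM2l // sqr_ge0.
have ev2j : (eps ^+ 2) ^+ 2 * (vol nu ^+ 2 * ip nu (j eps) (j eps)) <= vol nu ^+ 2 * ((eps ^+ 2) ^+ 2 * Kj).
  by rewrite mulrCA ler_wpM2l ?sqr_ge0 // ler_wpM2l // sqr_ge0.
have YY : 4 * ((p0 eps + \int[nu]_x kk eps x) ^+ 2 + p0 eps ^+ 2 +
    (eps ^+ 2) ^+ 2 * (vol nu * ip nu (j eps) (j eps)) +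
    (\int[nu]_x ((sig eps \- s) \* J) x) ^+ 2) <= Y eps.
  by rewrite /Y ler_wpM2l // lerD2r lerD2l.
have kl : ip nu (j eps \- J) (j eps \- J) <= Kk.
  by apply: le_trans (ipB_le (j2 e0) J2) _; rewrite /Kk lerD2r ler_wpM2l.
apply: lerD.
  rewrite mulrC ler_wpM2l ?invr_ge0 ?(ltW D0) // lerD //.
    by rewrite lerD2r lerD2l -mulrA ler_wpM2l.
  rewrite -(mulrA 2 (vol nu) (p0 eps ^+ 2)) -(mulrA 2 (vol nu) (Y eps)) lerD2l.
  by apply: ler_wpM2l => //; apply: ler_wpM2l.
rewrite [leRHS]mulrAC (mulrC (vol nu)^-1 (Num.sqrt (Y eps))).
apply: ler_pM; rewrite ?divr_ge0 ?sqrtr_ge0 //.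
  by apply: ler_wpM2r; [rewrite invr_ge0|exact: ler_wsqrtr].
by apply: ler_wsqrtr; exact: ler_wpM2l.
Qed.

Lemma strong_limit : small (fun eps =>
  ip m (f eps \- lift rho) (f eps \- lift rho)).
Proof.
apply: (@small_le _ _ (fun eps => 2 * fluct eps + 2 * limit_bound eps)); last first.
  by apply: smallD; exact: smallZ.
move=> eps he; have /andP[e0 e1] := he.
have lF2 : L2 m (lift (F eps)) := L2_lift mu (F2 e0).
have lr2 : L2 m (lift rho) := L2_lift mu rho2.
have -> : f eps \- lift rho = (f eps \- lift (F eps)) \+ lift (F eps \- rho).
  by apply/funext => z; rewrite /lift /=; ring.
have e22 := L2B (F2 e0) rho2.
apply: le_trans (ipD_le (L2B (f2 e0) lF2) (L2_lift mu e22)) _.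
by rewrite lerD2l ler_wpM2l // ip_lift // e2_le.
Qed.

End Limit.

(** * Restriction to a measurable domain *)

Section Lfun2.
Context d (T : measurableType d) (R : realType).
Variable m : {measure set T -> \bar R}.

Lemma Lnorm2E (f : T -> R) : L2 m f ->
  ('N[m]_2%:E[EFin \o f])%E = (Num.sqrt (ip m f f))%:E.
Proof.
move=> [mf f2]; rewrite unlock.
have -> : (\int[m]_x (`|(EFin \o f) x| `^ 2) = (ip m f f)%:E)%E.
  rewrite /ip /Rintegral fineK; last exact: (integrable_fin_num measurableT f2).
  apply: eq_integral => x _ /=.
  by rewrite powR_mulrn // -normrX ger0_norm ?sqr_ge0 // expr2.
by rewrite poweR_EFin powR12_sqrt // ip_ge0.
Qed.

Lemma Lfun2P (f : T -> R) : f \in Lfun m 2%:E <-> L2 m f.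
Proof.
split=> [f2|f2].
  split; last exact: Lfun2_integrable_sqr f2.
  by move: f2; rewrite inE => /andP[]; rewrite inE.
rewrite inE; apply/andP; split; rewrite inE; first by case: f2.
by rewrite /= /finite_norm Lnorm2E // ltry.
Qed.

Lemma LonP D (f : T -> R) : Lon m 2%:E D f <-> L2 m (f \_ D).
Proof. exact: Lfun2P. Qed.

Lemma norm_onE D (f : T -> R) : Lon m 2%:E D f ->
  norm_on m 2%:E D f = (Num.sqrt (ip m (f \_ D) (f \_ D)))%:E.
Proof. by move=> /LonP f2; rewrite /norm_on Lnorm2E. Qed.

End Lfun2.

Section Restriction.
Context d (T : measurableType d) (R : realType).
Variables (m m' : {measure set T -> \bar R}) (D : set T).
Hypothesis mD : measurable D.
Hypothesis mm' : forall A, measurable A -> A `<=` D -> m A = m' A.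
Implicit Types f g : T -> R.

Lemma Rint_restr f : \int[m]_(x in D) f x = \int[m']_x (f \_ D) x.
Proof. by rewrite -Rintegral_mkcond; congr fine; exact: eq_measure_integral. Qed.

Lemma L1_restr f : m.-integrable D (EFin \o f) <-> L1 m' (f \_ D).
Proof.
rewrite /L1 (_ : EFin \o f \_ D = (EFin \o f) \_ D); last first.
  by apply/funext => x /=; rewrite /patch; case: ifP.
have E : (\int[m]_(x in D) `|(EFin \o f) x| = \int[m']_(x in D) `|(EFin \o f) x|)%E.
  exact: eq_measure_integral.
by rewrite -integrable_mkcond //; split => /integrableP[mf flty];
  apply/integrableP; split => //; rewrite ?E // -E.
Qed.

Lemma restr_mul f g : (f \_ D) \* (g \_ D) = (f \* g) \_ D.
Proof. by apply/funext => x /=; rewrite /patch; case: ifP; rewrite ?mul0r. Qed.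

Lemma restr_sub f g : (f \_ D) \- (g \_ D) = (f \- g) \_ D.
Proof.
apply/funext => x; rewrite /patch /=; case: (x \in D) => //.
by rewrite subr0.
Qed.

Lemma restrK f : (f \_ D) \_ D = f \_ D.
Proof. by apply/funext => x; rewrite /patch; case: (x \in D). Qed.

Lemma L2_restr f : Lon m 2%:E D f <-> L2 m' (f \_ D).
Proof.
rewrite LonP /L2 restr_mul.
have H : L1 m ((f \* f) \_ D) <-> L1 m' ((f \* f) \_ D).
  rewrite -L1_restr /L1 (_ : EFin \o (f \* f) \_ D = (EFin \o (f \* f)) \_ D).
    by rewrite -integrable_mkcond.
  by apply/funext => x /=; rewrite /patch; case: ifP.
by split => -[mf /H].
Qed.

Lemma ip_restr f g : \int[m]_(x in D) (f x * g x) = ip m' (f \_ D) (g \_ D).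
Proof. by rewrite (Rint_restr (f \* g)) /ip restr_mul. Qed.

Lemma ip_restr_norm f : Lon m 2%:E D f ->
  norm_on m 2%:E D f = (Num.sqrt (ip m' (f \_ D) (f \_ D)))%:E.
Proof.
move=> f2; rewrite norm_onE // -ip_restr; congr (Num.sqrt _)%:E.
by rewrite /ip restr_mul [RHS]Rintegral_mkcond.
Qed.

Hypothesis m'D : m' (~` D) = 0%E.

Lemma ae_restr (P : T -> Prop) :
  {ae m, forall x, D x -> P x} <-> {ae m', forall x, P x}.
Proof.
split=> -[N [mN N0 PN]].
- have N1 : m' (N `&` D) = 0%E.
    rewrite -mm'; [|exact: measurableI|exact: subIsetr].
    by apply/eqP; rewrite -measure_le0 -N0 le_measure ?inE //; exact: measurableI.
  exists ((N `&` D) `|` ~` D); split.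
  + by apply: measurableU; [exact: measurableI|exact: measurableC].
  + apply/eqP; rewrite -measure_le0; apply: le_trans (measureU2 _ _ _) _.
    * exact: measurableI.
    * exact: measurableC.
    * by rewrite [X in (X + _)%E]N1 [X in (_ + X)%E]m'D adde0.
  + move=> x /= nPx; have [Dx|nDx] := pselect (D x); last by right.
    by left; split => //; apply: PN => /= H; apply: nPx; exact: H.
- exists (N `&` D); split.
  + exact: measurableI.
  + rewrite mm'; [|exact: measurableI|exact: subIsetr].
    by apply/eqP; rewrite -measure_le0 -N0 le_measure ?inE //; exact: measurableI.
  + move=> x /= nPx; have [Dx|nDx] := pselect (D x).
      by split => //; apply: PN => /= Px; apply: nPx.
    by exfalso; apply: nPx => /nDx.
Qed.

Lemma restr_ae f : {ae m', forall x, (f \_ D) x = f x}.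
Proof.
exists (~` D); split => //; first exact: measurableC.
by move=> x /= H Dx; apply: H; rewrite /patch mem_set.
Qed.

Lemma patch_measT f : measurable_fun setT f -> measurable_fun setT (f \_ D).
Proof.
by move=> mf; apply/(measurable_restrictT _ mD); exact: measurable_funS mf.
Qed.

Lemma L1_restr_meas f : measurable_fun setT f ->
  m.-integrable D (EFin \o f) -> L1 m' f.
Proof.
move=> mf /(L1_restr f).1 /integrableP[mp plty]; apply/integrableP; split.
  exact/measurable_EFinP.
apply: le_lt_trans plty; rewrite le_eqVlt; apply/orP; left; apply/eqP.
apply: ae_eq_integral => //.
- by apply: measurableT_comp => //; exact/measurable_EFinP.
- exact: measurableT_comp.
- by apply: filterS (restr_ae f) => x /= ->.
Qed.

Lemma Rint_restr_meas f : measurable_fun setT f ->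
  \int[m]_(x in D) f x = \int[m']_x f x.
Proof.
move=> mf; rewrite Rint_restr; apply: Rint_ae => //.
- exact: patch_measT.
- exact: restr_ae.
Qed.

Lemma L2_patchT f : L2 m' f -> L2 m' (f \_ D).
Proof.
move=> f2; apply: (L2_ae f2); first exact: patch_measT f2.1.
by apply: filterS (restr_ae f) => x ->.
Qed.

Lemma ip_patchT f g : L2 m' f -> L2 m' g -> ip m' (f \_ D) (g \_ D) = ip m' f g.
Proof.
move=> f2 g2; have fp := L2_patchT f2; have gp := L2_patchT g2.
rewrite (ip_ael fp f2 gp (restr_ae f)) ipC.
by rewrite (ip_ael gp g2 f2 (restr_ae g)) ipC.
Qed.

End Restriction.

(** * Functions on the slab *)

Section Slab.
Context (R : realType) (l : R).
Local Notation leb := (@lebesgue_measure R).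
Local Notation RT := (measurableTypeR R).

Lemma slab_meas : measurable (slab l : set RT).
Proof. exact: measurable_itv. Qed.

Lemma leb_slab : 0 < l -> leb (slab l) = (l + l)%:E.
Proof.
move=> l0; rewrite /slab lebesgue_measure_itv /= lte_fin ifT ?opprK //.
by rewrite -subr_gt0 opprK addr_gt0.
Qed.

Lemma slab_fin : (leb (slab l) < +oo)%E.
Proof.
rewrite /slab lebesgue_measure_itv /=.
by case: ifP => _; rewrite ?ltry.
Qed.

(** A measure on the whole line: primitives start at -l of themselves, and the results on finite
    measures apply. *)
Definition slabm : {finite_measure set RT -> \bar R} := mfrestr slab_meas slab_fin.

#[global] Instance ae_slabm_filter : Filter (almost_everywhere slabm).
Proof. exact: ae_filter_ringOfSetsType. Qed.

Lemma slabmE (A : set RT) : slabm A = leb (A `&` slab l).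
Proof. by []. Qed.

Lemma slabm_eq (A : set RT) : measurable A -> A `<=` slab l -> leb A = slabm A.
Proof. by move=> mA Al; rewrite slabmE setIidl. Qed.

Lemma slabm_compl : slabm (~` slab l) = 0%E.
Proof. by rewrite slabmE setICl measure0. Qed.

Lemma slabm_noatom (x : RT) : slabm [set x] = 0%E.
Proof.
rewrite slabmE; apply/eqP; rewrite -measure_le0 -(lebesgue_measure_set1 x).
rewrite le_measure ?inE //; [apply: measurableI => //; exact: slab_meas].
Qed.

Lemma slabm_vol : 0 < l -> vol slabm = l + l.
Proof. by move=> l0; rewrite /vol slabmE setTI leb_slab. Qed.

Lemma prim_slab (p : R -> R) x : -l <= x <= l ->
  prim slabm (p \_ (slab l)) x = \int[leb]_(y in `]- l, x[) p y.
Proof.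
move=> /andP[lx xl].
have -> : [set` `]- l, x[] = slab l `&` [set y | y < x].
  apply/seteqP; split => y /=; rewrite /slab /= !in_itv /=.
    by move=> /andP[-> yx]; rewrite (lt_le_trans yx xl).
  by move=> [/andP[-> _] ->].
rewrite Rintegral_mkcondr (@Rint_restr _ _ _ leb slabm (slab l) slabm_eq).
apply: eq_Rintegral => y _; rewrite /step /patch.
case: ifP => _; last by rewrite mulr0.
have [yx|xy] := ltP y x; first by rewrite mem_set // mul1r.
by rewrite memNset ?mul0r //= => /(le_lt_trans xy); rewrite ltxx.
Qed.

End Slab.

Section SlabProduct.
Context (R : realType) (l : R) (V : set R).
Variable mu : probability (measurableTypeR R) R.
Local Notation leb := (@lebesgue_measure R).
Local Notation RT := (measurableTypeR R).
Hypothesis mV : measurable (V : set RT).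
Hypothesis muV : mu V = 1%E.

Lemma mu_compl : mu (~` V) = 0%E.
Proof. by rewrite probability_setC // muV subee. Qed.

Let mSV : measurable (slab l `*` V : set (RT * RT)).
Proof. by apply: measurableX => //; exact: slab_meas. Qed.

Lemma slabprod_meas : measurable (slab l `*` V : set (RT * RT)).
Proof. exact: mSV. Qed.

(** Restricted to the strip over the slab, the product measure agrees with [slabm l \x mu] on
    rectangles, and these determine it. *)
Lemma slabprod_eq A : measurable A -> A `<=` slab l `*` V ->
  (leb \x mu)%E A = (slabm l \x mu)%E A.
Proof.
move=> mA AS; pose mST : measurable (slab l `*` setT : set (RT * RT)) :=
  measurableX (slab_meas l) measurableT.
rewrite (@product_measure_unique _ _ _ _ _ (slabm l) mu (mrestr (leb \x mu)%E mST)) //.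
  by rewrite /= /mrestr setIidl // => z /AS[].
move=> B C mB mC; rewrite /= /mrestr -setXI setIT product_measure1E //.
by apply: measurableI => //; exact: slab_meas.
Qed.

Lemma slabprod_compl : (slabm l \x mu)%E (~` (slab l `*` V)) = 0%E.
Proof.
have -> : ~` (slab l `*` V) = (~` slab l `*` setT) `|` (setT `*` ~` V) :> set (RT * RT).
  apply/seteqP; split => [[x v]|[x v]] /=.
    move=> H; have [sx|nsx] := pselect (slab l x); last by left.
    by right; split => // Vv; apply: H.
  by case=> -[H1 H2] [].
have mS : measurable (~` slab l : set RT) by apply: measurableC; exact: slab_meas.
have mVc : measurable (~` V : set RT) by exact: measurableC.
have A1 : (slabm l \x mu)%E (~` slab l `*` setT) = 0%E.
  by rewrite product_measure1E // [X in (X * _)%E]slabm_compl mul0e.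
have A2 : (slabm l \x mu)%E (setT `*` ~` V) = 0%E.
  by rewrite product_measure1E // [X in (_ * X)%E]mu_compl mule0.
apply/eqP; rewrite -measure_le0; apply: le_trans (measureU2 _ _ _) _.
- exact: measurableX.
- exact: measurableX.
- by rewrite [X in (X + _)%E]A1 [X in (_ + X)%E]A2 adde0.
Qed.

End SlabProduct.

(** * Density of compactly supported functions *)

Section Density.
Context (R : realType) (l : R).
Hypothesis l0 : 0 < l.
Local Notation leb := (@lebesgue_measure R).
Local Notation RT := (measurableTypeR R).
Local Notation nu := (slabm l).

Definition Cc (q : R -> R) := continuous q /\
  exists2 r, r < l & forall x, r < `|x| -> q x = 0.

Lemma cont_meas (q : R -> R) : continuous q -> measurable_fun setT (q : RT -> R).
Proof. exact: continuous_measurable_fun. Qed.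

Lemma Cc_integrable q : Cc q -> leb.-integrable setT (EFin \o q).
Proof.
move=> [cq [r rl q0]].
have E : EFin \o q = (EFin \o q) \_ `[- l, l].
  apply/funext => x; rewrite /patch /=; case: ifPn => // /negP xl.
  rewrite q0 // ltNge; apply/negP => xr; apply: xl; rewrite mem_set //= in_itv /=.
  by rewrite -ler_norml (le_trans xr) // ltW.
rewrite E -integrable_mkcond //.
apply: continuous_compact_integrable; first exact: segment_compact.
exact: continuous_subspaceT.
Qed.

Lemma Rint_eq0 d (T : measurableType d) (m : {measure set T -> \bar R}) (D : set T)
  (h : T -> R) : (forall x, D x -> h x = 0) -> \int[m]_(x in D) h x = 0.
Proof.
move=> h0; rewrite Rintegral_mkcond.
transitivity (\int[m]_x (cst 0 : T -> R) x); last by rewrite Rintegral_cst // mul0r.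
apply: eq_Rintegral => x _; rewrite /patch; case: ifP => // /set_mem.
exact: h0.
Qed.

(** The primitive from -oo vanishes to the left of the support of q; to its right it equals the
    total integral, which is 0. *)
Lemma Cc_primitive q : Cc q -> \int[leb]_(x in slab l) q x = 0 ->
  exists2 phi, C1c l phi & derive1 phi = q.
Proof.
move=> Cq q_int; have [cq [r rl q0]] := Cq; have iq := Cc_integrable Cq.
pose phi x := \int[leb]_(t in `]-oo, x]) q t.
have D x : derivable phi x 1 /\ derive1 phi x = q x.
  apply: (@continuous_FTC1 _ q -oo%O x (x + 1)) => //; first by rewrite ltrDl.
    exact: integrableS iq.
  by rewrite ltNyr.
  exact: cq.
have dE : derive1 phi = q by apply/funext => x; case: (D x).
exists phi => //; split.
- by move=> x; case: (D x).
- by rewrite dE.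
- exists r => // x; have [x0|x0] := leP 0 x.
    rewrite ger0_norm // => rx; rewrite -[RHS]q_int /phi.
    rewrite Rintegral_mkcond [RHS]Rintegral_mkcond.
    apply: eq_Rintegral => t _; rewrite /patch.
    have [tr|rt] := leP `|t| r; last first.
      by rewrite q0 //; do 2 case: ifP => _.
    rewrite !mem_set //= /slab /= in_itv /=.
      by rewrite -ltr_norml (le_lt_trans tr).
    by rewrite (le_trans (ler_norm t)) // (le_trans tr) // ltW.
  rewrite ltr0_norm // => rx; apply: Rint_eq0 => t /=; rewrite in_itv /= => tx.
  by apply: q0; rewrite (lt_le_trans rx) // ltr0_norm ?lerN2 // (le_lt_trans tx).
Qed.

Lemma C1c_prim phi : C1c l phi -> forall x, -l <= x <= l ->
  \int[leb]_(y in `]- l, x[) derive1 phi y = phi x.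
Proof.
move=> [dphi cphi [r rl phi0]] x /andP[lx xl].
have pl : phi (- l) = 0 by rewrite phi0 // normrN gtr0_norm.
move: lx; rewrite le_eqVlt => /predU1P[<-|lx].
  by rewrite set_itvoo0 ?Rintegral_set0 ?pl.
have cp : continuous phi.
  by move=> y; apply: differentiable_continuous; apply/derivable1_diffP; exact: dphi.
have ic : leb.-integrable `[- l, x] (EFin \o derive1 phi).
  apply: continuous_compact_integrable; first exact: segment_compact.
  exact: continuous_subspaceT.
have sub1 : `]- l, x[ `<=` `[- l, x] by apply: subset_itv_oo_cc.
have i1 : leb.-integrable `]- l, x[ (EFin \o derive1 phi).
  by apply: integrableS ic.
rewrite Rintegral_itv_bndo_bndc // Rintegral_itv_obnd_cbnd; last first.
  by apply: integrableS ic => //; exact: subset_itv_oc_cc.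
have FT : (\int[leb]_(y in [set` `[- l, x]%R]) (derive1 phi y)%:E =
    (phi x)%:E - (phi (- l))%:E)%E.
  apply: (continuous_FTC2 lx).
  - exact: continuous_subspaceT.
  - split.
    + by move=> y _; exact: dphi.
    + by apply: cvg_at_right_filter; exact: cp.
    + by apply: cvg_at_left_filter; exact: cp.
  - by [].
by rewrite /Rintegral FT pl /= subr0.
Qed.

Lemma C1c_cont phi : C1c l phi -> continuous phi.
Proof.
move=> [dphi _ _] y; apply: differentiable_continuous.
by apply/derivable1_diffP; exact: dphi.
Qed.

Lemma C1c_Cc phi : C1c l phi -> Cc (derive1 phi) /\ Cc phi.
Proof.
move=> C; have [dphi cphi [r rl phi0]] := C; split; last first.
  by split; [exact: C1c_cont|exists r].
split => //; exists r => // x rx; rewrite derive1E.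
rewrite (@near_eq_derive _ _ _ phi (cst 0)) ?derive_cst //.
have rx0 : 0 < `|x| - r by rewrite subr_gt0.
apply: filterS (nbhsx_ballx x _ rx0) => y; rewrite -ball_normE /ball_ /= => xy.
by rewrite phi0 //; have := lerB_dist x y; lra.
Qed.

(** For k > 0, equal to 1 when |x| <= l - 2 / k and to 0 when |x| >= l - 1 / k. *)
Definition cutoff (k : nat) (x : R) : R :=
  Num.min 1 (Num.max 0 (k%:R * (l - `|x|) - 1)).

Lemma cutoff_cont k : continuous (cutoff k).
Proof.
move=> x; rewrite /cutoff.
apply: (@continuous_min _ _ (cst 1) (fun x => Num.max 0 (k%:R * (l - `|x|) - 1))).
  exact: cst_continuous.
apply: (@continuous_max _ _ (cst 0) (fun x => (k%:R * (l - `|x|) - 1))).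
  exact: cst_continuous.
apply: cvgB; last exact: cvg_cst.
apply: cvgM; first exact: cvg_cst.
by apply: cvgB; [exact: cvg_cst|apply: cvg_norm; exact: cvg_id].
Qed.

Lemma cutoff_itv k x : 0 <= cutoff k x <= 1.
Proof.
by rewrite /cutoff le_min ler01 le_max lexx /= ge_min lexx.
Qed.

Lemma cutoff_Cc k G : continuous G -> Cc (fun x => cutoff k.+1 x * G x).
Proof.
move=> cG; split.
  by move=> x; apply: cvgM; [exact: cutoff_cont|exact: cG].
exists (l - (k.+1%:R)^-1); first by rewrite ltrBlDr ltrDl invr_gt0 ltr0n.
move=> x xl; rewrite /cutoff (_ : Num.max _ _ = 0) ?mul0r //.
  by rewrite (_ : Num.min _ _ = 0) ?mul0r //; apply/min_idPr.
apply/max_idPl; rewrite subr_le0 mulrC -ler_pdivlMr ?ltr0n // div1r; by rewrite lerBlDr -lerBlDl ltW.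
Qed.

Lemma cutoff_cvg x : slab l x -> cutoff k.+1 x @[k --> \oo] --> (1 : R).
Proof.
move=> xl; apply: cvg_near_cst.
have lx : 0 < l - `|x|.
  by move: xl; rewrite /slab /= in_itv /= -ltr_norml subr_gt0.
near=> k; rewrite /cutoff; apply/min_idPl; rewrite le_max; apply/orP; right.
have : 2 / (l - `|x|) <= k%:R by near: k; exact: nbhs_infty_ger.
rewrite ler_pdivrMr // => H.
have : k%:R * (l - `|x|) <= k.+1%:R * (l - `|x|) by rewrite ler_wpM2r ?ler_nat // ltW.
lra.
Unshelve. all: by end_near. Qed.

End Density.

Lemma clamp_dist (R : realDomainType) (M h g : R) : `|h| <= M ->
  `|h - Num.max (- M) (Num.min M g)| <= `|h - g|.
Proof.
rewrite ler_norml => /andP[h1 h2].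
have [g1|g1] := leP M g.
  have -> : Num.max (- M) M = M by apply/max_idPr; lra.
  by rewrite !ler0_norm; lra.
have [g2|g2] := leP (- M) g => //.
by rewrite !ger0_norm; lra.
Qed.

Lemma clamp_abs (R : realDomainType) (M g : R) : 0 <= M ->
  `|Num.max (- M) (Num.min M g)| <= M.
Proof.
move=> M0; rewrite ler_norml le_max lexx /= ge_max ge_min lexx /= andbT.
by lra.
Qed.

Section Density2.
Context (R : realType) (l : R).
Hypothesis l0 : 0 < l.
Local Notation leb := (@lebesgue_measure R).
Local Notation RT := (measurableTypeR R).
Local Notation nu := (slabm l).

Lemma slab_rest_ae (h : RT -> R) : {ae nu, forall x, (h \_ (slab l)) x = h x}.
Proof. exact: (restr_ae (@slab_meas R l) (@slabm_compl R l)). Qed.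

Lemma patch_meas (h : RT -> R) : measurable_fun setT h ->
  measurable_fun setT (h \_ (slab l)).
Proof.
by move=> mh; apply/(measurable_restrictT _ (@slab_meas R l)); exact: measurable_funS mh.
Qed.

Lemma L1_slab (h : RT -> R) : measurable_fun setT h ->
  leb.-integrable (slab l) (EFin \o h) -> L1 nu h.
Proof. exact: (L1_restr_meas (@slab_meas R l) (@slabm_eq R l) (@slabm_compl R l)). Qed.

Lemma Rint_slab (h : RT -> R) : measurable_fun setT h ->
  \int[leb]_(x in slab l) h x = \int[nu]_x h x.
Proof. exact: (Rint_restr_meas (@slab_meas R l) (@slabm_eq R l) (@slabm_compl R l)). Qed.

Lemma Cc_L2 q : Cc l q -> L2 nu q.
Proof.
move=> Cq; have [cq [r rl q0]] := Cq; have mq := cont_meas cq; split => //.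
have Cqq : Cc l (q \* q).
  split; first by move=> x; apply: cvgM; exact: cq.
  by exists r => // x /q0 /= ->; rewrite mul0r.
apply: L1_slab; first exact: measurable_funM.
by apply: integrableS (Cc_integrable Cqq) => //; exact: slab_meas.
Qed.

Lemma cutoff_L2_cvg (G : RT -> R) : measurable_fun setT G -> L2 nu G ->
  ip nu (fun x => cutoff l k.+1 x * G x - G x)
        (fun x => cutoff l k.+1 x * G x - G x) @[k --> \oo] --> (0 : R).
Proof.
move=> mG [_ G2].
have mk k : measurable_fun setT (fun x : RT => cutoff l k x * G x - G x).
  apply: measurable_funB => //; apply: measurable_funM => //.
  by apply: cont_meas; exact: cutoff_cont.
pose h k := ((fun x : RT => cutoff l k.+1 x * G x - G x) \*
             (fun x => cutoff l k.+1 x * G x - G x)) \_ (slab l).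
have mh k : measurable_fun setT (h k).
  by apply: patch_meas; apply: measurable_funM; exact: mk.
have E k : ip nu (fun x => cutoff l k.+1 x * G x - G x)
        (fun x => cutoff l k.+1 x * G x - G x) = \int[nu]_x h k x.
  apply: Rint_ae.
  - by apply: measurable_funM; exact: mk.
  - exact: mh.
  - by apply: filterS (slab_rest_ae ((fun x : RT => cutoff l k.+1 x * G x - G x) \*
      (fun x => cutoff l k.+1 x * G x - G x))) => x <-.
under eq_fun do rewrite E.
have -> : (0 : R) = \int[nu]_v (cst 0) v by rewrite Rintegral_cst // mul0r.
apply: (@Rint_dct _ _ _ nu h _ (G \* G)) => //.
- move=> x; have [xl|nxl] := boolP (x \in slab l); last first.
    have -> : (fun n => h n x) = (fun=> 0).
      by apply/funext => n; rewrite /h /patch (negbTE nxl).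
    exact: cvg_cst.
  have -> : (fun n => h n x) = (fun k => (cutoff l k.+1 x * G x - G x) *
      (cutoff l k.+1 x * G x - G x)).
    by apply/funext => n; rewrite /h /patch xl.
  have c1 := cutoff_cvg (set_mem xl).
  have c2 : cutoff l k.+1 x * G x - G x @[k --> \oo] --> (0 : R).
    have cG : (fun _ : nat => G x) k @[k --> \oo] --> G x by exact: cvg_cst.
    have c4 := cvgB (cvgM c1 cG) cG; rewrite mul1r subrr in c4; exact: c4.
  have c3 := cvgM c2 c2; rewrite mulr0 in c3; exact: c3.
- move=> k x; rewrite /h /patch; case: ifP => _; last by rewrite normr0 /= -expr2 sqr_ge0.
  have /andP[c0 c1] := cutoff_itv l k.+1 x.
  rewrite /= ger0_norm -expr2 ?sqr_ge0 //.
  rewrite (_ : _ - G x = (cutoff l k.+1 x - 1) * G x); last by ring.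
  rewrite exprMn -expr2 ler_piMl ?sqr_ge0 //.
  by move: (cutoff l k.+1 x) c0 c1 => t t0 t1; nra.
Qed.

(** Continuous functions approximate h in L^1. Once they are clamped to [-M, M], the error is at
    most 2 M, which turns the L^1 estimate into an L^2 one; [cutoff] then makes the support
    compact. *)
Lemma approx_bounded (h : RT -> R) M e : 0 < M -> measurable_fun setT h ->
  (forall x, `|h x| <= M) -> 0 < e ->
  exists2 q, Cc l q & ip nu (h \- q) (h \- q) <= e.
Proof.
move=> M0 mh hM e0; have h2 := L2_bounded (fin1 nu) mh hM.
have h1 := L2_L1 (fin1 nu) h2.
have ih : leb.-integrable (slab l) (EFin \o h).
  apply/(L1_restr (@slab_meas R l) (@slabm_eq R l)).
  have hn : L1 nu (fun x => `|h x|) := integrable_norm h1.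
  apply: (L1_le _ hn) => [|x]; first exact: patch_meas.
  by rewrite /patch; case: ifP => _; rewrite ?normr0.
have [g [cg ig gcv]] := approximation_continuous_integrable (@slab_meas R l) (slab_fin l) ih.
(* Then 2 M e1 = e / 4. The cut-off costs another e / 4, and [ipB_le] doubles the sum to e. *)
pose e1 := e / (8 * M).
have e10 : 0 < e1 by rewrite divr_gt0 // mulr_gt0.
have gcv' : \int[leb]_(z in slab l) `|h z - g n z| @[n --> \oo] --> (0 : R).
  exact: (fine_cvg gcv).
have [n _ /(_ n (leqnn n)) gn] := cvgr_le _ gcv' _ e10.
have mg := cont_meas (cg n).
have M0' := ltW M0.
pose G (x : RT) : R := Num.max (- M) (Num.min M (g n x)).
have cG : continuous (G : R -> R).
  move=> x; apply: (@continuous_max _ _ (cst (- M)) (fun x => Num.min M (g n x))).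
    exact: cst_continuous.
  apply: (@continuous_min _ _ (cst M) (g n)); first exact: cst_continuous.
  exact: cg.
have mG : measurable_fun setT G by exact: cont_meas.
have G2 : L2 nu G by apply: (L2_bounded (fin1 nu) mG) => x; exact: clamp_abs.
have hG : ip nu (h \- G) (h \- G) <= 2 * M * e1.
  have mhg : measurable_fun setT (fun x : RT => `|h x - g n x|).
    by apply: measurableT_comp => //; exact: measurable_funB.
  have ihg : L1 nu (fun x => `|h x - g n x|).
    apply: L1_slab => //.
    exact: (integrable_norm (integrableB (@slab_meas R l) ih (ig n))).
  apply: (@le_trans _ _ (\int[nu]_x ((2 * M) \*o (fun x => `|h x - g n x|)) x)).
    apply: le_Rintegral => //.
    - exact: (L2M (L2B h2 G2) (L2B h2 G2)).
    - exact: L1Z.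
    move=> x _ /=.
    have c1 := clamp_dist (g n x) (hM x); rewrite -/(G x) in c1.
    have c2 : `|h x - G x| <= 2 * M.
      apply: le_trans (ler_normB _ _) _; have := hM x; have := clamp_abs (g n x) M0'.
      by rewrite -/(G x); lra.
    rewrite -expr2 -real_normK ?num_real // expr2.
    by apply: ler_pM.
  rewrite RintZ // ler_wpM2l //; first by rewrite mulr_ge0.
  by rewrite -Rint_slab.
have G1 := cutoff_L2_cvg mG G2.
have e4 : 0 < e / 4 by rewrite divr_gt0.
have [k _ /(_ k (leqnn k)) Gk] := cvgr_le _ G1 _ e4.
have Cq := cutoff_Cc l k cG.
exists (fun x => cutoff l k.+1 x * G x) => //.
have q2 := Cc_L2 Cq.
have -> : h \- (fun x => cutoff l k.+1 x * G x) =
  (h \- G) \- ((fun x => cutoff l k.+1 x * G x) \- G).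
  by apply/funext => x /=; ring.
apply: le_trans (ipB_le (L2B h2 G2) (L2B q2 G2)) _.
have E1 : 2 * M * e1 = e / 4 by rewrite /e1; field; rewrite gt_eqF.
rewrite E1 in hG.
by move: (ip nu _ _) hG => t hG; move: Gk; rewrite /ip /=; move: (Rintegral _ _ _) => u; lra.
Qed.

Definition truncate (M : R) (h : RT -> R) (x : RT) : R := if `|h x| <= M then h x else 0.

Lemma truncate_meas M h : measurable_fun setT h -> measurable_fun setT (truncate M h).
Proof.
move=> mh; apply: measurable_fun_ifT => //; apply: measurable_fun_ler => //.
exact: measurableT_comp.
Qed.

Lemma truncate_cvg h : L2 nu h ->
  ip nu (h \- truncate n.+1%:R h) (h \- truncate n.+1%:R h) @[n --> \oo] --> (0 : R).
Proof.
move=> [mh h2].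
have -> : (0 : R) = \int[nu]_v (cst 0) v by rewrite Rintegral_cst // mul0r.
apply: (@Rint_dct _ _ _ nu _ _ (h \* h)) => //.
- by move=> n; apply: measurable_funM; apply: measurable_funB => //; exact: truncate_meas.
- move=> v; apply: cvg_near_cst; near=> n => /=.
  rewrite /truncate ifT ?subrr ?mul0r //.
  have : `|h v| <= n%:R by near: n; exact: nbhs_infty_ger.
  by move=> /le_trans; apply; rewrite ler_nat.
- move=> n v /=; rewrite /truncate; case: ifP => _; rewrite ?subrr ?subr0 ?mul0r ?normr0.
    by rewrite -expr2 sqr_ge0.
  by rewrite ger0_norm // -expr2 sqr_ge0.
Unshelve. all: by end_near. Qed.

Lemma Cc_dense h e : L2 nu h -> 0 < e ->
  exists2 q, Cc l q & ip nu (h \- q) (h \- q) <= e.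
Proof.
move=> h2 e0; have e4 : 0 < e / 4 by rewrite divr_gt0.
have [n _ /(_ n (leqnn n)) hn] := cvgr_le _ (truncate_cvg h2) _ e4.
have mh := h2.1; have mt := truncate_meas n.+1%:R mh.
have tM x : `|truncate n.+1%:R h x| <= n.+1%:R.
  by rewrite /truncate; case: ifP => // _; rewrite normr0.
have n0 : 0 < n.+1%:R :> R by rewrite ltr0n.
have [q Cq hq] := approx_bounded n0 mt tM e4.
exists q => //; have q2 := Cc_L2 Cq.
have t2 := L2_bounded (fin1 nu) mt tM.
have -> : h \- q = (h \- truncate n.+1%:R h) \+ (truncate n.+1%:R h \- q).
  by apply/funext => x /=; ring.
apply: le_trans (ipD_le (L2B h2 t2) (L2B t2 q2)) _.
by move: (ip nu _ _) (ip nu _ _) hn hq => x y; lra.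
Qed.

(** Derivatives of C^1_c functions have integral 0, so the approximation q of [psi] is corrected by
    a multiple of a fixed [th] with positive integral. As [psi] is mean free, the correction is of
    the order of the error. *)
Lemma C1c_dense psi e : L2 nu psi -> \int[nu]_x psi x = 0 -> 0 < e ->
  exists2 phi, C1c l phi & ip nu (psi \- derive1 phi) (psi \- derive1 phi) <= e.
Proof.
move=> p2 p0 e0; have vol0 : 0 < vol nu by rewrite slabm_vol // addr_gt0.
(* If th is within vol / 4 of 1 in squared norm, then (vol - int th)^2 <= vol^2 / 4, whence int th >
   0. *)
have [th Cth th0] : exists2 th, Cc l th & 0 < \int[nu]_x th x.
  have [th Cth H] := Cc_dense (L2_cst (fin1 nu) 1) (divr_gt0 vol0 (ltr0n R 4)).
  exists th => //; have th2 := Cc_L2 Cth.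
  have c2 := L2_cst (fin1 nu) 1; have := int_sqr_le (L2B c2 th2).
  rewrite RintB; [|exact: (L2_L1 (fin1 nu))|exact: (L2_L1 (fin1 nu))].
  have -> : \int[nu]_x cst 1 x = vol nu by rewrite -(ip1r nu) (ip11 nu).
  move=> /le_trans /(_ (ler_wpM2l (ltW vol0) H)).
  rewrite ltNge => H2; apply/negP => H3; move: H2; apply/negP; rewrite -ltNge.
  by move: (vol nu) vol0 (\int[nu]_x th x) H3 => v v0 t t0; nra.
set I := \int[nu]_x th x in th0.
have th2 := Cc_L2 Cth.
(* From [ipD_le]: 2 |psi - q|^2 + 2 c^2 |th|^2, where c^2 <= vol / I^2 |psi - q|^2 by [cI] below. *)
pose K := 2 + 2 * (vol nu / I ^+ 2 * ip nu th th).
have K0 : 0 < K.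
  rewrite ltr_wpDr // mulr_ge0 // mulr_ge0 ?ip_ge0 // divr_ge0 ?sqr_ge0 //.
  exact: ltW.
have [q Cq hq] := Cc_dense p2 (divr_gt0 e0 K0).
have q2 := Cc_L2 Cq.
pose c := \int[nu]_x q x / I.
pose q' := q \- c \*o th.
have cth2 : L2 nu (c \*o th) by exact: L2Z.
have toL1 := L2_L1 (fin1 nu).
have Cq' : Cc l q'.
  have [cq [r rl qr]] := Cq; have [ct [r' rl' tr]] := Cth; split.
    move=> x; apply: cvgB; first exact: cq.
    by apply: cvgM; [exact: cvg_cst|exact: ct].
  exists (Num.max r r'); first by rewrite gt_max rl.
  by move=> x; rewrite gt_max => /andP[h1 h2]; rewrite /q' /= qr // tr // mulr0 subr0.
have q'0 : \int[leb]_(x in slab l) q' x = 0.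
  rewrite Rint_slab; last by apply: cont_meas; case: Cq'.
  rewrite RintB ?RintZ; [|exact: toL1|exact: toL1|exact: toL1].
  by rewrite /c -/I divfK ?subrr // gt_eqF.
have [phi Cphi dphi] := Cc_primitive Cq' q'0.
exists phi => //; rewrite dphi.
have -> : psi \- q' = (psi \- q) \+ c \*o th by apply/funext => x; rewrite /q' /=; ring.
apply: le_trans (ipD_le (L2B p2 q2) cth2) _.
rewrite (ipZl _ th2 cth2) (ipZr _ th2 th2) mulrA -expr2.
have qI : (\int[nu]_x q x) ^+ 2 <= vol nu * ip nu (psi \- q) (psi \- q).
  have := int_sqr_le (L2B p2 q2).
  by rewrite RintB ?p0 ?sub0r ?sqrrN //; exact: toL1.
have cI : c ^+ 2 <= vol nu / I ^+ 2 * ip nu (psi \- q) (psi \- q).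
  rewrite /c exprMn exprVn [leRHS]mulrAC; apply: ler_wpM2r => //.
  by rewrite invr_ge0 sqr_ge0.
apply: (@le_trans _ _ (K * ip nu (psi \- q) (psi \- q))).
  rewrite /K [leRHS]mulrDl lerD // -[leRHS]mulrA ler_wpM2l // [leRHS]mulrAC.
  by apply: ler_wpM2r => //; exact: ip_ge0.
by rewrite mulrC -ler_pdivlMr.
Qed.

End Density2.

(** * H^1_0 functions as primitives of mean free functions *)

Section SobolevPrim.
Context (R : realType) (l : R).
Hypothesis l0 : 0 < l.
Local Notation leb := (@lebesgue_measure R).
Local Notation RT := (measurableTypeR R).
Local Notation nu := (slabm l).
Implicit Types (u du phi psi h k : RT -> R).

Let toL1 p : L2 nu p -> L1 nu p. Proof. exact: (L2_L1 (fin1 nu)). Qed.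

Lemma L2_patch h : L2 nu h -> L2 nu (h \_ (slab l)).
Proof. exact: (L2_patchT (@slab_meas R l) (@slabm_compl R l)). Qed.

Lemma ip_patch h k : L2 nu h -> L2 nu k ->
  ip nu (h \_ (slab l)) (k \_ (slab l)) = ip nu h k.
Proof. exact: (ip_patchT (@slab_meas R l) (@slabm_compl R l)). Qed.

Lemma Lon_slab h : L2 nu h -> Lon leb 2%:E (slab l) h.
Proof.
by move=> h2; apply/(L2_restr (@slab_meas R l) (@slabm_eq R l)); exact: L2_patch.
Qed.

Lemma norm_slab_lt h e : 0 < e -> Lon leb 2%:E (slab l) h ->
  (norm_on leb 2%:E (slab l) h < e%:E)%E =
  (ip nu (h \_ (slab l)) (h \_ (slab l)) < e ^+ 2).
Proof.
move=> e0 h2; rewrite (ip_restr_norm (@slabm_eq R l) h2) lte_fin.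
by rewrite -{1}(ger0_norm (ltW e0)) -sqrtr_sqr ltr_sqrt // exprn_gt0.
Qed.

Lemma C1c_L2 phi : C1c l phi -> L2 nu phi /\ L2 nu (derive1 phi).
Proof. by move=> /C1c_Cc[/Cc_L2 ? /Cc_L2 ?]. Qed.

Lemma C1c_primE phi x : C1c l phi -> -l <= x <= l ->
  prim nu (derive1 phi) x = phi x.
Proof.
move=> C xl; have [_ d2] := C1c_L2 C; have md := d2.1.
rewrite -(C1c_prim l0 C xl) -prim_slab //; apply: eq_prim_ae => //.
- exact: patch_meas.
- by apply: filterS (slab_rest_ae l (derive1 phi)) => y ->.
Qed.

Lemma C1c_int0 phi : C1c l phi -> \int[nu]_x derive1 phi x = 0.
Proof.
move=> C; have [_ d2] := C1c_L2 C.
rewrite -Rint_slab; last exact: d2.1.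
have ll : -l <= l <= l by rewrite lexx andbT (le_trans _ (ltW l0)) // oppr_le0 ltW.
rewrite (C1c_prim l0 C ll).
by have [_ _ [r rl H]] := C; rewrite H // gtr0_norm.
Qed.

Lemma C1c_prim_ae phi : C1c l phi -> {ae nu, forall x, prim nu (derive1 phi) x = phi x}.
Proof.
move=> C; have H : {ae leb, forall x, slab l x -> prim nu (derive1 phi) x = phi x}.
  apply: aeW => x; rewrite /slab /= in_itv /= => /andP[h1 h2].
  by rewrite C1c_primE // !ltW.
exact: ((ae_restr (@slab_meas R l) (@slabm_eq R l) (@slabm_compl R l) _).1 H).
Qed.

Lemma small_sqr_eq0 (x C : R) : 0 <= x ->
  (forall e, 0 < e -> x <= C * e ^+ 2) -> x = 0.
Proof.
move=> x0 H; apply/eqP; rewrite eq_le x0 andbT leNgt; apply/negP => xp.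
have C1 : 0 < `|C| + 1 by rewrite ltr_wpDl.
(* Chosen so that (|C| + 1) e^2 = x / 2. *)
pose e := Num.sqrt (x / (2 * (`|C| + 1))).
have q0 : 0 < x / (2 * (`|C| + 1)) by rewrite divr_gt0 // mulr_gt0.
have e0 : 0 < e by rewrite sqrtr_gt0.
have := H _ e0; rewrite sqr_sqrtr ?(ltW q0) //.
have : C * (x / (2 * (`|C| + 1))) <= (`|C| + 1) * (x / (2 * (`|C| + 1))).
  by apply: ler_wpM2r; [exact: ltW|rewrite (le_trans (ler_norm C)) // lerDl].
have -> : (`|C| + 1) * (x / (2 * (`|C| + 1))) = x / 2 by field; rewrite gt_eqF.
by move=> h1 h2; have := le_trans h2 h1; lra.
Qed.

(** For C^1_c functions this is the fundamental theorem of calculus. Integral and primitive are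
    continuous in L^2, so both facts pass to the closure. *)
Lemma H10_prim u du : H10 l u du -> let p := du \_ (slab l) in
  [/\ L2 nu p, \int[nu]_x p x = 0, L2 nu (u \_ (slab l)) &
      {ae nu, forall x, (u \_ (slab l)) x = prim nu p x}].
Proof.
move=> [[Lu Ldu _] appr] p.
have u2 : L2 nu (u \_ (slab l)) by apply/(L2_restr (@slab_meas R l) (@slabm_eq R l)).
have p2 : L2 nu p by apply/(L2_restr (@slab_meas R l) (@slabm_eq R l)).
have pp2 := L2_prim p2.
have H e : 0 < e -> exists2 phi, C1c l phi &
    ip nu ((u \_ (slab l)) \- phi) ((u \_ (slab l)) \- phi) <= e ^+ 2 /\
    ip nu (p \- derive1 phi) (p \- derive1 phi) <= e ^+ 2.
  move=> e0; have [phi C [n1 n2]] := appr e e0; exists phi => //.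
  have [f2 d2] := C1c_L2 C.
  have fp := L2_patch f2; have dp := L2_patch d2.
  have k1 : ip nu ((u \_ (slab l)) \- phi) ((u \_ (slab l)) \- phi) =
            ip nu ((u \- phi) \_ (slab l)) ((u \- phi) \_ (slab l)).
    have := ip_patch (L2B u2 f2) (L2B u2 f2).
    by rewrite -!restr_sub restrK => ->.
  have k2 : ip nu (p \- derive1 phi) (p \- derive1 phi) =
            ip nu ((du \- derive1 phi) \_ (slab l)) ((du \- derive1 phi) \_ (slab l)).
    have := ip_patch (L2B p2 d2) (L2B p2 d2).
    by rewrite -!restr_sub restrK => ->.
  have L1' : Lon leb 2%:E (slab l) (u \- phi).
    apply/(L2_restr (@slab_meas R l) (@slabm_eq R l)).
    by rewrite -restr_sub; exact: L2B.
  have L2' : Lon leb 2%:E (slab l) (du \- derive1 phi).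
    apply/(L2_restr (@slab_meas R l) (@slabm_eq R l)).
    by rewrite -restr_sub; exact: L2B.
  by rewrite k1 k2; split; apply: ltW; rewrite -norm_slab_lt.
split => //.
- apply/eqP; rewrite -sqrf_eq0; apply/eqP.
  apply: (@small_sqr_eq0 _ (vol nu)); first exact: sqr_ge0.
  move=> e /H[phi C [_ h]]; have [f2 d2] := C1c_L2 C.
  have := int_sqr_le (L2B p2 d2); rewrite RintB ?C1c_int0 ?subr0 //; try exact: toL1.
  move=> /le_trans; apply; apply: ler_wpM2l => //; exact: vol_ge0.
- have z : ip nu ((u \_ (slab l)) \- prim nu p) ((u \_ (slab l)) \- prim nu p) = 0.
    apply: (@small_sqr_eq0 _ (2 + 2 * vol nu ^+ 2)); first exact: ip_ge0.
    move=> e /H[phi C [h1 h2]]; have [f2 d2] := C1c_L2 C.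
    have pd2 := L2_prim d2; have pdp2 := L2B pp2 pd2.
    have E : ip nu ((u \_ (slab l)) \- prim nu p) ((u \_ (slab l)) \- prim nu p) =
       ip nu (((u \_ (slab l)) \- phi) \- (prim nu p \- prim nu (derive1 phi)))
             (((u \_ (slab l)) \- phi) \- (prim nu p \- prim nu (derive1 phi))).
      have a1 := L2B u2 pp2; have a2 := L2B (L2B u2 f2) pdp2.
      have ae : {ae nu, forall x, ((u \_ (slab l)) \- prim nu p) x =
          (((u \_ (slab l)) \- phi) \- (prim nu p \- prim nu (derive1 phi))) x}.
        by apply: filterS (C1c_prim_ae C) => x /= ->; ring.
      by rewrite (ip_ael a1 a2 a1 ae) ipC (ip_ael a1 a2 a2 ae).
    rewrite E; apply: le_trans (ipB_le (L2B u2 f2) pdp2) _.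
    have -> : prim nu p \- prim nu (derive1 phi) = prim nu (p \- derive1 phi).
      by apply/funext => x /=; rewrite primB //; exact: toL1.
    rewrite [leRHS]mulrDl lerD ?ler_wpM2l // -[leRHS]mulrA ler_wpM2l //.
    apply: le_trans (ip_prim_le (L2B p2 d2)) _.
    by rewrite ler_wpM2l ?sqr_ge0.
  by apply: filterS (ip_eq0 (L2B u2 pp2) z) => x /= /eqP; rewrite subr_eq0 => /eqP.
Qed.

(** Converse of [H10_prim]. Derivatives of C^1_c functions that approximate [psi] have primitives
    that approximate its primitive, by [ip_prim_le]. *)
Lemma prim_H10 psi : L2 nu psi -> \int[nu]_x psi x = 0 -> H10 l (prim nu psi) psi.
Proof.
move=> p2 p0; have pp2 := L2_prim p2; split.
  split; [exact: Lon_slab|exact: Lon_slab|].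
  move=> phi C; have [f2 d2] := C1c_L2 C; have pd2 := L2_prim d2.
  rewrite !(ip_restr (@slabm_eq R l)) !ip_patch //.
  rewrite prim_ibp //; last exact: (@slabm_noatom R l).
  rewrite p0 mul0r sub0r ipC (ip_ael pd2 f2 p2 (C1c_prim_ae C)).
  by rewrite ipC.
(* vol^2 serves for the primitives and 1 for the derivatives; the factor 2 makes the inequalities
   strict. *)
move=> e e0; pose K := 2 * (1 + vol nu ^+ 2).
have K0 : 0 < K by rewrite mulr_gt0 // ltr_pwDl // sqr_ge0.
have e2 : 0 < e ^+ 2 by rewrite exprn_gt0.
have [phi C h] := C1c_dense l0 p2 p0 (divr_gt0 e2 K0).
have [f2 d2] := C1c_L2 C; have pd2 := L2_prim d2.
have hK : (1 + vol nu ^+ 2) * ip nu (psi \- derive1 phi) (psi \- derive1 phi) < e ^+ 2.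
  apply: (@le_lt_trans _ _ ((1 + vol nu ^+ 2) * (e ^+ 2 / K))).
    by apply: ler_wpM2l => //; rewrite addr_ge0 // sqr_ge0.
  have -> : (1 + vol nu ^+ 2) * (e ^+ 2 / K) = e ^+ 2 / 2.
    by rewrite /K; field; rewrite gt_eqF // ltr_pwDl // sqr_ge0.
  by rewrite ltr_pdivrMr // ltr_pMr // ltr1n.
have i0 := ip_ge0 nu (psi \- derive1 phi).
have v0 := sqr_ge0 (vol nu).
exists phi => //; split; rewrite norm_slab_lt //; try exact: Lon_slab (L2B _ _).
- rewrite ip_patch; [|exact: L2B|exact: L2B].
  have a1 := L2B pp2 f2; have a2 := L2B pp2 pd2.
  have ae : {ae nu, forall x, (prim nu psi \- phi) x = (prim nu psi \- prim nu (derive1 phi)) x}.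
    by apply: filterS (C1c_prim_ae C) => x /= ->.
  rewrite (ip_ael a1 a2 a1 ae) ipC (ip_ael a1 a2 a2 ae).
  have -> : prim nu psi \- prim nu (derive1 phi) = prim nu (psi \- derive1 phi).
    by apply/funext => x /=; rewrite primB //; exact: toL1.
  apply: le_lt_trans (ip_prim_le (L2B p2 d2)) _; apply: le_lt_trans hK.
  by apply: ler_wpM2r => //; rewrite lerDr.
- rewrite ip_patch; [|exact: L2B|exact: L2B].
  by apply: le_lt_trans hK; rewrite ler_peMl // lerDl.
Qed.

End SobolevPrim.

(** * An exponential weight *)

Section Weight.
Context (R : realType) (l : R).
Hypothesis l0 : 0 < l.
Local Notation leb := (@lebesgue_measure R).
Local Notation RT := (measurableTypeR R).
Local Notation nu := (slabm l).

(** The Volterra iterates are compared with the weight at every real x. Off the slab the weight is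
    therefore continued by constants, as [prim nu p] is ([prim_clamp]). *)
Definition clamp (x : R) : R := Num.max (- l) (Num.min l x).

Lemma clamp_itv x : - l <= clamp x <= l.
Proof.
rewrite /clamp le_max lexx /= ge_max ge_min lexx /= andbT.
by rewrite (le_trans _ (ltW l0)) // oppr_le0 ltW.
Qed.

Lemma clamp_id x : - l <= x <= l -> clamp x = x.
Proof. by move=> /andP[h1 h2]; rewrite /clamp min_r // max_r. Qed.

Lemma prim_clamp (p : RT -> R) x : measurable_fun setT p ->
  prim nu p x = prim nu p (clamp x).
Proof.
move=> mp; apply: Rint_ae.
- by apply: measurable_funM => //; exact: step_meas.
- by apply: measurable_funM => //; exact: step_meas.
have H : {ae leb, forall y, slab l y -> step x y * p y = step (clamp x) y * p y}.
  apply: aeW => y; rewrite /slab /= in_itv /= => /andP[h1 h2].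
  congr (_ * _); rewrite /step /clamp lt_max lt_min h2 /=.
  by rewrite (_ : (y < - l) = false) //; apply: le_gtF; exact: ltW.
exact: ((ae_restr (@slab_meas R l) (@slabm_eq R l) (@slabm_compl R l) _).1 H).
Qed.

Variable lam : R.
Hypothesis lam0 : 0 < lam.

Definition weight (x : R) : R := expR (lam * clamp x).

Lemma weight_meas : measurable_fun setT (weight : RT -> R).
Proof.
apply: (measurableT_comp (@measurable_expR R)); apply: measurable_funM => //.
by apply: measurable_maxr => //; exact: measurable_minr.
Qed.

Lemma weight_lo x : expR (lam * - l) <= weight x.
Proof. by rewrite ler_expR ler_pM2l //; case/andP: (clamp_itv x). Qed.

Lemma weight_hi x : weight x <= expR (lam * l).
Proof. by rewrite ler_expR ler_pM2l //; case/andP: (clamp_itv x). Qed.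

Lemma weight_gt0 x : 0 < weight x.
Proof. exact: expR_gt0. Qed.

Lemma weight_L2 : L2 nu weight.
Proof.
apply: (L2_bounded (fin1 nu) weight_meas (C := expR (lam * l))) => x.
by rewrite ger0_norm ?weight_hi // ltW // weight_gt0.
Qed.

Lemma expR_int x : - l < x ->
  \int[leb]_(y in `]- l, x[) expR (lam * y) = lam^-1 * (expR (lam * x) - expR (lam * - l)).
Proof.
move=> lx; pose F y := lam^-1 * expR (lam * y).
have dF (y : R) : is_derive y (1 : R) F (expR (lam * y)).
  rewrite /F; apply: is_derive_eq; rewrite /GRing.scale /=.
  by field; rewrite gt_eqF.
have cf : continuous (fun y => expR (lam * y)).
  move=> y; apply: (@continuous_comp _ _ _ (fun y => lam * y) expR).
    by apply: cvgM; [exact: cvg_cst|exact: cvg_id].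
  exact: continuous_expR.
have ic : leb.-integrable `[- l, x] (EFin \o (fun y => expR (lam * y))).
  apply: continuous_compact_integrable; first exact: segment_compact.
  exact: continuous_subspaceT.
have i1 : leb.-integrable `]- l, x[ (EFin \o (fun y => expR (lam * y))).
  by apply: integrableS ic => //; exact: subset_itv_oo_cc.
rewrite Rintegral_itv_bndo_bndc // Rintegral_itv_obnd_cbnd; last first.
  by apply: integrableS ic => //; exact: subset_itv_oc_cc.
have cF : continuous F.
  move=> y; apply: differentiable_continuous; apply/derivable1_diffP.
  by case: (dF y).
rewrite /Rintegral (@continuous_FTC2 _ _ F) //.
- by rewrite /= /F; ring.
- exact: continuous_subspaceT.
- split.
  + by move=> y _; case: (dF y).
  + by apply: cvg_at_right_filter; exact: cF.
  + by apply: cvg_at_left_filter; exact: cF.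
- by move=> y _; rewrite derive1E; case: (dF y).
Qed.

Lemma prim_weight x : prim nu weight x <= lam^-1 * weight x.
Proof.
rewrite (prim_clamp x weight_meas).
have E : weight x = expR (lam * clamp x) by [].
rewrite E; have := clamp_itv x; move: (clamp x) => y {E x} yl.
have -> : prim nu weight y = prim nu ((fun y => expR (lam * y)) \_ (slab l)) y.
  apply: eq_prim_ae; first exact: weight_meas.
    apply: patch_meas; apply: (measurableT_comp (@measurable_expR R)).
    exact: measurable_funM.
  have H : {ae leb, forall z, slab l z -> weight z = ((fun y => expR (lam * y)) \_ (slab l)) z}.
    apply: aeW => z zl; rewrite /patch mem_set // /weight clamp_id //.
    by move: zl; rewrite /slab /= in_itv /= => /andP[? ?]; rewrite !ltW.
  exact: ((ae_restr (@slab_meas R l) (@slabm_eq R l) (@slabm_compl R l) _).1 H).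
rewrite prim_slab //; have /andP[+ _] := yl; rewrite le_eqVlt => /predU1P[<-|ly].
  by rewrite set_itvoo0 ?Rintegral_set0 // mulr_ge0 ?invr_ge0 ?ltW // expR_gt0.
rewrite expR_int //; apply: ler_wpM2l; first by rewrite invr_ge0 ltW.
by rewrite lerBlDr lerDl ltW // expR_gt0.
Qed.

End Weight.

(** * The diffusion problem *)

Section Volterra.
Context (R : realType) (l : R).
Hypothesis l0 : 0 < l.
Local Notation leb := (@lebesgue_measure R).
Local Notation RT := (measurableTypeR R).
Local Notation nu := (slabm l).
Variables (D a b : R) (s : RT -> R).
Hypotheses (D0 : 0 < D) (a0 : 0 < a).
Hypothesis ms : measurable_fun setT s.
Hypothesis sab : forall x, a <= s x <= b.

Let s_ge0 x : 0 <= s x.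
Proof. by have /andP[h _] := sab x; rewrite (le_trans _ h) // ltW. Qed.

Let s_abs x : `|s x| <= b.
Proof. by rewrite ger0_norm //; case/andP: (sab x). Qed.

Let b_gt0 : 0 < b.
Proof. by have /andP[h1 h2] := sab 0; rewrite (lt_le_trans a0) // (le_trans h1). Qed.

Let sL2 p : L2 nu p -> L2 nu (s \* p). Proof. exact: (L2_mull ms s_abs). Qed.
Let toL1 p : L2 nu p -> L1 nu p. Proof. exact: (L2_L1 (fin1 nu)). Qed.

Definition volt (u : RT -> R) : RT -> R :=
  D^-1 \*o prim nu (s \* prim nu u).

Lemma volt_L2 u : L2 nu u -> L2 nu (volt u).
Proof. by move=> u2; apply: L2Z; apply: L2_prim; apply: sL2; exact: L2_prim. Qed.

Lemma voltB u v x : L2 nu u -> L2 nu v -> volt (u \- v) x = volt u x - volt v x.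
Proof.
move=> u2 v2; have pu2 := L2_prim u2; have pv2 := L2_prim v2.
rewrite /volt /=.
have -> : s \* prim nu (u \- v) = s \* prim nu u \- s \* prim nu v.
  by apply/funext => y /=; rewrite (primB _ (toL1 u2) (toL1 v2)); ring.
by rewrite (primB _ (toL1 (sL2 pu2)) (toL1 (sL2 pv2))) mulrBr.
Qed.

Lemma volt_le u v : L2 nu u -> L2 nu v -> (forall x, u x <= v x) ->
  forall x, volt u x <= volt v x.
Proof.
move=> u2 v2 uv x; have pu2 := L2_prim u2; have pv2 := L2_prim v2.
rewrite /volt /= ler_pM2l ?invr_gt0 //.
apply: (prim_le _ (toL1 (sL2 pu2)) (toL1 (sL2 pv2))) => y /=.
by apply: ler_wpM2l => //; exact: (prim_le _ (toL1 u2) (toL1 v2)).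
Qed.

Lemma prim_ge0 u x : L2 nu u -> (forall y, 0 <= u y) -> 0 <= prim nu u x.
Proof.
by move=> u2 u0; apply: Rintegral_ge0 => y _; rewrite mulr_ge0 // /step ler0n.
Qed.

Lemma prim_dct (u_ : nat -> RT -> R) (u : RT -> R) C x :
  (forall n, measurable_fun setT (u_ n)) -> measurable_fun setT u ->
  (forall n y, `|u_ n y| <= C) -> (forall y, u_ n y @[n --> \oo] --> u y) ->
  prim nu (u_ n) x @[n --> \oo] --> prim nu u x.
Proof.
move=> mu_ mu uC cu; apply: (@Rint_dct _ _ _ nu _ _ (cst C)).
- by move=> n; apply: measurable_funM => //; exact: step_meas.
- by apply: measurable_funM => //; exact: step_meas.
- exact: (L1_cst (fin1 nu)).
- by move=> y; apply: cvgM; [exact: cvg_cst|exact: cu].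
- move=> n y /=; rewrite normrM; apply: le_trans (uC n y).
  by rewrite ler_piMl // step_abs.
Qed.

(** Large enough for b / (D lam^2) <= 1 / 2, which is the factor gained when [volt] acts on the
    weight. *)
Let lam : R := 1 + 2 * (b / D).
Let bD : 0 < b / D. Proof. exact: divr_gt0. Qed.
Let lam0 : 0 < lam. Proof. by rewrite /lam; move: bD; lra. Qed.
Let w := weight l lam.
Let w2 : L2 nu w. Proof. exact: weight_L2. Qed.

(* The exponential weight, with lam large enough, makes volt a contraction. *)
Let volt_weight x : volt w x <= w x / 2.
Proof.
have pw2 := L2_prim w2; have bw2 : L2 nu ((b / lam) \*o w) by exact: L2Z.
have w0 y : 0 <= w y by apply: ltW; exact: weight_gt0.
apply: (@le_trans _ _ (D^-1 * (b / lam * (lam^-1 * w x)))).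
  rewrite /volt /=; apply: ler_wpM2l; first by rewrite invr_ge0 ltW.
  apply: (@le_trans _ _ (prim nu ((b / lam) \*o w) x)).
    apply: (prim_le _ (toL1 (sL2 pw2)) (toL1 bw2)) => y /=.
    rewrite -mulrA; apply: ler_pM => //; first exact: prim_ge0.
      by case/andP: (sab y).
    exact: prim_weight.
  rewrite (primZ _ _ (toL1 w2)); apply: ler_wpM2l.
    by rewrite divr_ge0 // ltW.
  exact: prim_weight.
have -> : D^-1 * (b / lam * (lam^-1 * w x)) = (b / D / lam ^+ 2) * w x.
  by field; rewrite !gt_eqF.
rewrite mulrC; apply: ler_wpM2l => //.
rewrite ler_pdivrMr ?exprn_gt0 // /lam; move: (b / D) bD => t t0; nra.
Qed.

(** For nonnegative data the iteration from 0 increases, since [volt] is monotone, and stays below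
    [C \*o w]. Its pointwise limit exists, is nonnegative, and solves the equation by dominated
    convergence. *)
Lemma volterra_ge0 (h : RT -> R) H : measurable_fun setT h ->
  (forall x, 0 <= h x <= H) ->
  exists u, [/\ L2 nu u, forall x, 0 <= u x & forall x, u x = h x + volt u x].
Proof.
move=> mh hH; have H0 : 0 <= H by have /andP[h1 h2] := hH 0; rewrite (le_trans h1).
have h2 : L2 nu h.
  apply: (L2_bounded (fin1 nu) mh (C := H)) => x.
  by have /andP[h1 h3] := hH x; rewrite ger0_norm.
(* As w >= exp(- lam l), C w / 2 dominates h; by [volt_weight], C w is then a supersolution. *)
pose C := 2 * (H / expR (lam * - l)).
have C0 : 0 <= C by rewrite mulr_ge0 // divr_ge0 // ltW // expR_gt0.
have Cw : L2 nu (C \*o w) by exact: L2Z.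
have hC x : h x <= C * w x / 2.
  have /andP[_ h3] := hH x; apply: (le_trans h3).
  apply: (@le_trans _ _ (H / expR (lam * - l) * w x)); last first.
    by rewrite le_eqVlt; apply/orP; left; apply/eqP; rewrite /C; field; rewrite gt_eqF // expR_gt0.
  rewrite -mulrA ler_peMr // mulrC ler_pdivlMr ?expR_gt0 // mul1r.
  exact: weight_lo.
pose U := fix U n : RT -> R := if n is n'.+1 then h \+ volt (U n') else cst 0.
have U2 n : L2 nu (U n).
  elim: n => [|n IH]; first exact: (L2_cst (fin1 nu)).
  by apply: L2D => //; exact: volt_L2.
have volt0 x : volt (cst 0) x = 0.
  have z2 := L2_cst (fin1 nu) 0.
  have E : (cst 0 : RT -> R) \- cst 0 = cst 0.
    by apply/funext => y /=; rewrite subrr.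
  by have := voltB x z2 z2; rewrite subrr E.
have z2 := L2_cst (fin1 nu) 0.
have Unn n x : 0 <= U n x.
  elim: n x => [|n IH] x //=; apply: addr_ge0; first by case/andP: (hH x).
  by rewrite -(volt0 x); apply: volt_le.
have UC n x : U n x <= C * w x.
  elim: n x => [|n IH] x /=; first by rewrite mulr_ge0 // ltW // weight_gt0.
  have h3 := volt_le (U2 n) Cw IH x.
  have h4 : volt (C \*o w) x <= C * w x / 2.
    have -> : volt (C \*o w) x = C * volt w x.
      have pw2 := L2_prim w2; rewrite /volt /=.
      have -> : s \* prim nu (C \*o w) = C \*o (s \* prim nu w).
        by apply/funext => y /=; rewrite (primZ _ _ (toL1 w2)); ring.
      by rewrite (primZ _ _ (toL1 (sL2 pw2))); ring.
    by rewrite -mulrA ler_wpM2l.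
  apply: (@le_trans _ _ (C * w x / 2 + C * w x / 2)); last by rewrite -splitr.
  by apply: lerD; [exact: hC|exact: le_trans h3 h4].
have Und x : nondecreasing_seq (fun n => U n x).
  apply/nondecreasing_seqP => n; elim: n x => [|n IH] x; first exact: (Unn 1%N x).
  by rewrite /= lerD2l; exact: (volt_le (U2 n) (U2 n.+1) IH x).
pose K := C * expR (lam * l).
have UK n x : `|U n x| <= K.
  rewrite ger0_norm // (le_trans (UC n x)) // ler_wpM2l //; exact: weight_hi.
pose u x := limn (fun n => U n x).
have cu x : U n x @[n --> \oo] --> u x.
  apply: nondecreasing_is_cvgn => //; exists K => _ [n _ <-].
  by rewrite (le_trans (ler_norm _)) // UK.
have mu : measurable_fun setT (u : RT -> R).
  by apply: (@measurable_fun_cvg _ _ _ _ U) => // n; exact: (U2 n).1.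
have u0 x : 0 <= u x.
  apply: limr_ge; first exact: cvgP (cu x).
  by near=> n.
have uK x : u x <= K.
  apply: limr_le; first exact: cvgP (cu x).
  by near=> n; rewrite (le_trans (ler_norm _)) // UK.
have u2 : L2 nu u.
  by apply: (L2_bounded (fin1 nu) mu (C := K)) => x; rewrite ger0_norm.
exists u; split => // x.
have vcv : volt (U n) x @[n --> \oo] --> volt u x.
  apply: cvgM; first exact: cvg_cst.
  apply: (@prim_dct _ _ (b * (vol nu * K))).
  - by move=> n; exact: (sL2 (L2_prim (U2 n))).1.
  - exact: (sL2 (L2_prim u2)).1.
  - move=> n y; rewrite /= normrM; apply: ler_pM => //.
    apply: le_trans (prim_abs_le _ (toL1 (U2 n))) _.
    apply: (@le_trans _ _ (\int[nu]_x (cst K) x)).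
      apply: le_Rintegral => //.
      + exact: (integrable_norm (toL1 (U2 n))).
      + exact: (L1_cst (fin1 nu)).
    by rewrite [leLHS](Rintegral_cst nu measurableT K) mulrC lexx.
  - move=> y; apply: cvgM; first exact: cvg_cst.
    by apply: (@prim_dct _ _ K) => // n; exact: (U2 n).1.
have c1 : U n.+1 x @[n --> \oo] --> u x.
  by have := cu x; rewrite -(cvg_shiftS (fun n => U n x)).
have c2 : U n.+1 x @[n --> \oo] --> h x + volt u x.
  by apply: cvgD; [exact: cvg_cst|exact: vcv].
exact: (cvg_unique _ c1 c2).
Unshelve. all: by end_near. Qed.

End Volterra.

Section Shooting.
Context (R : realType) (l : R).
Hypothesis l0 : 0 < l.
Local Notation leb := (@lebesgue_measure R).
Local Notation RT := (measurableTypeR R).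
Local Notation nu := (slabm l).
Variables (D a b : R) (s g : RT -> R).
Hypotheses (D0 : 0 < D) (a0 : 0 < a).
Hypothesis ms : measurable_fun setT s.
Hypothesis sab : forall x, a <= s x <= b.
Hypothesis g2 : L2 nu g.

Let s_ge0 x : 0 <= s x.
Proof. by have /andP[h _] := sab x; rewrite (le_trans _ h) // ltW. Qed.

Let s_abs x : `|s x| <= b.
Proof. by rewrite ger0_norm //; case/andP: (sab x). Qed.

Let sL2 p : L2 nu p -> L2 nu (s \* p). Proof. exact: (L2_mull ms s_abs). Qed.
Let toL1 p : L2 nu p -> L1 nu p. Proof. exact: (L2_L1 (fin1 nu)). Qed.

Lemma volterra_source (p : RT -> R) : L2 nu p -> (forall x, 0 <= p x) ->
  exists u, [/\ L2 nu u, forall x, 0 <= u x &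
    forall x, u x = D^-1 * prim nu p x + volt l D s u x].
Proof.
move=> p2 p0; have P2 : L2 nu (D^-1 \*o prim nu p) by apply: L2Z; exact: L2_prim.
apply: (@volterra_ge0 _ _ l0 _ _ _ _ D0 a0 ms sab _ (D^-1 * \int[nu]_y `|p y|)).
  exact: P2.1.
move=> x; rewrite mulr_ge0 ?invr_ge0 ?(ltW D0) ?prim_ge0 //=.
rewrite ler_pM2l ?invr_gt0 //; apply: le_trans (ler_norm _) _.
exact: (prim_abs_le x (toL1 p2)).
Qed.

(** The system is J = c + prim (g - rho) with D rho = - prim (s J). Eliminating J, one finds rho = -
    (c u1 + u0), where u1 and u0 solve the Volterra equation with sources s and s prim g. The
    condition at l is affine in c. *)
Lemma exists_flux : exists J rho : RT -> R,
  [/\ L2 nu J, L2 nu rho, forall x, D * rho x = - prim nu (s \* J) x,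
      \int[nu]_x (s \* J) x = 0 &
      forall psi, L2 nu psi -> \int[nu]_x psi x = 0 ->
        ip nu J psi = - ip nu (g \- rho) (prim nu psi)].
Proof.
have Dn0 : D != 0 by rewrite gt_eqF.
(* The Volterra equation is solved for nonnegative sources, so g is split into its positive and
   negative parts. *)
pose gp (x : RT) : R := Num.max (g x) 0; pose gm (x : RT) : R := Num.max (- g x) 0.
have mg := g2.1.
have gple x : `|gp x| <= `|g x|.
  by rewrite /gp; have [_|_] := leP (g x) 0; rewrite ?normr0.
have gmle x : `|gm x| <= `|g x|.
  by rewrite /gm; have [_|_] := leP (- g x) 0; rewrite ?normr0 ?normrN.
have L2le (h : RT -> R) : measurable_fun setT h -> (forall x, `|h x| <= `|g x|) -> L2 nu h.
  move=> mh hg; split => //; apply: (L1_le _ g2.2); first exact: measurable_funM.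
  move=> x /=; rewrite ger0_norm -!expr2 ?sqr_ge0 //.
  by rewrite -[leRHS]real_normK ?num_real // sqr_le_abs.
have gp2 : L2 nu gp by apply: L2le => //; apply: measurable_maxr.
have gm2 : L2 nu gm.
  apply: L2le => //; apply: measurable_maxr => //.
  exact: measurableT_comp.
have gE : g = gp \- gm.
  apply/funext => x; rewrite /gp /gm /=; have [h|h] := leP (g x) 0.
    by rewrite max_l ?oppr_ge0 // sub0r opprK.
  by rewrite max_r ?subr0 // oppr_le0 ltW.
have gp0 x : 0 <= gp x by rewrite /gp le_max lexx orbT.
have gm0 x : 0 <= gm x by rewrite /gm le_max lexx orbT.
have one2 := L2_cst (fin1 nu) 1.
have pgp2 := L2_prim gp2; have pgm2 := L2_prim gm2.
have [u1 [u12 u10 u1E]] := volterra_source (sL2 one2) (fun x => mulr_ge0 (s_ge0 x) ler01).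
have [vp [vp2 vp0 vpE]] := volterra_source (sL2 pgp2)
  (fun x => mulr_ge0 (s_ge0 x) (prim_ge0 x gp2 gp0)).
have [vm [vm2 vm0 vmE]] := volterra_source (sL2 pgm2)
  (fun x => mulr_ge0 (s_ge0 x) (prim_ge0 x gm2 gm0)).
pose u0 := vp \- vm; have u02 : L2 nu u0 by exact: L2B.
have pg2 := L2_prim g2; have pu02 := L2_prim u02; have pu12 := L2_prim u12.
pose A := \int[nu]_x (s \* (cst 1 \+ prim nu u1)) x.
pose B := \int[nu]_x (s \* (prim nu g \+ prim nu u0)) x.
have cu2 : L2 nu (cst 1 \+ prim nu u1) by exact: L2D.
have gu2 : L2 nu (prim nu g \+ prim nu u0) by exact: L2D.
(* As u1 >= 0, A >= a vol: the affine equation A c + B = 0 can be solved for c. *)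
have A0 : 0 < A.
  apply: (@lt_le_trans _ _ (a * vol nu)).
    by rewrite mulr_gt0 // slabm_vol // addr_gt0.
  rewrite /vol -(Rintegral_cst nu measurableT a); apply: le_Rintegral => //.
  - exact: (L1_cst (fin1 nu)).
  - exact: toL1 (sL2 cu2).
  - move=> x _ /=; have /andP[h _] := sab x; apply: (le_trans h).
    by rewrite ler_peMr // lerDl prim_ge0.
(* The shooting parameter J(-l) = c makes rho vanish at l. *)
pose c := - B / A.
pose rho : RT -> R := (- c) \*o u1 \- u0.
have rho2 : L2 nu rho by apply: L2B => //; exact: L2Z.
pose J : RT -> R := cst c \+ prim nu (g \- rho).
have gr2 : L2 nu (g \- rho) by exact: L2B.
have J2 : L2 nu J by apply: L2D; [exact: (L2_cst (fin1 nu))|exact: L2_prim].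
have sJ : s \* J = c \*o (s \* (cst 1 \+ prim nu u1)) \+ s \* (prim nu g \+ prim nu u0).
  apply/funext => x; rewrite /J /= (primB _ (toL1 g2) (toL1 rho2)) /rho.
  have cu : L2 nu ((- c) \*o u1) by exact: L2Z.
  by rewrite (primB _ (toL1 cu) (toL1 u02)) (primZ _ _ (toL1 u12)); ring.
have csL2 : L2 nu (c \*o (s \* (cst 1 \+ prim nu u1))) by apply: L2Z; exact: sL2.
exists J, rho; split => //.
- move=> x; rewrite sJ (primD _ (toL1 csL2) (toL1 (sL2 gu2))).
  rewrite (primZ _ _ (toL1 (sL2 cu2))) /rho /u0 /=.
  have -> : s \* (cst 1 \+ prim nu u1) = s \* cst 1 \+ s \* prim nu u1.
    by apply/funext => y /=; ring.
  rewrite (primD _ (toL1 (sL2 one2)) (toL1 (sL2 pu12))).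
  have pvp2 := L2_prim vp2; have pvm2 := L2_prim vm2.
  have -> : s \* (prim nu g \+ prim nu (vp \- vm)) =
      (s \* prim nu gp \+ s \* prim nu vp) \- (s \* prim nu gm \+ s \* prim nu vm).
    apply/funext => y /=; rewrite (primB _ (toL1 vp2) (toL1 vm2)).
    by rewrite [in prim nu g y]gE (primB _ (toL1 gp2) (toL1 gm2)); ring.
  have q1 := L2D (sL2 pgp2) (sL2 pvp2); have q2 := L2D (sL2 pgm2) (sL2 pvm2).
  rewrite (primB _ (toL1 q1) (toL1 q2)).
  rewrite (primD _ (toL1 (sL2 pgp2)) (toL1 (sL2 pvp2))).
  rewrite (primD _ (toL1 (sL2 pgm2)) (toL1 (sL2 pvm2))).
  rewrite u1E vpE vmE /volt /=; move: (prim nu _ _) (prim nu _ _) (prim nu _ _).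
  move: (prim nu _ _) (prim nu _ _) (prim nu _ _) => x1 x2 x3 x4 x5 x6.
  by field.
- rewrite sJ RintD; [|exact: toL1|exact: toL1 (sL2 gu2)].
  rewrite RintZ; last exact: toL1 (sL2 cu2).
  by rewrite -/A -/B /c divfK ?addNr // gt_eqF.
- move=> psi p2 p0; rewrite /J ipDl //; [|exact: (L2_cst (fin1 nu))|exact: L2_prim].
  rewrite prim_ibp //; last exact: (@slabm_noatom R l).
  have -> : ip nu (cst c) psi = c * \int[nu]_x psi x.
    by rewrite /ip -RintZ //; exact: toL1.
  by rewrite p0 !mulr0 add0r sub0r.
Qed.

End Shooting.

(** * Functions orthogonal to H^1_0 *)

Section Orthogonal.
Context (R : realType) (l : R).
Hypothesis l0 : 0 < l.
Local Notation leb := (@lebesgue_measure R).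
Local Notation RT := (measurableTypeR R).
Local Notation nu := (slabm l).

Lemma ae_slab_dense (P : R -> Prop) (x r : R) : {ae nu, forall y, P y} ->
  slab l x -> 0 < r -> exists y, `|x - y| < r /\ P y.
Proof.
move=> H xl r0.
have [N [mN N0 PN]] := (ae_restr (@slab_meas R l) (@slabm_eq R l) (@slabm_compl R l) _).2 H.
apply: contrapT => nex.
move: xl; rewrite /slab /= in_itv /= => /andP[lx xl].
pose u := Num.min l (x + r).
have xu : x < u by rewrite lt_min xl ltrDl.
have sub : `]x, u[ `<=` N.
  move=> y /=; rewrite in_itv /= => /andP[xy yu]; apply: PN => /= HP.
  have ul : u <= l by rewrite /u ge_min lexx.
  have ur : u <= x + r by rewrite /u ge_min lexx orbT.
  apply: nex; exists y; split.
    by rewrite ltr0_norm ?subr_lt0 //; move: xy yu ul ur; lra.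
  by apply: HP; rewrite /slab /= in_itv /= (lt_trans lx xy) (lt_le_trans yu ul).
have : (leb `]x, u[ <= leb N)%E by rewrite le_measure // inE.
rewrite N0 lebesgue_measure_itv /= lte_fin xu -EFinB lee_fin subr_le0.
by rewrite leNgt xu.
Qed.

Lemma step_diff_le (x y : RT) : ip nu (step x \- step y) (step x \- step y) <= `|x - y|.
Proof.
wlog xy : x y / y <= x.
  move=> H; have [yx|xy] := leP y x; first exact: H.
  rewrite distrC; apply: le_trans (H y x (ltW xy)).
  rewrite le_eqVlt; apply/orP; left; apply/eqP.
  by apply: eq_Rintegral => z _ /=; ring.
pose I : set RT := [set` `[y, x[].
have mI : measurable I by exact: measurable_itv.
have -> : ip nu (step x \- step y) (step x \- step y) = fine (nu I).
  have -> : fine (nu I) = \int[nu]_z (\1_I z).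
    by rewrite /Rintegral integral_indic // setIT.
  apply: eq_Rintegral => z _; rewrite /step /= indicE /I.
  have [zx|xz] := ltP z x; have [zy|yz] := ltP z y.
  - by rewrite memNset ?subrr ?mul0r //= in_itv /= leNgt zy.
  - by rewrite mem_set ?subr0 ?mulr1 //= in_itv /= yz.
  - by exfalso; have := lt_le_trans zy xy; rewrite ltNge xz.
  - by rewrite memNset ?subrr ?mul0r //= in_itv /= ltNge xz andbF.
rewrite ger0_norm ?subr_ge0 //.
have h : (nu I <= (x - y)%:E)%E.
  apply: (@le_trans _ _ (leb I)).
    rewrite slabmE le_measure ?inE //; apply: measurableI => //; exact: slab_meas.
  rewrite /I lebesgue_measure_itv /= lte_fin; case: ltP => // _.
  by rewrite lee_fin subr_ge0.
rewrite -lee_fin fineK //; exact: fin_num_measure.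
Qed.

(** Cauchy-Schwarz between x and y. It supplies the continuity by which [prim_const] passes from
    almost every x to every x of the slab. *)
Lemma prim_holder (e : RT -> R) x y : L2 nu e ->
  (prim nu e x - prim nu e y) ^+ 2 <= `|x - y| * ip nu e e.
Proof.
move=> e2; have sx := L2_step nu x; have sy := L2_step nu y.
rewrite !primE -(ipBl sx sy e2); apply: le_trans (ip_cauchy (L2B sx sy) e2) _.
by rewrite ler_wpM2r ?ip_ge0 // step_diff_le.
Qed.

Lemma prim_const (e : RT -> R) c : L2 nu e -> {ae nu, forall x, prim nu e x = c} ->
  forall x, slab l x -> prim nu e x = c.
Proof.
move=> e2 H x xl; apply/eqP; rewrite -subr_eq0 -sqrf_eq0 eq_le sqr_ge0 andbT.
apply/ler_addgt0Pr => d d0; rewrite add0r.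
have K0 : 0 < ip nu e e + 1 by rewrite ltr_wpDl // ip_ge0.
have [y [xy <-]] := ae_slab_dense H xl (divr_gt0 d0 K0).
apply: le_trans (prim_holder x y e2) _.
apply: (@le_trans _ _ (`|x - y| * (ip nu e e + 1))); first by rewrite ler_wpM2l // lerDl.
by rewrite -ler_pdivlMr // ltW.
Qed.

(** Lebesgue differentiation of the primitive. To differentiate at a point, the primitive must be
    constant on a whole neighbourhood, not just almost everywhere. *)
Lemma prim_const_ae0 (e : RT -> R) c : L2 nu e ->
  (forall x, slab l x -> prim nu e x = c) -> {ae nu, forall x, e x = 0}.
Proof.
move=> e2 H; pose h : R -> R := e \_ (slab l).
have h1 : leb.-integrable setT (EFin \o h).
  have := (L1_restr (@slab_meas R l) (@slabm_eq R l) e).2 (L2_L1 (fin1 nu) (L2_patch e2)).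
  move=> /(integrable_mkcond _ (@slab_meas R l)).1.
  congr (_.-integrable _ _); apply/funext => x.
  by rewrite /h /patch /=; case: ifP.
have il : locally_integrable [set: R] h.
  have := @integrable_locally R h setT measurableT h1.
  by congr locally_integrable; apply/funext => x; rewrite /patch mem_set.
have hy y : leb.-integrable `]-oo, y] (EFin \o h) by apply: integrableS h1.
have D := FTC1Ny hy il.
apply/(ae_restr (@slab_meas R l) (@slabm_eq R l) (@slabm_compl R l)).
have Fl : Filter (almost_everywhere leb) by exact: ae_filter_ringOfSetsType.
apply: filterS D => x [dx dE] xl.
have -> : e x = h x by rewrite /h /patch mem_set.
rewrite -dE derive1E.
rewrite (@near_eq_derive _ _ _ _ (cst c)) ?derive_cst //.
have : nbhs x (slab l) by apply: open_nbhs_nbhs; split => //; exact: interval_open.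
apply: filterS => y yl; rewrite -(H y yl) primE /ip /=.
transitivity (prim nu h y); last first.
  apply: eq_prim_ae; [exact: (L2_patch e2).1|exact: e2.1|exact: slab_rest_ae].
have yl' : - l <= y <= l.
  by move: yl; rewrite /slab /= in_itv /= => /andP[? ?]; rewrite !ltW.
rewrite /h prim_slab // -Rintegral_itv_bndo_bndc; last first.
  exact: integrableS h1.
rewrite Rintegral_mkcond [RHS]Rintegral_mkcond; apply: eq_Rintegral => t _.
rewrite /patch; move: yl'; case/andP => _ yl'.
case: ifPn => [/set_mem /=|/negP nt]; rewrite ?in_itv /=.
  move=> ty; case: ifPn => [/set_mem tl|/negP ntl].
    by rewrite mem_set //= in_itv /=; move: tl; rewrite /slab /= in_itv /= => /andP[-> _].
  rewrite memNset // /= in_itv /= => /andP[lt _]; apply: ntl; rewrite mem_set //.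
  by rewrite /slab /= in_itv /= lt (lt_le_trans ty).
rewrite memNset // => /=; rewrite in_itv /= => /andP[_ ty]; apply: nt.
by rewrite mem_set //= in_itv.
Qed.

(** Take for [psi] the primitive of e minus its mean c. Integration by parts turns the hypothesis
    into |prim e - c|^2 = 0, so the primitive of e is constant. This identifies rho with g when D =
    0. *)
Lemma orth_prim_ae0 (e : RT -> R) : L2 nu e ->
  (forall psi, L2 nu psi -> \int[nu]_x psi x = 0 -> ip nu e (prim nu psi) = 0) ->
  {ae nu, forall x, e x = 0}.
Proof.
move=> e2 H; have E2 := L2_prim e2.
have vol0 : 0 < vol nu by rewrite slabm_vol // addr_gt0.
pose c := \int[nu]_x prim nu e x / vol nu.
have c2 := L2_cst (fin1 nu) c; have p2 := L2B E2 c2.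
have p0 : \int[nu]_x (prim nu e \- cst c) x = 0.
  rewrite RintB; [|exact: (L2_L1 (fin1 nu))|exact: (L2_L1 (fin1 nu))].
  have -> : \int[nu]_x cst c x = c * vol nu by exact: (Rintegral_cst nu measurableT c).
  by rewrite /c divfK ?subrr // gt_eqF.
have z : ip nu (prim nu e \- cst c) (prim nu e \- cst c) = 0.
  rewrite {1}(ipBl E2 c2 p2) (prim_ibp (@slabm_noatom R l) e2 p2) p0 mulr0 sub0r H // oppr0 sub0r.
  have -> : ip nu (cst c) (prim nu e \- cst c) = c * \int[nu]_x (prim nu e \- cst c) x.
    by rewrite /ip -RintZ //; exact: (L2_L1 (fin1 nu)).
  by rewrite p0 mulr0 oppr0.
apply: (prim_const_ae0 (c := c) e2); apply: prim_const => //.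
by apply: filterS (ip_eq0 p2 z) => x /= /eqP; rewrite subr_eq0 => /eqP.
Qed.

End Orthogonal.

(** * Bounds for weak-star limits *)

Section WeakStar.
Context d (T : measurableType d) (R : realType).
Variable m : {finite_measure set T -> \bar R}.
Implicit Types h phi : T -> R.

Lemma Rint_le0_ae h : L1 m h -> (forall x, 0 <= h x) -> \int[m]_x h x <= 0 ->
  {ae m, forall x, h x = 0}.
Proof.
move=> h1 h0 hle.
have z : \int[m]_x h x = 0 by apply/eqP; rewrite eq_le hle Rintegral_ge0.
have : (\int[m]_x `|(h x)%:E| = 0)%E.
  have -> : (\int[m]_x `|(h x)%:E| = \int[m]_x (h x)%:E)%E.
    by apply: eq_integral => x _ /=; rewrite ger0_norm.
  rewrite -[LHS]fineK; first by rewrite -/(Rintegral _ _ _) z.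
  exact: (integrable_fin_num measurableT h1).
move/(ae_eq_integral_abs m measurableT (measurable_int _ h1)).1.
by apply: filterS => x /= /(_ I) [].
Qed.

Variables (sig : R -> T -> R) (sg : T -> R) (a b : R).
Hypothesis msig : forall eps, 0 < eps -> measurable_fun setT (sig eps).
Hypothesis sigab : forall eps, 0 < eps -> forall x, a <= sig eps x <= b.
Hypothesis sg1 : L1 m sg.
Hypothesis cv : forall phi, L1 m phi ->
  \int[m]_x (sig eps x * phi x) @[eps --> 0^'+] --> \int[m]_x (sg x * phi x).

Let mind_L1 (P : T -> bool) h : measurable_fun setT P -> L1 m h ->
  L1 m (fun x => h x * (if P x then 1 else 0)).
Proof.
move=> mP h1; apply: (L1_le _ (integrable_norm h1)).
  apply: measurable_funM; first exact: L1_meas h1.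
  by apply: measurable_fun_ifT.
by move=> x /=; case: (P x); rewrite ?mulr1 ?mulr0 ?normr0.
Qed.

Let sig_L1 eps : 0 < eps -> L1 m (sig eps).
Proof.
move=> e0; apply: (L1_le (msig e0) (L1_cst (fin1 m) (`|a| + `|b|))) => x /=.
have /andP[h1 h2] := sigab e0 x; rewrite ler_norml.
have := ler_norm a; have := ler_norm b; have := ler_norm (- a).
by rewrite normrN; have := normr_ge0 a; have := normr_ge0 b; move=> *; apply/andP; split; lra.
Qed.

(** Tested against the indicator of the set where [sg < a], the limit is at least a times the
    measure of that set, which must therefore be null. *)
Lemma weak_star_ge : {ae m, forall x, a <= sg x}.
Proof.
have msg := L1_meas sg1.
pose P x := sg x < a; have mP : measurable_fun setT P by apply: measurable_fun_ltr.
pose phi x : R := if P x then 1 else 0.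
have p1 : L1 m phi.
  have := mind_L1 mP (L1_cst (fin1 m) 1).
  by congr L1; apply/funext => x; rewrite mul1r.
have ge : a * \int[m]_x phi x <= \int[m]_x (sg x * phi x).
  apply: (cvgr_to_ge (cv p1)); apply: filterS (near0 ltr01) => eps /andP[e0 _].
  rewrite -RintegralZl //; apply: le_Rintegral => //.
  - exact: (L1Z a p1).
  - exact: (mind_L1 mP (sig_L1 e0)).
  - move=> x _; rewrite /phi; case: ifP => _; rewrite ?mulr0 // !mulr1.
    by case/andP: (sigab e0 x).
have i1 := mind_L1 mP sg1; have i2 := L1Z a p1.
have : {ae m, forall x, (a \*o phi \- (fun x => sg x * phi x)) x = 0}.
  apply: Rint_le0_ae.
  - exact: L1B.
  - move=> x /=; rewrite /phi /P; case: ifP => [h|_]; rewrite ?mulr0 ?subrr // !mulr1.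
    by rewrite subr_ge0 ltW.
  - by rewrite RintB // RintZ // subr_le0.
apply: filterS => x /=; rewrite /phi /P; have [h|h] := ltP (sg x) a => //.
by rewrite !mulr1 => /eqP; rewrite subr_eq0 => /eqP E; move: h; rewrite -E ltxx.
Qed.

Lemma weak_star_le : {ae m, forall x, sg x <= b}.
Proof.
have msg := L1_meas sg1.
pose P x := b < sg x; have mP : measurable_fun setT P by apply: measurable_fun_ltr.
pose phi x : R := if P x then 1 else 0.
have p1 : L1 m phi.
  have := mind_L1 mP (L1_cst (fin1 m) 1).
  by congr L1; apply/funext => x; rewrite mul1r.
have le : \int[m]_x (sg x * phi x) <= b * \int[m]_x phi x.
  apply: (cvgr_to_le (cv p1)); apply: filterS (near0 ltr01) => eps /andP[e0 _].
  rewrite -RintegralZl //; apply: le_Rintegral => //.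
  - exact: (mind_L1 mP (sig_L1 e0)).
  - exact: (L1Z b p1).
  - move=> x _; rewrite /phi; case: ifP => _; rewrite ?mulr0 // !mulr1.
    by case/andP: (sigab e0 x).
have i1 := mind_L1 mP sg1; have i2 := L1Z b p1.
have : {ae m, forall x, ((fun x => sg x * phi x) \- b \*o phi) x = 0}.
  apply: Rint_le0_ae.
  - exact: L1B.
  - move=> x /=; rewrite /phi /P; case: ifP => [h|_]; rewrite ?mulr0 ?subrr // !mulr1.
    by rewrite subr_ge0 ltW.
  - by rewrite RintB // RintZ // subr_le0.
apply: filterS => x /=; rewrite /phi /P; have [h|h] := ltP b (sg x) => //.
by rewrite !mulr1 => /eqP; rewrite subr_eq0 => /eqP E; move: h; rewrite E ltxx.
Qed.

(** Turns bounds that hold almost everywhere into bounds at every point, as the comparison argument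
    asks of sigma and of its limit. *)
Definition clip (h : T -> R) (x : T) : R := Num.max a (Num.min b (h x)).

Lemma clip_meas h : measurable_fun setT h -> measurable_fun setT (clip h).
Proof. by move=> mh; apply: measurable_maxr => //; exact: measurable_minr. Qed.

Lemma clip_itv h x : a <= b -> a <= clip h x <= b.
Proof. by move=> ab; rewrite /clip le_max lexx /= ge_max ab ge_min lexx. Qed.

Lemma clip_id h x : a <= h x -> h x <= b -> clip h x = h x.
Proof. by move=> h1 h2; rewrite /clip min_r // max_r. Qed.

Lemma clip_ae : {ae m, forall x, sg x = clip sg x}.
Proof.
apply: filterS2 weak_star_ge weak_star_le => x h1 h2.
by rewrite clip_id.
Qed.

Lemma weak_star_clip phi : L1 m phi ->
  \int[m]_x (sig eps x * phi x) @[eps --> 0^'+] --> \int[m]_x (clip sg x * phi x).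
Proof.
move=> p1; have msg := L1_meas sg1; have mp := L1_meas p1.
have -> : \int[m]_x (clip sg x * phi x) = \int[m]_x (sg x * phi x).
  apply: Rint_ae.
  - by apply: measurable_funM => //; exact: clip_meas.
  - exact: measurable_funM.
  - by apply: filterS clip_ae => x E; rewrite -E.
exact: cv.
Qed.

End WeakStar.

Section LonLemmas.
Context d (T : measurableType d) (R : realType).
Variable m : {measure set T -> \bar R}.

Lemma Lon_inf_ae (D : set T) (f : T -> R) : Lon m +oo%E D f ->
  exists M, {ae m, forall x, `|(f \_ D) x| <= M}.
Proof.
rewrite /Lon inE => /andP[_]; rewrite inE /= /finite_norm unlock /=.
(* If the whole space is null, every bound holds almost everywhere. *)
case: ifPn => [m0 H|]; last first.
  rewrite -leNgt measure_le0 => /eqP m0 _; exists 0; exists setT; split => //.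
by apply: (@ess_supr_bounded _ _ _ m (fun x => `|(f \_ D) x|)).
Qed.

Lemma Lon_meas p (D : set T) (f : T -> R) : Lon m p D f -> measurable_fun setT (f \_ D).
Proof. by rewrite /Lon inE => /andP[]; rewrite inE. Qed.

End LonLemmas.

(** * From the transport problem to its integrated form *)

Section Translation.
Context (R : realType) (l : R) (V : set R).
Hypothesis l0 : 0 < l.
Variable mu : probability (measurableTypeR R) R.
Local Notation leb := (@lebesgue_measure R).
Local Notation RT := (measurableTypeR R).
Local Notation nu := (slabm l).
Local Notation m := (nu \x mu)%E.
Hypothesis mV : measurable (V : set RT).
Hypothesis muV : mu V = 1%E.

Lemma velocity_L2 : mu.-integrable V (fun v => (v ^+ 2)%:E) ->
  L2 mu (fun v : RT => v : R).
Proof.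
move=> i2; split => //; apply: (@L1_restr_meas _ _ _ mu mu _ mV (fun A _ _ => erefl) (mu_compl mV muV)).
  exact: measurable_funM.
by congr (_.-integrable _ _): i2.
Qed.

Lemma velocity_mean0 : (\int[mu]_(v in V) v%:E = 0)%E -> \int[mu]_v v = 0.
Proof.
move=> i0; rewrite -(@Rint_restr_meas _ _ _ mu mu _ mV (fun A _ _ => erefl) (mu_compl mV muV)) //.
by rewrite /Rintegral i0.
Qed.

Lemma velocity_var : vavg V mu (fun v => v ^+ 2) = ip mu (fun v : RT => v : R) (fun v => v).
Proof.
rewrite /vavg (@Rint_restr_meas _ _ _ mu mu _ mV (fun A _ _ => erefl) (mu_compl mV muV)); last first.
  exact: measurable_funX.
by apply: eq_Rintegral => v _; rewrite expr2.
Qed.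

Lemma mean_patch (f : RT * RT -> R) x : slab l x ->
  rhof mu (f \_ (slab l `*` V)) x = vavg V mu (fun w => f (x, w)).
Proof.
move=> xl; rewrite /vavg Rintegral_mkcond; apply: eq_Rintegral => w _ /=.
rewrite mul1r /patch; congr (if _ then _ else _).
by apply/idP/idP => /set_mem; rewrite ?inE /=; [case|].
Qed.

(** Off v = 0 the absolutely continuous representative u of f(., v) gives v f = v u(-l) + v prim df,
    and [coll] is v df by the equation. At v = 0 only [coll = 0] is extracted. *)
Lemma transport_translate eps (sig sig' g : RT -> R) (f : RT * RT -> R) :
  0 < eps -> (forall x, slab l x -> sig' x = sig x) ->
  measurable_fun setT (coll mu eps sig' (g \_ (slab l)) (f \_ (slab l `*` V))) ->
  transport_sol l V mu eps sig g f ->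
  let c := coll mu eps sig' (g \_ (slab l)) (f \_ (slab l `*` V)) in
  {ae mu, forall v : RT,
    (v = 0 -> {ae nu, forall x, c (x, v) = 0}) /\
    {ae nu, forall x, v * (f \_ (slab l `*` V)) (x, v) =
       inflow nu mu eps sig' (g \_ (slab l)) (f \_ (slab l `*` V)) v
       + prim nu (fun y => c (y, v)) x}}.
Proof.
move=> e0 sE mc [f2 H] c.
have en0 : eps != 0 by rewrite gt_eqF.
have toT := ae_restr (@slab_meas R l) (@slabm_eq R l) (@slabm_compl R l).
have Fm : Filter (almost_everywhere mu) by exact: ae_filter_ringOfSetsType.
have Fl : Filter (almost_everywhere leb) by exact: ae_filter_ringOfSetsType.
have mu_mu (A : set RT) : measurable A -> A `<=` V -> mu A = mu A by [].
apply: (ae_restr mV mu_mu (mu_compl mV muV) _).1.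
apply: filterS H => v Hv Vv; have [df [eq1 eq2]] := Hv Vv.
have mcv : measurable_fun setT (fun y : RT => c (y, v)) by exact: measurableT_comp mc _.
(* The transport equation multiplied by eps. *)
have collE : {ae nu, forall x, c (x, v) = v * (df \_ (slab l)) x}.
  apply: (toT _).1; apply: filterS eq1 => x E xl; have {E} := E xl.
  have xv : (x, v) \in slab l `*` V by rewrite inE.
  rewrite /c /coll /lift /= mean_patch // sE // /patch xv mem_set //.
  by move=> <-; field.
have c0 : v = 0 -> {ae nu, forall x, c (x, v) = 0}.
  by move=> v0; apply: filterS collE => x ->; rewrite v0 mul0r.
split => //; have [v0|v0] := eqVneq v 0.
  have i0 : inflow nu mu eps sig' (g \_ (slab l)) (f \_ (slab l `*` V)) v = 0.
    by rewrite /inflow v0 ltxx.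
  apply: aeW => x; rewrite i0 {1}v0 mul0r add0r.
  rewrite (@eq_prim_ae _ _ _ (cst 0)) //; last exact: c0.
  by rewrite /prim Rint_eq0 // => y _ /=; rewrite mulr0.
have [u [[Ldf uE] fu bc1 bc2]] := eq2 v0.
have df1 : L1 nu (df \_ (slab l)).
  apply/(L1_restr (@slab_meas R l) (@slabm_eq R l)).
  apply/(integrable_mkcond _ (@slab_meas R l)).
  have := (Lfun1_integrable _ _).1 Ldf.
  congr (_.-integrable _ _); apply/funext => x.
  by rewrite /patch /=; case: ifP.
have mdf := L1_meas df1.
have mvdf : measurable_fun setT (v \*o (df \_ (slab l)) : RT -> R) by exact: measurable_funM.
have pc x : prim nu (fun y => c (y, v)) x = v * prim nu (df \_ (slab l)) x.
  by rewrite -primZ //; apply: eq_prim_ae.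
have ll : - l <= l <= l by rewrite lexx andbT (le_trans _ (ltW l0)) // oppr_le0 ltW.
have tE : tau nu mu eps sig' (g \_ (slab l)) (f \_ (slab l `*` V)) v =
    v * prim nu (df \_ (slab l)) l.
  rewrite /tau (Rint_ae mcv mvdf collE) RintZ //; congr (_ * _).
  by rewrite prim_slab // (Rint_restr (@slabm_eq R l)).
(* For v < 0 the condition u(l) = 0 makes u(-l) minus the integral of df, that is v u(-l) = -
   tau. *)
have iE : inflow nu mu eps sig' (g \_ (slab l)) (f \_ (slab l `*` V)) v = v * u (- l).
  rewrite /inflow tE; case: ltgtP v0 => // vs _; last by rewrite bc1 // mulr0.
  have := uE l ll; rewrite bc2 // -prim_slab // => /eqP.
  by rewrite eq_sym addr_eq0 => /eqP ->; rewrite mulrN.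
apply: (toT _).1; apply: filterS fu => x E xl.
have xv : (x, v) \in slab l `*` V by rewrite inE.
have xl' : - l <= x <= l.
  by move: xl; rewrite /slab /= in_itv /= => /andP[? ?]; rewrite !ltW.
rewrite /patch xv -/(patch _ _ _) (E xl) iE pc (uE x xl') mulrDr.
by rewrite prim_slab.
Qed.

End Translation.

(** Inversion is continuous off 0 and sends 0 to 0, so it coincides with its own extension by 0 from
    the complement of 0. *)
Lemma inv_meas (R : realType) d (T : measurableType d) (s : T -> R) :
  measurable_fun setT s -> measurable_fun setT (fun x => (s x)^-1).
Proof.
move=> ms; suff mi : measurable_fun setT (@GRing.inv R).
  exact: measurableT_comp mi ms.
have oD : open (~` [set (0 : R)]) by rewrite openC; exact: closed_eq.
have mD : measurable (~` [set (0 : R)]) by apply: measurableC; exact: measurable_set1.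
have H : measurable_fun (~` [set (0 : R)]) (@GRing.inv R).
  apply: open_continuous_measurable_fun => // y; rewrite inE /= => /eqP y0.
  by apply: cvgV => //; exact: cvg_id.
have := (measurable_restrictT _ mD).1 H; congr measurable_fun.
apply/funext => y; rewrite /patch; case: ifPn => // /negP y0.
have [->|yn0] := eqVneq y 0; first by rewrite invr0.
by exfalso; apply: y0; rewrite inE /=; exact/eqP.
Qed.

Lemma Lon1P d (T : measurableType d) (R : realType) (m m' : {measure set T -> \bar R})
    (D : set T) (phi : T -> R) : measurable D ->
  (forall A, measurable A -> A `<=` D -> m A = m' A) ->
  Lon m 1%E D phi <-> L1 m' (phi \_ D).
Proof.
move=> mD mm; rewrite -(L1_restr mD mm) /Lon Lfun1_integrable.
rewrite (_ : EFin \o phi \_ D = (EFin \o phi) \_ D).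
  by have [h1 h2] := @integrable_mkcond _ _ _ m _ (EFin \o phi) mD; split.
by apply/funext => x; rewrite /patch /=; case: ifP.
Qed.

(** * Weak form of the diffusion problem *)

Section Diffusion.
Context (R : realType) (l : R).
Hypothesis l0 : 0 < l.
Local Notation leb := (@lebesgue_measure R).
Local Notation RT := (measurableTypeR R).
Local Notation nu := (slabm l).
Variables (D a b : R) (sg g : R -> R).
Hypotheses (a0 : 0 < a).
Let sg0 : RT -> R := sg \_ (slab l).
Let g0 : RT -> R := g \_ (slab l).
Hypothesis msg : measurable_fun setT sg0.
Let s : RT -> R := clip a b sg0.
Hypothesis ab : a <= b.
Hypothesis sE : {ae nu, forall x, sg0 x = s x}.
Hypothesis g2 : L2 nu g0.

Let sab x : a <= s x <= b. Proof. exact: clip_itv. Qed.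
Let ms : measurable_fun setT s. Proof. exact: clip_meas. Qed.
Let mis : measurable_fun setT (fun x => (s x)^-1).
Proof. exact: inv_meas. Qed.
Let s_gt0 x : 0 < s x.
Proof. by have /andP[h _] := sab x; rewrite (lt_le_trans a0). Qed.
Let Ds : RT -> R := fun x => D / s x.
Let mDs : measurable_fun setT Ds. Proof. exact: measurable_funM. Qed.
Let Ds_abs x : `|Ds x| <= `|D| / a.
Proof.
rewrite /Ds normrM [X in _ * X]ger0_norm; last by rewrite invr_ge0 ltW.
by apply: ler_wpM2l => //; rewrite lef_pV2 ?posrE //; case/andP: (sab x).
Qed.
Let DsL2 p : L2 nu p -> L2 nu (Ds \* p). Proof. exact: (L2_mull mDs Ds_abs). Qed.

(** Replaces [sg] by its clipped representative, whose inverse is bounded, so that the flux term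
    becomes a pairing of L^2 functions. *)
Lemma diffusion_int (rho drho X psi : RT -> R) :
  L2 nu (rho \_ (slab l)) -> L2 nu (drho \_ (slab l)) ->
  L2 nu (X \_ (slab l)) -> L2 nu (psi \_ (slab l)) ->
  \int[leb]_(x in slab l) (rho x * X x + D / sg x * drho x * psi x) =
  ip nu (rho \_ (slab l)) (X \_ (slab l)) +
  ip nu (Ds \* (drho \_ (slab l))) (psi \_ (slab l)).
Proof.
move=> r2 p2 X2 psi2; rewrite (Rint_restr (@slabm_eq R l)).
have q2 := DsL2 p2.
rewrite -RintD; [|exact: L2M|exact: L2M].
have -> : (fun x => rho x * X x + D / sg x * drho x * psi x) \_ (slab l) =
    (fun x => (rho \_ (slab l)) x * (X \_ (slab l)) x +
      D * (sg0 x)^-1 * (drho \_ (slab l)) x * (psi \_ (slab l)) x).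
  apply/funext => x; rewrite /sg0 /patch; case: (x \in slab l) => //.
  by rewrite !mulr0 addr0.
apply: Rint_ae.
- apply: measurable_funD; first exact: measurable_funM r2.1 X2.1.
  apply: measurable_funM; last exact: psi2.1.
  apply: measurable_funM; last exact: p2.1.
  by apply: measurable_funM => //; exact: inv_meas.
- apply: measurable_funD; first exact: measurable_funM r2.1 X2.1.
  exact: measurable_funM q2.1 psi2.1.
- by apply: filterS sE => x -> /=.
Qed.

Let source_int (X : RT -> R) : L2 nu (X \_ (slab l)) ->
  \int[leb]_(x in slab l) (g x * X x) = ip nu g0 (X \_ (slab l)).
Proof. by move=> X2; rewrite (ip_restr (@slabm_eq R l)). Qed.

Let ip_patchr h X : L2 nu h -> L2 nu X -> ip nu h (X \_ (slab l)) = ip nu h X.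
Proof.
move=> h2 X2; have X2' := L2_patch X2.
by rewrite ipC (ip_ael X2' X2 h2 (slab_rest_ae l X)) ipC.
Qed.

(** By [prim_H10] the primitives of mean free [psi] are admissible test functions; this puts the
    problem in the form of [flux_eq]. *)
Lemma diffusion_weak rho : diffusion_sol l D sg g rho ->
  exists p, [/\ L2 nu p, \int[nu]_x p x = 0, L2 nu (rho \_ (slab l)),
    {ae nu, forall x, (rho \_ (slab l)) x = prim nu p x} &
    forall psi, L2 nu psi -> \int[nu]_x psi x = 0 ->
      ip nu (prim nu p) (prim nu psi) + ip nu (Ds \* p) psi = ip nu g0 (prim nu psi)].
Proof.
move=> [drho [H E]]; have [p2 p0 r2 rE] := H10_prim l0 H.
exists (drho \_ (slab l)); split => // psi psi2 psi0.
have X2 := L2_prim psi2; have P2 := L2_prim p2.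
have := E _ _ (prim_H10 l0 psi2 psi0).
rewrite diffusion_int //; [|exact: L2_patch|exact: L2_patch].
rewrite source_int; last exact: L2_patch.
rewrite !ip_patchr //; last exact: DsL2.
by rewrite (ip_ael r2 P2 X2 rE).
Qed.

Lemma diffusion_exists : 0 < D -> exists rho, diffusion_sol l D sg g rho.
Proof.
move=> D0; have [J [rho [J2 rho2 rhoE sJ0 JE]]] := exists_flux l0 D0 a0 ms sab g2.
have s_abs x : `|s x| <= b by rewrite ger0_norm ?(ltW (s_gt0 x)) //; case/andP: (sab x).
have sJ2 : L2 nu (s \* J) := L2_mull ms s_abs J2.
have toL1 p : L2 nu p -> L1 nu p by exact: (L2_L1 (fin1 nu)).
(* The derivative of rho, read off D rho = - prim (s J). *)
pose p : RT -> R := (- D^-1) \*o (s \* J).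
have p2 : L2 nu p by exact: L2Z.
have p0 : \int[nu]_x p x = 0 by rewrite RintZ ?sJ0 ?mulr0 //; exact: toL1.
have rp : rho = prim nu p.
  apply/funext => x; rewrite /p primZ; last exact: toL1.
  rewrite mulNr -mulrN -rhoE mulrA mulVf ?mul1r // gt_eqF //.
have HP := prim_H10 l0 p2 p0.
exists rho; exists p; split; first by rewrite rp.
move=> phi dphi H; have [q2 q0 f2 fE] := H10_prim l0 H.
have X2 := L2_prim q2; have rho2' := L2_patch rho2; have p2' := L2_patch p2.
rewrite diffusion_int // source_int //.
have e1 : ip nu (rho \_ (slab l)) (phi \_ (slab l)) =
    ip nu rho (prim nu (dphi \_ (slab l))).
  by rewrite ipC ip_patchr // (ip_ael f2 X2 rho2 fE) ipC.
have e2 : ip nu g0 (phi \_ (slab l)) = ip nu g0 (prim nu (dphi \_ (slab l))).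
  by rewrite ipC (ip_ael f2 X2 g2 fE) ipC.
rewrite e1 e2.
have -> : ip nu (Ds \* (p \_ (slab l))) (dphi \_ (slab l)) = - ip nu J (dphi \_ (slab l)).
  rewrite -[RHS]mulN1r -(ipZl _ J2 q2).
  have h2 : L2 nu (Ds \* p) := DsL2 p2.
  have -> : -1 \*o J = Ds \* p.
    apply/funext => x; rewrite /Ds /p /=; field.
    by rewrite !gt_eqF.
  apply: ip_ael => //; first exact: DsL2.
  by apply: filterS (slab_rest_ae l p) => x /= ->.
rewrite (JE _ q2 q0) opprK (ipBl g2 rho2 X2); ring.
Qed.

End Diffusion.

(** * The diffusion limit *)

Section DiffusionLimit.
Context (R : realType) (l : R) (V : set R).
Hypothesis l0 : 0 < l.
Variable mu : probability (measurableTypeR R) R.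
Local Notation leb := (@lebesgue_measure R).
Local Notation RT := (measurableTypeR R).
Local Notation nu := (slabm l).
Local Notation m := (nu \x mu)%E.
Local Notation idV := (fun v : RT => v : R).
Local Notation S := (slab l).
Hypothesis mV : measurable (V : set RT).
Hypothesis muV : mu V = 1%E.
Hypothesis hv2 : mu.-integrable V (fun v => (v ^+ 2)%:E).
Hypothesis hmean : (\int[mu]_(v in V) v%:E = 0)%E.
Variables (g : R -> R) (sig : R -> R -> R) (a b : R) (sigstar : R -> R)
  (f : R -> R * R -> R).
Hypothesis hg : Lon leb 2%:E S g.
Hypothesis a0 : 0 < a.
Hypothesis sig_diff : forall eps, 0 < eps -> forall x, S x -> derivable (sig eps) x 1.
Hypothesis sig_bound : forall eps, 0 < eps -> forall x, S x -> a <= sig eps x <= b.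
Hypothesis hsigstar : weak_star_lim l sig sigstar.
Hypothesis hf : forall eps, 0 < eps -> transport_sol l V mu eps (sig eps) g (f eps).

Let ab : a <= b.
Proof.
have z : S 0 by rewrite /slab /= in_itv /= oppr_lt0 l0.
by have /andP[h1 h2] := sig_bound ltr01 z; exact: le_trans h1 h2.
Qed.

Let V2 : L2 mu idV. Proof. exact: velocity_L2 mV muV hv2. Qed.
Let V0 : \int[mu]_v v = 0. Proof. exact: velocity_mean0 mV muV hmean. Qed.
Let mu1 : mu setT = 1%E. Proof. exact: probability_setT. Qed.
Let noatom : forall x, nu [set x] = 0%E. Proof. exact: slabm_noatom. Qed.
Let vol0 : 0 < vol nu. Proof. by rewrite slabm_vol // addr_gt0. Qed.

Let g0 : RT -> R := g \_ S.
Let g2 : L2 nu g0.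
Proof. by apply/(L2_restr (@slab_meas R l) (@slabm_eq R l)). Qed.

Let sg0 : RT -> R := sigstar \_ S.
(** Extension by 0 would lose the lower bound off the slab; clipping restores it and changes nothing
    on the slab. *)
Let sx eps : RT -> R := clip a b (sig eps \_ S).
Let s : RT -> R := clip a b sg0.

Let sxE eps x : 0 < eps -> S x -> sx eps x = sig eps x.
Proof.
move=> e0 xl; have /andP[h1 h2] := sig_bound e0 xl.
by rewrite /sx clip_id /patch mem_set.
Qed.

Let sxab eps x : a <= sx eps x <= b. Proof. exact: clip_itv. Qed.
Let sab x : a <= s x <= b. Proof. exact: clip_itv. Qed.

Let msig eps : 0 < eps -> measurable_fun setT (sig eps \_ S : RT -> R).
Proof.
move=> e0; apply/(measurable_restrictT _ (@slab_meas R l)).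
apply: open_continuous_measurable_fun; first exact: interval_open.
move=> x /set_mem xl; apply: differentiable_continuous.
by apply/derivable1_diffP; exact: sig_diff.
Qed.

Let msx eps : 0 < eps -> measurable_fun setT (sx eps).
Proof. by move=> e0; apply: clip_meas; exact: msig. Qed.

Let msg : measurable_fun setT sg0. Proof. exact: Lon_meas hsigstar.1. Qed.

Let ms : measurable_fun setT s. Proof. exact: clip_meas. Qed.

Let sg1 : L1 nu sg0.
Proof.
have [M HM] := Lon_inf_ae hsigstar.1.
have H : {ae nu, forall x, `|sg0 x| <= M}.
  apply: (ae_restr (@slab_meas R l) (@slabm_eq R l) (@slabm_compl R l) _).1.
  have Fl : Filter (almost_everywhere leb) by exact: ae_filter_ringOfSetsType.
  by apply: filterS HM => x h _.
have ih : L1 nu (fun x => `|sg0 x|).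
  apply: (L1_le_ae _ (L1_cst (fin1 nu) `|M|)) => //.
  - exact: measurableT_comp.
  - by apply: filterS H => x h /=; rewrite (le_trans h) // ler_norm.
exact: (L1_le msg ih).
Qed.

Let cv0 phi : L1 nu phi ->
  \int[nu]_x (sx eps x * phi x) @[eps --> 0^'+] --> \int[nu]_x (sg0 x * phi x).
Proof.
move=> p1; have mp := L1_meas p1.
have mpp := patch_meas l mp.
have pL : Lon leb 1%E S phi.
  apply/(Lon1P phi (@slab_meas R l) (@slabm_eq R l)).
  have hn : L1 nu (fun x => `|phi x|) := integrable_norm p1.
  apply: (L1_le _ hn) => [|x]; first exact: mpp.
  by rewrite /patch; case: ifP => _; rewrite ?normr0.
have E (h : RT -> R) : measurable_fun setT (h \_ S) ->
    \int[leb]_(x in S) (h x * phi x) = \int[nu]_x ((h \_ S) x * phi x).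
  move=> mh; rewrite (Rint_restr (@slabm_eq R l) (h \* phi)) -restr_mul.
  apply: Rint_ae; [exact: measurable_funM|exact: measurable_funM|].
  by apply: filterS (slab_rest_ae l phi) => x /= ->.
have := hsigstar.2 phi pL; rewrite (E sigstar msg).
apply: cvg_trans; apply: near_eq_cvg; apply: filterS (near0 ltr01) => eps /andP[e0 _].
rewrite E; last exact: msig.
apply: Rint_ae.
- by apply: measurable_funM => //; exact: msig.
- by apply: measurable_funM => //; exact: msx.
- have H : {ae leb, forall x, S x -> (sig eps \_ S) x * phi x = sx eps x * phi x}.
    by apply: aeW => x xl; rewrite sxE // /patch mem_set.
  exact: ((ae_restr (@slab_meas R l) (@slabm_eq R l) (@slabm_compl R l) _).1 H).
Qed.

Let sE : {ae nu, forall x, sg0 x = s x}.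
Proof.
by apply: (clip_ae (sig := sx)).
Qed.

Let weak_star phi : L1 nu phi ->
  \int[nu]_x (sx eps x * phi x) @[eps --> 0^'+] --> \int[nu]_x (s x * phi x).
Proof.
by move=> p1; apply: (weak_star_clip (sig := sx) (sg := sg0)).
Qed.

Let SV : set (RT * RT) := S `*` V.
Let mSV : measurable SV. Proof. exact: slabprod_meas. Qed.
Let SVeq A : measurable A -> A `<=` SV -> (leb \x mu)%E A = m A.
Proof. exact: slabprod_eq. Qed.
Let SVc : m (~` SV) = 0%E. Proof. exact: slabprod_compl. Qed.

Let f0 eps : RT * RT -> R := f eps \_ SV.
Let f2 eps : 0 < eps -> L2 m (f0 eps).
Proof. by move=> e0; apply/(L2_restr mSV SVeq); case: (hf e0). Qed.

Let coll2 eps : 0 < eps -> L2 m (coll mu eps (sx eps) g0 (f0 eps)).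
Proof. by move=> e0; exact: (coll_L2 eps a0 (msx e0) (sxab eps) g2 (f2 e0)). Qed.

Let transport eps : 0 < eps -> {ae mu, forall v : RT,
  (v = 0 -> {ae nu, forall x, coll mu eps (sx eps) g0 (f0 eps) (x, v) = 0}) /\
  {ae nu, forall x, v * f0 eps (x, v) = inflow nu mu eps (sx eps) g0 (f0 eps) v
    + prim nu (fun y => coll mu eps (sx eps) g0 (f0 eps) (y, v)) x}}.
Proof.
move=> e0; apply: (transport_translate l0 mV muV e0 _ _ (hf e0)).
- by move=> x; exact: sxE.
- exact: (coll2 e0).1.
Qed.

Let D := vavg V mu (fun v => v ^+ 2).
Let DE : D = ip mu idV idV. Proof. exact: velocity_var. Qed.

Let fluct_small : small (fun eps =>
  ip m (f0 eps \- lift (rhof mu (f0 eps))) (f0 eps \- lift (rhof mu (f0 eps)))).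
Proof.
have K0 : 0 <= ip nu g0 g0 / (2 * a).
  by rewrite divr_ge0 ?ip_ge0 // mulr_ge0 // ltW.
apply: (@small_le _ _ (fun eps => ip nu g0 g0 / (2 * a) * eps)); last first.
  exact (smallZ K0 (@small_id R)).
move=> eps he; have /andP[e0 e1] := he.
apply: le_trans (fluct_bound mu1 noatom a0 e0 (msx e0) (sxab eps) g2 (f2 e0) (transport e0)) _.
by rewrite -mulrA; exact: le_scale_eps.
Qed.

(** D is the second moment of [mu], so v = 0 almost surely, and there the equation reads [coll = 0].
    Averaged in v, this leaves eps (g - F) = 0. *)
Let mean_eq eps : D = 0 -> 0 < eps ->
  ip nu (rhof mu (f0 eps) \- g0) (rhof mu (f0 eps) \- g0) = 0.
Proof.
move=> D0 e0; have F2 : L2 nu (rhof mu (f0 eps)) by apply: mean_L2; exact: f2.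
have c2 := coll2 e0.
have v0 : {ae mu, forall v : RT, v = 0} by apply: ip_eq0 => //; rewrite -DE.
have cc : ip m (coll mu eps (sx eps) g0 (f0 eps)) (coll mu eps (sx eps) g0 (f0 eps)) = 0.
  rewrite (ip_sections c2 c2).
  have -> : (0 : R) = \int[mu]_v (cst 0) v by rewrite Rintegral_cst // mul0r.
  apply: Rint_ae => //; first exact: (L1_meas (L1_sections c2 c2)).
  have Fm : Filter (almost_everywhere mu) by exact: ae_filter_ringOfSetsType.
  apply: filterS3 v0 (transport e0) (L2_ae2 c2) => v vz [H _] cv2.
  have z2 := L2_cst (fin1 nu) 0.
  by rewrite (ip_ael cv2 z2 cv2 (H vz)) ip0l.
have e2 := L2B g2 F2; have le2 := L2_lift mu e2.
have := ip_coll_lift mu1 eps a0 (msx e0) (sxab eps) g2 (f2 e0) e2.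
have -> : ip m (coll mu eps (sx eps) g0 (f0 eps)) (lift (g0 \- rhof mu (f0 eps))) = 0.
  apply/eqP; rewrite -sqrf_eq0 eq_le sqr_ge0 andbT.
  by rewrite (le_trans (ip_cauchy c2 le2)) // cc mul0r.
move/esym/eqP; rewrite mulf_eq0 gt_eqF //= => /eqP E.
by rewrite -E; apply: eq_Rintegral => x _ /=; ring.
Qed.

(** For D > 0 the flux J = - (D / s) rho' of the given solution meets the assumptions of
    [strong_limit]; for D = 0 the weak form says rho = g. As rho is an arbitrary solution,
    uniqueness becomes a corollary. *)
Lemma strong_convergence rho : diffusion_sol l D sigstar g rho ->
  L2 nu (rho \_ S) /\
  small (fun eps => ip m (f0 eps \- lift (rho \_ S)) (f0 eps \- lift (rho \_ S))).
Proof.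
move=> Hrho; have [p [p2 p0 r2 rE pE]] := diffusion_weak l0 a0 msg ab sE g2 Hrho.
split => //; have P2 := L2_prim p2.
have : 0 <= D by rewrite DE ip_ge0.
rewrite le_eqVlt => /predU1P[D0|D0].
- have er : {ae nu, forall x, (prim nu p \- g0) x = 0}.
    apply: orth_prim_ae0 => //; first exact: L2B.
    move=> psi psi2 psi0; have X2 := L2_prim psi2.
    rewrite (ipBl P2 g2 X2) -(pE _ psi2 psi0) -D0.
    rewrite (_ : ip nu _ psi = 0) ?addr0 ?subrr //.
    rewrite (_ : _ \* p = cst 0) ?ip0l //.
    by apply/funext => x /=; rewrite !mul0r.
  have gr : {ae nu, forall x, g0 x = (rho \_ S) x}.
    apply: filterS2 er rE => x /= /eqP; rewrite subr_eq0 => /eqP <- ->.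
    by [].
  apply: (@small_le _ _ (fun eps =>
    2 * ip m (f0 eps \- lift (rhof mu (f0 eps))) (f0 eps \- lift (rhof mu (f0 eps))))).
    move=> eps /andP[e0 _].
    have F2 : L2 nu (rhof mu (f0 eps)) by apply: mean_L2; exact: f2.
    have lF2 := L2_lift mu F2; have e2 := L2B F2 r2; have e2' := L2B F2 g2.
    have z : ip nu (rhof mu (f0 eps) \- rho \_ S) (rhof mu (f0 eps) \- rho \_ S) = 0.
      have ae : {ae nu, forall x, (rhof mu (f0 eps) \- rho \_ S) x =
          (rhof mu (f0 eps) \- g0) x}.
        by apply: filterS gr => x /= ->.
      rewrite (ip_ael e2 e2' e2 ae) ipC (ip_ael e2 e2' e2' ae).
      exact: mean_eq.
    have -> : f0 eps \- lift (rho \_ S) = (f0 eps \- lift (rhof mu (f0 eps))) \+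
        lift (rhof mu (f0 eps) \- rho \_ S).
      by apply/funext => w; rewrite /lift /=; ring.
    apply: le_trans (ipD_le (L2B (f2 e0) lF2) (L2_lift mu e2)) _.
    by rewrite (ip_lift mu1 e2 e2) z mulr0 addr0.
  exact: smallZ.
- pose Ds (x : RT) : R := D / s x.
  have s_gt0 x : 0 < s x by have /andP[h _] := sab x; rewrite (lt_le_trans a0).
  have Dp2 : L2 nu (Ds \* p).
    apply: (@L2_mull _ _ _ _ (D / a)) => //.
      by apply: measurable_funM => //; exact: inv_meas.
    move=> x; rewrite /Ds ger0_norm; last by rewrite divr_ge0 ?ltW.
    apply: ler_wpM2l; first exact: ltW.
    by rewrite lef_pV2 ?posrE //; case/andP: (sab x).
  pose J : RT -> R := -1 \*o (Ds \* p).
  have J2 : L2 nu J by exact: L2Z.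
  have toL1 q : L2 nu q -> L1 nu q by exact: (L2_L1 (fin1 nu)).
  have sJ : s \* J = - D \*o p.
    by apply/funext => x; rewrite /J /Ds /=; field; rewrite gt_eqF.
  have D0' : 0 < ip mu idV idV by rewrite -DE.
  have JE psi : L2 nu psi -> \int[nu]_x psi x = 0 ->
      ip nu J psi = - ip nu (g0 \- prim nu p) (prim nu psi).
    move=> psi2 psi0; have X2 := L2_prim psi2.
    rewrite (ipZl _ Dp2 psi2) (ipBl g2 P2 X2) -(pE _ psi2 psi0).
    by rewrite addrC addKr mulN1r.
  have pD x : ip mu idV idV * prim nu p x = - prim nu (s \* J) x.
    by rewrite sJ primZ ?mulNr ?opprK -?DE //; exact: toL1.
  have pend : \int[nu]_x (s \* J) x = 0.
    by rewrite sJ RintZ ?p0 ?mulr0 //; exact: toL1.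
  have H := @strong_limit _ nu mu mu1 noatom vol0 V2 V0 D0' a b sx s g0 f0
    (prim nu p) J a0 msx (fun eps _ => sxab eps) ms sab g2 f2 transport weak_star
    P2 J2 JE pD pend.
  apply: (small_le _ H) => eps /andP[e0 _].
  have lp2 : L2 m (lift (prim nu p)) := L2_lift mu P2.
  have lr2 : L2 m (lift (rho \_ S)) := L2_lift mu r2.
  have e2 := L2B P2 r2.
  have z : ip nu (prim nu p \- rho \_ S) (prim nu p \- rho \_ S) = 0.
    have z2 := L2_cst (fin1 nu) 0.
    have ae : {ae nu, forall x, (prim nu p \- rho \_ S) x = cst 0 x}.
      by apply: filterS rE => x /= ->; rewrite subrr.
    by rewrite (ip_ael e2 z2 e2 ae) ip0l.
  have A2 := L2B (f2 e0) lp2; have B2 := L2_lift mu e2.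
  have BB : ip m (lift (prim nu p \- rho \_ S)) (lift (prim nu p \- rho \_ S)) = 0.
    by rewrite (ip_lift mu1 e2 e2).
  have AB : ip m (f0 eps \- lift (prim nu p)) (lift (prim nu p \- rho \_ S)) = 0.
    apply/eqP; rewrite -sqrf_eq0 eq_le sqr_ge0 andbT.
    by rewrite (le_trans (ip_cauchy A2 B2)) // BB mulr0.
  have -> : f0 eps \- lift (rho \_ S) = (f0 eps \- lift (prim nu p)) \+
      lift (prim nu p \- rho \_ S).
    by apply/funext => w; rewrite /lift /=; ring.
  rewrite (ipDl A2 B2 (L2D A2 B2)) (ipDr A2 B2 A2) (ipDr A2 B2 B2).
  by rewrite AB BB (ipC _ (lift _)) AB !addr0.
Qed.

(** Both solutions are strong limits of the same family f. The argument covers D = 0 as well. *)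
Lemma diffusion_unique rho rho' : diffusion_sol l D sigstar g rho ->
  diffusion_sol l D sigstar g rho' ->
  {ae leb, forall x, S x -> rho' x = rho x}.
Proof.
move=> /strong_convergence[r2 H] /strong_convergence[r2' H'].
have e2 := L2B r2' r2.
have z : ip nu (rho' \_ S \- rho \_ S) (rho' \_ S \- rho \_ S) = 0.
  apply/eqP; rewrite eq_le ip_ge0 andbT; apply/ler_addgt0Pr => d d0; rewrite add0r.
  have SS := smallD (smallZ (ler0n R 2) H) (smallZ (ler0n R 2) H').
  have : \forall eps \near (0 : R)^'+,
      ip nu (rho' \_ S \- rho \_ S) (rho' \_ S \- rho \_ S) <= d.
    apply: filterS2 (near0 ltr01) (SS d d0) => eps /andP[e0 _] /= h.
    apply: le_trans h.
    have lr2 : L2 m (lift (rho \_ S)) := L2_lift mu r2.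
    have lr2' : L2 m (lift (rho' \_ S)) := L2_lift mu r2'.
    rewrite -(ip_lift mu1 e2 e2).
    rewrite (_ : lift _ = (f0 eps \- lift (rho \_ S)) \- (f0 eps \- lift (rho' \_ S))); last first.
      by apply/funext => w; rewrite /lift /=; ring.
    by apply: ipB_le; apply: L2B => //; exact: f2.
  by move=> /(@filter_ex _ _ (at_right_proper_filter (0 : R)))[].
apply: (ae_restr (@slab_meas R l) (@slabm_eq R l) (@slabm_compl R l) _).2.
have aer := slab_rest_ae l rho; have aer' := slab_rest_ae l rho'.
apply: filterS3 (ip_eq0 e2 z) aer aer' => x /= E <- <-.
by apply/eqP; rewrite -subr_eq0; apply/eqP.
Qed.

Lemma diffusion_limit rho : diffusion_sol l D sigstar g rho ->
  weak_L2_lim (leb \x mu)%E (S `*` V) f (fun z => rho z.1).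
Proof.
move=> /strong_convergence[r2 H].
have lr2 : L2 m (lift (rho \_ S)) := L2_lift mu r2.
have rS : (fun z : RT * RT => rho z.1) \_ SV = lift (rho \_ S) \_ SV.
  apply/funext => -[x v]; rewrite /patch; case: ifP => // /set_mem[/= xl _].
  by rewrite /lift /patch mem_set.
have rS2 : L2 m ((fun z : RT * RT => rho z.1) \_ SV).
  by rewrite rS; exact: (L2_patchT mSV SVc).
split; first by apply/(L2_restr mSV SVeq).
move=> psi Lpsi; have psi2 : L2 m (psi \_ SV) by apply/(L2_restr mSV SVeq).
pose q := psi \_ SV.
have E h : \int[(leb \x mu)%E]_(z in SV) (h z * psi z) = ip m (h \_ SV) q.
  exact: (ip_restr SVeq).
have ES := E (fun z => rho z.1); rewrite /SV in ES; rewrite ES.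
have Ef eps : \int[(leb \x mu)%E]_(z in S `*` V) (f eps z * psi z) = ip m (f0 eps) q.
  exact: E.
under eq_fun do rewrite Ef.
apply/cvgrPdist_le => d d0.
(* The summand 1 keeps K positive when [psi] vanishes. *)
pose K := Num.sqrt (ip m q q) + 1.
have K0 : 0 < K by rewrite ltr_wpDl // sqrtr_ge0.
have dK : 0 < d / K by rewrite divr_gt0.
apply: filterS2 (near0 ltr01) (small_sqrt H dK) => eps /andP[e0 _] he.
have f02 := f2 e0; have e2 := L2B f02 lr2.
rewrite distrC -(ipBl f02 rS2 psi2).
have pq : (f0 eps \- (fun z : RT * RT => rho z.1) \_ SV) =
   (f0 eps \- lift (rho \_ S)) \_ SV.
  by rewrite rS -restr_sub /f0 restrK.
have p2 := L2_patchT mSV SVc e2.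
rewrite pq (ip_ael p2 e2 psi2 (restr_ae mSV SVc (f0 eps \- lift (rho \_ S)))).
apply: le_trans (ip_cauchy_abs e2 psi2) _.
apply: (@le_trans _ _ (d / K * K)); last by rewrite divfK ?gt_eqF.
apply: ler_pM; [exact: sqrtr_ge0|exact: sqrtr_ge0|exact: he|].
by rewrite lerDl.
Qed.

(** For D = 0 the problem reads rho = g, which is solvable only if g itself lies in H^1_0; hence the
    restriction to D > 0. *)
Lemma diffusion_solution : 0 < D -> exists rho, diffusion_sol l D sigstar g rho.
Proof. exact: (diffusion_exists l0 a0 msg ab sE g2). Qed.

End DiffusionLimit.

Unset Implicit Arguments.
Set Strict Implicit.
Set Printing Implicit Defensive.

Theorem theorem1 (R : realType) (l : R) (hl : 0 < l)
  (V : set R) (hV : V = setT \/ V = [set` `]-1, 1[%R])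
  (mu : probability (measurableTypeR R) R) (hmuV : mu V = 1%E)
  (hv2 : mu.-integrable V (fun v => (v ^+ 2)%:E))
  (hmean : (\int[mu]_(v in V) v%:E = 0)%E)
  (g : R -> R) (hg : Lon (@lebesgue_measure R) 2%:E (slab l) g)
  (beta : R) (hbeta : 0 < beta <= 2)
  (sig : R -> R -> R) (a b c : R) (ha : 0 < a) (hb : 0 < b) (hc : 0 < c)
  (hsig_diff : forall eps : R, 0 < eps ->
     forall x, slab l x -> derivable (sig eps) x 1)
  (hsig_bound : forall eps : R, 0 < eps ->
     forall x, slab l x -> a <= sig eps x <= b)
  (hsig_deriv : forall eps : R, 0 < eps ->
     (norm_on (@lebesgue_measure R) +oo (slab l) (derive1 (sig eps))
        <= (c * eps `^ (- beta))%:E)%E)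
  (sigstar : R -> R) (hsigstar : weak_star_lim l sig sigstar)
  (f : R -> R * R -> R)
  (hf : forall eps : R, 0 < eps ->
     transport_sol l V mu eps (sig eps) g (f eps)) :
  let D := vavg V mu (fun v => v ^+ 2) in
  (0 < D -> exists rho : R -> R, diffusion_sol l D sigstar g rho) /\
  forall rho : R -> R, diffusion_sol l D sigstar g rho ->
    (forall rho' : R -> R, diffusion_sol l D sigstar g rho' ->
       {ae @lebesgue_measure R, forall x, slab l x -> rho' x = rho x}) /\
    weak_L2_lim (@lebesgue_measure R \x mu)%E (slab l `*` V) f
      (fun z => rho z.1).
Proof.
move=> D; have mV : measurable (V : set (measurableTypeR R)).
  by case: hV => ->; [exact: measurableT|exact: measurable_itv].
split.
  exact: (diffusion_solution hl hg ha hsig_diff hsig_bound hsigstar).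
move=> rho Hrho; split => [rho' Hrho'|].
  exact: (diffusion_unique hl mV hmuV hv2 hmean hg ha hsig_diff hsig_bound
    hsigstar hf Hrho Hrho').
exact: (diffusion_limit hl mV hmuV hv2 hmean hg ha hsig_diff hsig_bound
  hsigstar hf Hrho).
Qed.
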